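(* Assume that $\theta$ is not a negative rational number or zero and let $\lambda\in H_{\bar n}$. The super Jack polynomial $SP_\lambda(x,\tilde x;\theta)$ is then a linear combination of monomials $x^a\tilde x^b$ with $(a,b)\le({}^n\lambda,{}_n\lambda')$. Moreover, the leading term (the term with $(a,b)=({}^n\lambda,{}_n\lambda')$) is given by $$(-1)^{|{}_n\lambda|}\,b_{{}_n\lambda'}(\theta^{-1})\,x^{{}^n\lambda}\tilde x^{{}_n\lambda'}.$$
   Context: Let $\bar n=(n,\tilde n)$ be a pair of non-negative integers, $\theta$ a real parameter, $x=(x_1,\dots,x_n)$, $\tilde x=(\tilde x_1,\dots,\tilde x_{\tilde n})$ independent variables. $H_{\bar n}$ is the set of partitions $\lambda$ with $\lambda_{n+1}\le\tilde n$. For $\lambda\in H_{\bar n}$, ${}^n\lambda=(\lambda_1,\dots,\lambda_n)$, ${}_n\lambda=(\lambda_{n+1},\lambda_{n+2},\dots)$, and ${}_n\lambda'$ is the conjugate of ${}_n\lambda$, regarded as a vector in $\mathbb{Z}^{\tilde n}$ (padding by zeros). For integer vectors $a,b\in\mathbb{Z}^N$, $a\le b$ means $a_1+\dots+a_i\le b_1+\dots+b_i$ for all $i=1,\dots,N$; $x^a=x_1^{a_1}\cdots x_n^{a_n}$. $b_\lambda(\theta)=\prod_{s\in\lambda}\frac{a(s)+\theta l(s)+\theta}{a(s)+\theta l(s)+1}$, with $a(s)=\lambda_i-j$, $l(s)=\lambda'_j-i$ for $s=(i,j)$ in the diagram of $\lambda$. Let $\Lambda$ be the algebra of symmetric functions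 with power sums $p_r$; $P_\lambda=P_\lambda(\cdot;\theta)\in\Lambda$ is the (monic) Jack symmetric function with Macdonald parameter $1/\theta$: the unique eigenfunction of the form $m_\lambda+\sum_{\mu<\lambda}u_{\lambda\mu}m_\mu$ (dominance order) of the stable limit of the operators $\frac1{2\theta}\sum_ix_i^2\partial_{x_i}^2+\sum_{i\ne j}\frac{x_ix_j}{x_i-x_j}\partial_{x_i}$. The super Jack polynomial $SP_\lambda(x,\tilde x;\theta)$ is the image of $P_\lambda$ under the algebra homomorphism $\Lambda\to\mathbb{C}[x,\tilde x]$ with $p_r\mapsto\sum_{i=1}^nx_i^r-\theta^{-1}\sum_{I=1}^{\tilde n}\tilde x_I^r$ for all $r\ge1$. *)

(* Defs.v *)
From HB Require Import structures.
From mathcomp Require Import all_boot all_order all_algebra.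
From mathcomp Require Import finmap reals complex.
(* monalg and mpoly have clashing notations ({mpoly R[n]}, 'X_{1..n}): only
   those of mpoly are wanted. *)
From mathcomp Require Import -(notations) monalg.
From mathcomp Require Import mpoly.

Set Implicit Arguments.
Unset Strict Implicit.
Unset Printing Implicit Defensive.

Import GRing.Theory.
Local Open Scope ring_scope.
Local Notation "x %:F" := (tofrac x) : ring_scope.

(* A partition is the list of its positive parts, in weakly decreasing order:
   lambda_(i+1) is nth 0 la i, which is 0 beyond the length. *)
Definition is_partition (la : seq nat) : bool :=
  sorted geq la && (0%N \notin la).

Definition part (la : seq nat) (i : nat) : nat := nth 0%N la i.

Definition conj_part (la : seq nat) : seq nat :=
  [seq count (fun k => j < k)%N la | j <- iota 0 (part la 0)].

Definition dominated (mu la : seq nat) : Prop :=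
  sumn mu = sumn la /\
  forall k : nat, (sumn (take k mu) <= sumn (take k la))%N.

(* H_(n, nt): the fat hook lambda_(n+1) <= nt. *)
Definition in_hook (n nt : nat) (la : seq nat) : bool := (part la n <= nt)%N.

(* The box (i + 1, j + 1) is indexed from 0 by (i, j). *)
Definition arm (la : seq nat) (i j : nat) : nat := (part la i - j.+1)%N.
Definition leg (la : seq nat) (i j : nat) : nat :=
  (part (conj_part la) j - i.+1)%N.

Definition jack_b (K : fieldType) (theta : K) (la : seq nat) : K :=
  \prod_(i < size la) \prod_(j < part la i)
    (((arm la i j)%:R + theta * (leg la i j)%:R + theta) /
     ((arm la i j)%:R + theta * (leg la i j)%:R + 1)).

(* In characteristic 0 the algebra of symmetric functions is the free
   commutative algebra on the power sums p_1, p_2, ...: the monoid algebra of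
   the monomials in countably many variables, variable number r standing for
   p_(r+1). *)
Notation symfun K := (malg (cmonom nat) K).

Definition psum (K : fieldType) (r : nat) : symfun K := mkmalgU (ucm r.-1) 1.

Section PowerSumSubstitution.
Variables (K : fieldType) (N : nat) (q : nat -> {mpoly K[N]}).

Definition subst_mon (m : cmonom nat) : {mpoly K[N]} :=
  \prod_(r <- finsupp m) q r.+1 ^+ m r.

Lemma subst_monEw (d : {fset nat}) (m : cmonom nat) :
  fsubset (finsupp m) d -> subst_mon m = \prod_(r <- d) q r.+1 ^+ m r.
Proof.
move=> le; rewrite /subst_mon (big_fset_incl _ le) // => i _.
by rewrite -cmE_neq0 negbK => /eqP ->; rewrite expr0.
Qed.

Fact subst_mon_mmorphism : mmorphism subst_mon.
Proof.
split=> [m1 m2|]; last by rewrite /subst_mon mdom1 big_seq_fset0.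
pose d := fsetU (finsupp m1) (finsupp m2).
rewrite (@subst_monEw d) ?mdomD // (@subst_monEw d m1) ?fsubsetUl //.
rewrite (@subst_monEw d m2) ?fsubsetUr // -big_split /=.
by apply: eq_bigr => i _; rewrite cmM exprD.
Qed.

HB.instance Definition _ :=
  isMultiplicative.Build (cmonom nat) {mpoly K[N]} subst_mon
    subst_mon_mmorphism.

(* The algebra homomorphism with p_r |-> q r for all r >= 1. *)
Definition subst_psum : symfun K -> {mpoly K[N]} :=
  monalg.mmap (@mpolyC N K) subst_mon.

HB.instance Definition _ := GRing.RMorphism.on subst_psum.

Fact subst_psum_scalable : scalable subst_psum.
Proof. by move=> c f; rewrite /subst_psum monalg.mmapZ mul_mpolyC. Qed.

HB.instance Definition _ :=
  GRing.isScalable.Build K (symfun K) {mpoly K[N]} *:%R subst_psum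
    subst_psum_scalable.

Lemma subst_psumE (r : nat) : (0 < r)%N -> subst_psum (psum K r) = q r.
Proof.
move=> r0; rewrite /subst_psum /psum monalg.mmapU [X in X * _]mpolyC1 mul1r.
by rewrite /= /subst_mon mdomU big_seq_fset1 cmUU expr1 prednK.
Qed.

End PowerSumSubstitution.

Section Jack.
Variable K : fieldType.

(* f(x_1, ..., x_N) *)
Definition restrict (N : nat) : symfun K -> {mpoly K[N]} :=
  subst_psum (fun r => \sum_(i < N) 'X_i ^+ r).

(* m_la(x_1, ..., x_N): the sum of the distinct monomials whose nonzero
   exponents are a rearrangement of la (so 0 when N is less than the length
   of la); such monomials have degree |la|. *)
Definition monomial_sym (N : nat) (la : seq nat) : {mpoly K[N]} :=
  \sum_(m : 'X_{1..N < (sumn la).+1} |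
        perm_eq [seq k <- [seq (m : 'X_{1..N}) i | i <- enum 'I_N] | k != 0%N]
                la)
    'X_[m].

(* The individual terms of the operator only map into rational functions. *)
Definition jack_op (theta : K) (N : nat) (f : {mpoly K[N]}) :
    {fraction {mpoly K[N]}} :=
  ((2%:R * theta)^-1 *: \sum_(i < N) ('X_i ^+ 2 * mderiv i (mderiv i f)))%:F
  + \sum_(i < N) \sum_(j < N | i != j)
      ('X_i * 'X_j)%:F / ('X_i - 'X_j)%:F * (mderiv i f)%:F.

Definition stable_limit (theta : K) (L : symfun K -> symfun K) : Prop :=
  forall (N : nat) (f : symfun K),
    jack_op theta (restrict N f) = (restrict N (L f))%:F.

Definition monic_triangular (la : seq nat) (P : symfun K) : Prop :=
  exists (s : seq (seq nat)) (u : seq nat -> K),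
    (forall mu, mu \in s ->
       [/\ is_partition mu, dominated mu la & mu <> la]) /\
    (forall N : nat,
       restrict N P =
       monomial_sym N la + \sum_(mu <- s) u mu *: monomial_sym N mu).

Definition is_jack (theta : K) (la : seq nat) (P : symfun K) : Prop :=
  (exists L : symfun K -> symfun K,
     stable_limit theta L /\ exists e : K, L P = e *: P) /\
  monic_triangular la P.

(* The variables of {mpoly K[n + nt]} are x_i = 'X_(lshift nt i) and
   tilde x_j = 'X_(rshift n j). *)
Definition super_psum (theta : K) (n nt r : nat) : {mpoly K[n + nt]} :=
  \sum_(i < n) 'X_(lshift nt i) ^+ r
  - theta^-1 *: \sum_(j < nt) 'X_(rshift n j) ^+ r.

Definition superize (theta : K) (n nt : nat) : symfun K -> {mpoly K[n + nt]} :=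
  subst_psum (super_psum theta n nt).

Definition is_super_jack (theta : K) (n nt : nat) (la : seq nat)
    (SP : {mpoly K[n + nt]}) : Prop :=
  exists2 P : symfun K, is_jack theta la P & SP = superize theta n nt P.

End Jack.

(* The order on exponent vectors by partial sums; total degrees need not
   agree. *)
Definition partial_sum_le (N : nat) (a b : 'X_{1..N}) : Prop :=
  forall i : 'I_N,
    (\sum_(k < N | (k <= i)%N) a k <= \sum_(k < N | (k <= i)%N) b k)%N.

Definition join_exp (n nt : nat) (a b : nat -> nat) : 'X_{1..(n + nt)} :=
  [multinom match split k with inl i => a i | inr j => b j end | k < n + nt].

(* Main.v *)
Require Import Defs.
From HB Require Import structures.
From mathcomp Require Import all_boot all_order all_algebra.
From mathcomp Require Import fingroup perm.
From mathcomp Require Import finmap reals complex.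
From mathcomp Require Import -(notations) monalg.
From mathcomp Require Import mpoly.
From mathcomp Require Import zify ring.
Set Implicit Arguments.
Unset Strict Implicit.
Unset Printing Implicit Defensive.
Import Order.TTheory GRing.Theory Num.Theory.
Local Open Scope ring_scope.

(** Let [kappa] be the inverse of [theta].  A word in two letters specifies, for
    each variable [X_i], whether it contributes [X_i^r] (letter [false]) or
    [- kappa X_i^r] (letter [true]) to the power sum [p_r]; each word thus gives
    a specialization of the Jack function, and the super Jack polynomial belongs to
    the word with [n] letters [false] followed by [nt] letters [true].  Both
    assertions are proved for all words at once.  The leading exponent of a word
    is obtained by peeling [la]: a letter [false] removes the first remaining row,
    a letter [true] the first remaining column ([wlead]).

    Support.  The single eigenvalue of the Jack operator is too coarse to
    recognize the leading exponent of a word.  So the operator is deformed: over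
    the polynomials in a parameter [h], with [s = 1 - h] and [q = 1 + h c], there
    is a difference operator [stabop] on symmetric functions which every word
    turns into a Macdonald-type difference operator, where a letter [true]
    exchanges the roles of [s] and [q] ([discr_stabop]; this rests on
    partial fractions and Newton's identities).  These operators are triangular
    for the order by partial sums ([qdiff_mcoeff]), and their eigenvalue at an
    exponent is, up to a common factor, the sum of [s^r q^k] over boxes [(r, k)]
    attached to it ([qdiff_eigE]).  For suitable [c] the monomials [s^r q^k]
    have distinct degrees in [h], so that an eigenvalue determines the boxes and
    hence the exponent.  The Jack operator appears as the third-order term in
    [h], and the Jack function lifts to an eigenvector of [stabop]: remove from
    any lift, by the triangular operators, the eigenvalues of all lower partitions; since the
    Jack eigenvalues of comparable partitions differ when [theta] is not a
    nonpositive rational, this does not destroy the value at [h = 0]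
    ([eigenvector_lift]).  Setting [h = 0] yields the support for every word
    ([word_support]).

    Leading coefficient.  Every specialization satisfies
    [(kappa d_x + d_t) F = 0] on [x = t], for a variable [x] of letter [false]
    and a variable [t] of letter [true] ([quasi_invariance]).  For neighbouring
    variables the support of [F], known for the word and for the word with the
    two letters exchanged, leaves two terms in this equation, which relates the
    leading coefficients of the two words by an explicit factor attached to a box
    of [la] ([wlead_coef_swap]).  Start from the word with many letters [false]
    followed by [nt] letters [true], whose leading term is that of the Jack
    function itself, with coefficient [1], and move the block of letters [true] to the left
    up to position [n]; the variables behind it do not occur in the leading term.
    The boxes passed are those below row [n] of [la], and the product of their
    factors is the asserted coefficient ([wlead_coef_hook], [prod_swap_factor]). *)

(** * Polynomials in power sums *)

Lemma mpoly_ring_ind (n : nat) (R : comRingType) (P : {mpoly R[n]} -> Prop) :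
  (forall c, P c%:MP) -> (forall i, P 'X_i) ->
  (forall p q, P p -> P q -> P (p + q)) ->
  (forall p q, P p -> P q -> P (p * q)) -> forall p, P p.
Proof.
move=> PC PX PD PM p; rewrite (mpolyE p).
apply: (big_ind P); [by rewrite -mpolyC0; apply: PC | exact: PD | move=> m _].
rewrite -mul_mpolyC; apply: (PM); first exact: PC.
rewrite mpolyXE_id; apply: (big_ind P);
  [by rewrite -mpolyC1; apply: PC | exact: PM | move=> i _].
elim: (m i) => [|k IHk]; first by rewrite expr0 -mpolyC1; apply: PC.
by rewrite exprS; apply: (PM).
Qed.

Lemma mderiv_mmap (D N : nat) (R : comRingType) (q : 'I_D -> {mpoly R[N]})
    (i : 'I_N) (f : {mpoly R[D]}) :
  mderiv i (mmap (@mpolyC N R) q f) =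
  \sum_(r < D) mmap (@mpolyC N R) q (mderiv r f) * mderiv i (q r).
Proof.
elim/mpoly_ring_ind: f => [c|j|f g IHf IHg|f g IHf IHg].
- rewrite mmapC mderivC big1 // => r _.
  by rewrite mderivC mmap0 mul0r.
- rewrite mmapX mmap1U (bigD1 j) //= big1 => [|r rj].
    have U0 : (U_(j) - U_(j))%MM = 0%MM :> 'X_{1..D}.
      by apply/mnmP => l; rewrite mnmBE subnn mnm0E.
    by rewrite addr0 mderivX mnm1E eqxx scale1r U0 mpolyX0 rmorph1 mul1r.
  by rewrite mderivX mnm1E eq_sym (negbTE rj) scale0r mmap0 mul0r.
- rewrite mmapD mderivD IHf IHg -big_split /=; apply: eq_bigr => r _.
  by rewrite mderivD mmapD mulrDl.
- rewrite rmorphM mderivM IHf IHg mulr_suml mulr_sumr -big_split /=.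
  apply: eq_bigr => r _; rewrite mderivM mmapD !rmorphM /=; ring.
Qed.

Lemma mderiv_varX (N : nat) (R : comRingType) (i j : 'I_N) (l : nat) :
  mderiv i ('X_j ^+ l) = (l%:R * (j == i)%:R) *: 'X_i ^+ l.-1 :> {mpoly R[N]}.
Proof.
rewrite mpolyXn mderivX mulmnE mnm1E.
have [->|_] := eqVneq j i; last by rewrite mul0n mulr0 !scale0r.
rewrite mul1n mulr1; case: l => [|l]; first by rewrite !scale0r.
by rewrite mulmS addmC addmK mpolyXn.
Qed.

(** Apply each derivation [d/dX_i] to a relation [f] between the power sums:
    the chain rule makes [X_i] a root of the one-variable polynomial whose
    coefficient of index [l] is a nonzero multiple of the specialization of
    [d_l f].  It has degree less than [D] and [N >= D] distinct roots, so every
    [d_l f] is again a relation, of smaller size, and thus zero by induction: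
    [f] is a constant. *)
Lemma powersum_indep (R : idomainType) (D N : nat) (c : 'I_D -> R)
    (f : {mpoly R[D]}) :
  (forall k, k.+1%:R != 0 :> R) -> (forall r, c r != 0) -> (D <= N)%N ->
  mmap (@mpolyC N R) (fun r => c r *: \sum_(i < N) 'X_i ^+ r.+1) f = 0 ->
  f = 0.
Proof.
move=> char0 c_neq0 leDN; set q := (fun r => _).
have [k lt_fk] := ubnP (msize f); elim: k f lt_fk => // k IHk f lt_fk f0.
have [//|f_neq0] := eqVneq f 0.
have df0 r : mderiv r f = 0.
  apply: IHk.
    move: f_neq0; rewrite -msize_poly_eq0 => f_neq0.
    have [->|df_neq0] := eqVneq (mderiv r f) 0; first by rewrite msize0; lia.
    suff : (msize (mderiv r f) <= (msize f).-1)%N by lia.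
    rewrite msizeE; apply/bigmax_leqP_seq => m mf _.
    have mUf : (m + U_(r))%MM \in msupp f.
      rewrite mcoeff_msupp; move: mf; rewrite mcoeff_msupp mcoeff_deriv.
      by apply: contra_neq => ->; rewrite mul0rn.
    have := msize_mdeg_lt mUf; rewrite mdegD mdeg1; lia.
  pose g r := mmap (@mpolyC N R) q (mderiv r f).
  pose a l := oapp (fun r : 'I_D => (r.+1%:R * c r) *: g r) 0 (insub l).
  have aE (l : 'I_D) : a l = (l.+1%:R * c l) *: g l by rewrite /a valK.
  pose G : {poly {mpoly R[N]}} := \poly_(l < D) a l.
  have rootG i : root G 'X_i.
    apply/rootP; transitivity (mderiv i (mmap (@mpolyC N R) q f)); last first.
      by rewrite f0 raddf0.
    rewrite /G horner_poly mderiv_mmap.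
    apply: eq_bigr => l _; rewrite aE.
    have -> : mderiv i (q l) = (c l * l.+1%:R) *: 'X_i ^+ l.
      rewrite /q mderivZ (raddf_sum (mderiv i)) (bigD1 i) //= big1 ?addr0.
        by rewrite mderiv_varX eqxx mulr1 scalerA.
      by move=> j ji; rewrite mderiv_varX (negbTE ji) mulr0 scale0r.
    by rewrite -scalerAl -scalerAr mulrC.
  have G0 : G = 0.
    apply/eqP; apply: contraT => Gn0.
    have sG := size_poly D a.
    suff : (size [seq 'X_i : {mpoly R[N]} | i <- enum 'I_N] < size G)%N.
      by rewrite size_map size_enum_ord ltnNge (leq_trans sG leDN).
    apply: max_poly_roots Gn0 _ _; first by apply/allP => x /mapP[i _ ->].
    rewrite map_inj_uniq ?enum_uniq // => i j /(congr1 (mcoeff U_(i)%MM)).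
    rewrite !mcoeffXU eqxx; case: eqVneq => // _ /eqP.
    by rewrite oner_eq0.
  have : G`_r = 0 by rewrite G0 coef0.
  rewrite coef_poly ltn_ord aE; move/eqP.
  rewrite mscalerI mulf_eq0 (negbTE (char0 _)) (negbTE (c_neq0 _)).
  by move/eqP.
have fC : f = (f@_0)%:MP.
  apply/mpolyP => m; rewrite mcoeffC; have [->|m_neq0] := eqVneq m 0%MM.
    by rewrite mulr1.
  rewrite mulr0; have [r mr] : exists r, m r != 0%N.
    apply/existsP; apply: contraNT m_neq0 => /existsPn m0.
    by apply/eqP/mnmP => i; rewrite mnm0E; apply/eqP; have := m0 i; rewrite negbK.
  have /(congr1 (mcoeff (m - U_(r))%MM)) := df0 r.
  rewrite mcoeff_deriv submK ?lep1mP // mcoeff0 -mulr_natr => /eqP.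
  by rewrite mulf_eq0 (negbTE (char0 _)) orbF => /eqP.
by move: f0; rewrite fC mmapC => /eqP; rewrite mpolyC_eq0 => /eqP ->.
Qed.

(** * Exponents under the partial-sum order *)

(** The possibility that [u] lies outside [s] is what makes this usable on
    supports of polynomials. *)
Lemma big_seq_single (R : nmodType) (I : eqType) (s : seq I) (u : I)
    (g : I -> R) :
  uniq s -> (forall a, a \in s -> a != u -> g a = 0) ->
  (u \notin s -> g u = 0) -> \sum_(a <- s) g a = g u.
Proof.
move=> us g0 gu; have [us'|/[dup] nus /gu ->] := boolP (u \in s); last first.
  by rewrite big_seq big1 // => a sa; apply: g0 => //; apply: contraNneq nus => <-.
rewrite (bigD1_seq u) //= big_seq_cond big1 ?addr0 // => a /andP[sa au].
exact: g0.
Qed.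

Section PartialSumOrder.
Variable M : nat.
Implicit Types a b m : 'X_{1..M}.

Definition psums m (i : 'I_M) : nat := (\sum_(k < M | (k <= i)%N) m k)%N.

Definition ple a b : bool := [forall i, (psums a i <= psums b i)%N].

(** A numerical companion of [ple]: strictly monotone, and equal ranks of
    comparable exponents force equality, so it serves for inductions. *)
Definition rank m : nat := (\sum_i psums m i)%N.

Lemma pleP a b : reflect (partial_sum_le a b) (ple a b).
Proof. exact: forallP. Qed.

Lemma psumsD a b i : psums (a + b)%MM i = (psums a i + psums b i)%N.
Proof. by rewrite /psums -big_split; apply: eq_bigr => k _; rewrite mnmDE. Qed.

Lemma psums_inj a b : (forall i, psums a i = psums b i) -> a = b.
Proof.
move=> Eab; apply/mnmP => -[i iM].
elim/ltn_ind: i iM => i IHi iM; have := Eab (Ordinal iM).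
rewrite /psums (bigD1 (Ordinal iM)) //= [in RHS](bigD1 (Ordinal iM)) //=.
rewrite (eq_bigr b) => [|[k kM] /andP[ki kNi]]; first by move/addIn.
by apply: IHi; move: ki kNi; rewrite -val_eqE /= ltn_neqAle => -> ->.
Qed.

Lemma ple_refl a : ple a a. Proof. by apply/forallP. Qed.

Lemma ple_trans b a c : ple a b -> ple b c -> ple a c.
Proof.
by move=> /forallP ab /forallP bc; apply/forallP => i; apply: leq_trans (bc i).
Qed.

Lemma ple_add a b a' b' : ple a b -> ple a' b' -> ple (a + a')%MM (b + b')%MM.
Proof.
move=> /forallP ab /forallP ab'; apply/forallP => i.
by rewrite !psumsD leq_add.
Qed.

Lemma ple_cancel a b u v : ple a u -> (a + b = u + v)%MM -> ple v b.
Proof.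
move=> /forallP au E; apply/forallP => i; have := au i.
have : (psums a i + psums b i = psums u i + psums v i)%N by rewrite -!psumsD E.
by lia.
Qed.

Lemma ple_rank a b : ple a b -> (rank a <= rank b)%N.
Proof. by move=> /forallP ab; apply: leq_sum. Qed.

Lemma ple_eq_rank a b : ple a b -> (rank b <= rank a)%N -> a = b.
Proof.
move=> /forallP ab le_ba; apply: psums_inj => i.
have : (rank a == rank b)%N.
  by rewrite eqn_leq le_ba andbT; apply: ple_rank; apply/forallP.
have /leqif_sum H : forall i, true ->
    (psums a i <= psums b i ?= iff (psums a i == psums b i))%N by [].
by rewrite /rank H => /forallP/(_ i)/eqP.
Qed.

Lemma ple_anti a b : ple a b -> ple b a -> a = b.
Proof. by move=> ab /ple_rank; apply: ple_eq_rank. Qed.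

Lemma ex_ple_max (s : seq 'X_{1..M}) m : m \in s ->
  exists2 m', m' \in s & ple m m' /\ {in s, forall m'', ple m' m'' -> m'' = m'}.
Proof.
pose B := (\max_(a <- s) rank a)%N.
have [k] := ubnP (B - rank m)%N; elim: k m => // k IHk m lt_k sm.
have [/hasP[m' sm' /andP[mm' nmm']]|/hasPn mmax] :=
    boolP (has (fun m' => ple m m' && (m' != m)) s).
  have lt_mm' : (rank m < rank m')%N.
    rewrite ltnNge; apply: contra nmm' => le.
    by rewrite eq_sym; apply/eqP; apply: ple_eq_rank.
  have le_B : (rank m' <= B)%N by rewrite /B; apply: leq_bigmax_seq.
  have [||m1 sm1 [le1 max1]] := IHk m' => //; first by lia.
  by exists m1 => //; split=> //; apply: ple_trans mm' le1.
exists m => //; split; first exact: ple_refl.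
move=> m' sm' mm'; apply/eqP; have := mmax _ sm'; rewrite mm' /=.
by rewrite negbK.
Qed.

End PartialSumOrder.

Section Leading.
Variables (M : nat) (R : idomainType).
Implicit Types (F G U V : {mpoly R[M]}) (u v m : 'X_{1..M}) (c d : R).

(** The coefficient [c] may vanish, in which case [u] is only an upper bound of
    the support; this makes the notion stable under products without
    nonvanishing conditions. *)
Definition leads U u c : Prop := {in msupp U, forall m, ple m u} /\ U@_u = c.

Lemma mcoeffM_msupp F G m :
  (F * G)@_m = \sum_(a <- msupp F) \sum_(b <- msupp G)
    F@_a * G@_b * ((a + b)%MM == m)%:R.
Proof.
rewrite mpolyME (big_morph _ (mcoeffD m) (mcoeff0 _ m)).
rewrite big_allpairs /=; apply: eq_bigr => a _; apply: eq_bigr => b _.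
by rewrite mcoeffZ mcoeffX.
Qed.

(** Two exponents [a <= u] and [b] with [a + b = u + m] satisfy [m <= b], so
    that maximality of [m] leaves a single product. *)
Lemma mcoeffM_leads U u c F m : leads U u c ->
  {in msupp F, forall m', ple m m' -> m' = m} -> (U * F)@_(u + m) = c * F@_m.
Proof.
move=> [leU <-] maxm; rewrite mcoeffM_msupp.
have zero a b : a \in msupp U -> b \in msupp F -> (a, b) != (u, m) ->
    ((a + b)%MM == (u + m)%MM) = false.
  move=> Ua Fb; apply: contraNF => /eqP E.
  have Eb : b = m by apply: maxm => //; apply: ple_cancel (leU _ Ua) E.
  by move: E; rewrite Eb => /addIm ->.
rewrite (@big_seq_single _ _ _ u) ?msupp_uniq //=; first last.
- by move=> /memN_msupp_eq0 ->; rewrite big1 // => b _; rewrite !mul0r.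
- move=> a Ua au; rewrite big_seq big1 // => b Fb.
  by rewrite zero ?mulr0 // xpair_eqE negb_and au.
have [Uu|/memN_msupp_eq0 ->] := boolP (u \in msupp U); last first.
  by rewrite mul0r big1 // => b _; rewrite !mul0r.
rewrite (@big_seq_single _ _ _ m) ?msupp_uniq ?eqxx ?mulr1 //=.
  by move=> b Fb bm; rewrite zero ?mulr0 // xpair_eqE negb_and bm orbT.
by move=> /memN_msupp_eq0 ->; rewrite mulr0.
Qed.

Lemma leads1 : leads 1 0%MM 1.
Proof.
split=> [m|]; last by rewrite mcoeff1 eqxx.
by rewrite msupp1 inE => /eqP ->; apply: ple_refl.
Qed.

Lemma leadsM U u c V v d : leads U u c -> leads V v d ->
  leads (U * V) (u + v)%MM (c * d).
Proof.
move=> [leU cU] [leV cV]; split=> [m /msuppM_le/allpairsP[[a b] /= [Ua Vb ->]]|].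
  by apply: ple_add; [apply: leU | apply: leV].
rewrite (@mcoeffM_leads U u c) ?cV //.
by move=> m' Vm' vm'; apply: ple_anti => //; apply: leV.
Qed.

Lemma leads_prod (I : Type) (r : seq I) (P : pred I) (F : I -> {mpoly R[M]})
    (u : I -> 'X_{1..M}) (c : I -> R) :
  (forall i, P i -> leads (F i) (u i) (c i)) ->
  leads (\prod_(i <- r | P i) F i) (\sum_(i <- r | P i) u i)%MM
    (\prod_(i <- r | P i) c i).
Proof.
move=> ldF; elim/big_rec3: _ => [|i x y z Pi]; first exact: leads1.
by move=> ld; apply: leadsM ld; apply: ldF.
Qed.

Lemma leadsZ c U u d : leads U u d -> leads (c *: U) u (c * d).
Proof.
move=> [leU <-]; split; last by rewrite mcoeffZ.
by move=> m /msuppZ_le; apply: leU.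
Qed.

Lemma psums_mnm1 (l i : 'I_M) : psums U_(l)%MM i = (l <= i)%N.
Proof.
rewrite /psums big_mkcond (bigD1 l) //= mnm1E eqxx big1 => [|j jl].
  by rewrite addn0; case: (l <= i)%N.
by rewrite mnm1E eq_sym (negbTE jl); case: ifP.
Qed.

Lemma ple_mnm1 (k l : 'I_M) : (k <= l)%N -> ple U_(l)%MM U_(k)%MM.
Proof.
move=> kl; apply/forallP => i; rewrite !psums_mnm1.
by case: (leqP l i) => // /(leq_trans kl) ->.
Qed.

Definition minord (k l : 'I_M) : 'I_M := if (k < l)%N then k else l.

Lemma leads_linear (k l : 'I_M) (a : R) : k != l ->
  leads ('X_k - a *: 'X_l) U_(minord k l)%MM (if (k < l)%N then 1 else - a).
Proof.
move=> kl; split=> [m|].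
  move=> /msuppB_le; rewrite mem_cat => /orP[|/msuppZ_le];
    rewrite msuppX inE => /eqP ->; apply: ple_mnm1; rewrite /minord;
    by case: ltnP => //; lia.
rewrite mcoeffB mcoeffZ !mcoeffXU /minord; case: ifP => _.
  by rewrite eqxx eq_sym (negbTE kl) mulr0 subr0.
by rewrite eqxx (negbTE kl) mulr1 sub0r.
Qed.

End Leading.

(** * Triangular difference operators *)

Section DifferenceOperator.
Variables (M : nat) (R : idomainType) (tau sig : 'I_M -> R).
Implicit Types (F G : {mpoly R[M]}) (m : 'X_{1..M}) (i : 'I_M).

(** The product runs over ordered pairs: up to sign it is the square of the
    Vandermonde determinant, and the factors with a given first index split
    off without signs. *)
Definition discr : {mpoly R[M]} := \prod_k \prod_(l | l != k) ('X_k - 'X_l).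

Definition discr_co i : {mpoly R[M]} :=
  \prod_(k | k != i) \prod_(l | l != k) ('X_k - 'X_l).

(** Divided by [discr], this is the coefficient
    [(1 - tau_i) * \prod_(l | l != i) (X_i - tau_l X_l) / (X_i - X_l)]
    of a Macdonald difference operator with one parameter per variable. *)
Definition dnum i : {mpoly R[M]} :=
  (1 - tau i) *: ((\prod_(l | l != i) ('X_i - tau l *: 'X_l)) * discr_co i).

Definition dilate i F : {mpoly R[M]} :=
  mmap (@mpolyC M R) (fun j => (if j == i then sig i else 1) *: 'X_j) F.

Definition qdiff F : {mpoly R[M]} := \sum_i dnum i * (dilate i F - F).

(** In [dnum i] the leading factor of [X_i - tau_l X_l] is [- tau_l X_l] for
    [l < i] and [X_i] for [i < l], which is where the product comes from. *)
Definition qdiff_eig m : R :=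
  \sum_i (1 - tau i) * (\prod_(l < M | (l < i)%N) tau l) * (sig i ^+ m i - 1).

Lemma discrE i : discr = \prod_(l | l != i) ('X_i - 'X_l) * discr_co i.
Proof. by rewrite /discr (bigD1 i). Qed.

Lemma dilateD i F G : dilate i (F + G) = dilate i F + dilate i G.
Proof. exact: mmapD. Qed.

Lemma dilateM i F G : dilate i (F * G) = dilate i F * dilate i G.
Proof. exact: (rmorphM (mmap (@mpolyC M R) _)). Qed.

Lemma mcoeff_dilate i F m : (dilate i F)@_m = sig i ^+ m i * F@_m.
Proof.
have mmapk k : mmap1 (fun j => (if j == i then sig i else 1) *: 'X_j) k =
    sig i ^+ k i *: 'X_[k] :> {mpoly R[M]}.
  rewrite /mmap1 mpolyXE_id -mul_mpolyC (bigD1 i) //= eqxx exprZn.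
  rewrite [in RHS](bigD1 i) //= mulrA mul_mpolyC; congr (_ * _).
  by apply: eq_bigr => j /negbTE ->; rewrite scale1r.
rewrite /dilate /mmap (raddf_sum (mcoeff m)) /=.
rewrite (@big_seq_single _ _ _ m) ?msupp_uniq //.
- by rewrite mmapk mcoeffCM mcoeffZ mcoeffX eqxx mulr1 mulrC.
- by move=> k _ /negbTE km; rewrite mmapk mcoeffCM mcoeffZ mcoeffX km !mulr0.
- by move=> /memN_msupp_eq0 ->; rewrite mpolyC0 mul0r mcoeff0.
Qed.

Lemma mcoeff_dilateB i F m : (dilate i F - F)@_m = (sig i ^+ m i - 1) * F@_m.
Proof. by rewrite mcoeffB mcoeff_dilate mulrBl mul1r. Qed.

Lemma msupp_dilateB i F : {subset msupp (dilate i F - F) <= msupp F}.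
Proof.
move=> m; rewrite !mcoeff_msupp mcoeff_dilateB mulf_eq0 negb_or.
by case/andP.
Qed.

Definition discr_mon : 'X_{1..M} :=
  (\sum_(k < M) \sum_(l < M | l != k) U_(minord k l))%MM.

Definition discr_lc : R :=
  \prod_(k < M) \prod_(l < M | l != k) (if (k < l)%N then 1 else - 1).

Lemma leads_diff (k l : 'I_M) : l != k ->
  leads ('X_k - 'X_l) U_(minord k l)%MM (if (k < l)%N then 1 else - 1 : R).
Proof.
move=> lk; have := @leads_linear M R k l 1; rewrite scale1r; apply.
by rewrite eq_sym.
Qed.

Lemma leads_discr : leads discr discr_mon discr_lc.
Proof.
apply: leads_prod => k _; apply: leads_prod => l lk; exact: leads_diff.
Qed.

Lemma leads_dnum i : leads (dnum i) discr_mon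
  ((1 - tau i) * (\prod_(l < M | (l < i)%N) tau l) * discr_lc).
Proof.
have -> : (1 - tau i) * (\prod_(l < M | (l < i)%N) tau l) * discr_lc =
    (1 - tau i) * (\prod_(l < M | l != i) (if (i < l)%N then 1 else - tau l) *
      \prod_(k < M | k != i) \prod_(l < M | l != k)
         (if (k < l)%N then 1 else - 1)).
  rewrite -mulrA; congr (_ * _).
  rewrite {1}/discr_lc [X in _ * X](bigD1 i) //= mulrA; congr (_ * _).
  rewrite big_mkcond [X in _ * X]big_mkcond -big_split /= [RHS]big_mkcond /=.
  apply: eq_bigr => l _; rewrite -val_eqE /=.
  by case: ltngtP; rewrite ?mul1r ?mulr1 ?mulrN1.
have -> : discr_mon = ((\sum_(l < M | l != i) U_(minord i l)) +
    (\sum_(k < M | k != i) \sum_(l < M | l != k) U_(minord k l)))%MM.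
  by rewrite /discr_mon (bigD1 i).
apply: leadsZ; apply: leadsM; apply: leads_prod => k ki.
  by apply: leads_linear; rewrite eq_sym.
by apply: leads_prod => l lk; apply: leads_diff.
Qed.

Lemma discr_lc_neq0 : discr_lc != 0.
Proof.
apply/prodf_neq0 => k _; apply/prodf_neq0 => l _.
by case: ifP => _; rewrite ?oppr_eq0 oner_eq0.
Qed.

Lemma discr_neq0 : discr != 0.
Proof.
have [_ lc] := leads_discr; apply: contra_neq discr_lc_neq0 => D0.
by rewrite -lc D0 mcoeff0.
Qed.

Lemma mcoeff_qdiff F m :
  {in msupp F, forall m', ple m m' -> m' = m} ->
  (qdiff F)@_(discr_mon + m) = discr_lc * (qdiff_eig m * F@_m).
Proof.
move=> maxm; rewrite /qdiff /qdiff_eig (raddf_sum (mcoeff _)) mulr_suml mulr_sumr.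
apply: eq_bigr => i _; rewrite /= (mcoeffM_leads (leads_dnum i)); last first.
  by move=> m' /msupp_dilateB; apply: maxm.
by rewrite mcoeff_dilateB; ring.
Qed.

(** The coefficient of a maximal exponent of [G] survives in [discr * G],
    since [discr] has a nonzero leading coefficient. *)
Lemma qdiff_msupp F G : discr * G = qdiff F ->
  {in msupp G, forall m, exists2 m', m' \in msupp F & ple m m'}.
Proof.
move=> E m /ex_ple_max[m1 Gm1 [mm1 max1]].
have : (qdiff F)@_(discr_mon + m1) != 0.
  rewrite -E (mcoeffM_leads leads_discr) // mulf_neq0 ?discr_lc_neq0 //.
  by rewrite -mcoeff_msupp.
rewrite (raddf_sum (mcoeff _)) => nz.
have [i nzi] : exists i, (dnum i * (dilate i F - F))@_(discr_mon + m1) != 0.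
  apply/existsP; apply: contraNT nz => /existsPn z; rewrite big1 // => i _.
  by apply/eqP; have := z i; rewrite negbK.
rewrite -mcoeff_msupp in nzi.
have /allpairsP[[a b] /= [Na Fb Eab]] := msuppM_le nzi.
exists b; first exact: msupp_dilateB Fb.
apply: ple_trans mm1 _; apply: ple_cancel (esym Eab).
exact: (leads_dnum i).1.
Qed.

(** The operator [F |-> qdiff F / discr] is triangular for [ple], with diagonal
    entries [qdiff_eig]. *)
Lemma qdiff_mcoeff F G m : discr * G = qdiff F ->
  {in msupp F, forall m', ple m m' -> m' = m} ->
  G@_m = qdiff_eig m * F@_m.
Proof.
move=> E maxm; apply: (mulfI discr_lc_neq0); rewrite -mcoeff_qdiff // -E.
rewrite (mcoeffM_leads leads_discr) // => m' /(qdiff_msupp E)[m'' Fm''] le1 le2.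
have Em : m'' = m by apply: maxm => //; apply: ple_trans le2 le1.
by apply: ple_anti => //; rewrite -Em.
Qed.

End DifferenceOperator.

(** * Partial fractions and Newton's identities *)

Section TruncatedSeries.
Variable (R : comNzRingType).
Implicit Types (P Q W : {poly R}) (n k : nat).

(** Congruence of power series modulo [X^(n + 1)]. *)
Definition eqm n P Q : Prop := forall k, (k <= n)%N -> P`_k = Q`_k.

Lemma eqm_refl n P : eqm n P P. Proof. by []. Qed.

Lemma eqm_sym n P Q : eqm n P Q -> eqm n Q P.
Proof. by move=> E k /E. Qed.

Lemma eqm_trans n P Q W : eqm n P Q -> eqm n Q W -> eqm n P W.
Proof. by move=> E1 E2 k kn; rewrite E1 ?E2. Qed.

Lemma eqmD n P Q P' Q' : eqm n P Q -> eqm n P' Q' -> eqm n (P + P') (Q + Q').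
Proof. by move=> E1 E2 k kn; rewrite !coefD E1 ?E2. Qed.

Lemma eqmM n P Q P' Q' : eqm n P Q -> eqm n P' Q' -> eqm n (P * P') (Q * Q').
Proof.
move=> E1 E2 k kn; rewrite !coefM; apply: eq_bigr => -[i /= lt_ik] _.
by rewrite E1 ?E2 //; lia.
Qed.

Lemma eqm_sum n (I : Type) (r : seq I) (F G : I -> {poly R}) :
  (forall i, eqm n (F i) (G i)) ->
  eqm n (\sum_(i <- r) F i) (\sum_(i <- r) G i).
Proof. by move=> E k kn; rewrite !coef_sum; apply: eq_bigr => i _; apply: E. Qed.

Lemma eqm_cancel n P Q W : W`_0 = 1 -> eqm n (P * W) (Q * W) -> eqm n P Q.
Proof.
move=> W0 E k; elim/ltn_ind: k => k IHk kn; have := E k kn; rewrite !coefM.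
rewrite !big_ord_recr /= subnn W0 !mulr1.
rewrite (eq_bigr (fun i : 'I_k => Q`_i * W`_(k - i))); first by move/addrI.
by move=> [i lt_ik] _; rewrite IHk //=; lia.
Qed.

Lemma coef_Xderiv P k : ('X * P^`())`_k = P`_k *+ k.
Proof. by rewrite coefXM coef_deriv; case: k. Qed.

Definition geom n (z : R) : {poly R} := \poly_(k < n.+1) z ^+ k.

Lemma eqm_geom n z : eqm n ((1 - z *: 'X) * geom n z) 1.
Proof.
move=> k kn; rewrite mulrBl mul1r coefB -scalerAl coefZ coefXM !coef_poly coef1.
case: k kn => [|k] kn; first by rewrite mulr0 subr0.
by rewrite ltnS kn /= ltnS (ltnW kn) -exprS subrr.
Qed.

Lemma eqm_Xderiv_linear n z :
  eqm n ('X * (1 - z *: 'X)^`()) ((1 - z *: 'X) * (- (z *: 'X) * geom n z)).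
Proof.
rewrite mulrCA derivB derivC derivZ derivX sub0r.
apply: (@eqm_trans _ _ (- (z *: 'X) * 1)).
  by rewrite mulr1 mulrN -scalerAr mulr1.
by apply: eqmM => //; apply/eqm_sym/eqm_geom.
Qed.

Lemma eqm_Xderiv_prod n (I : eqType) (r : seq I) (F W : I -> {poly R}) :
  (forall i, eqm n ('X * (F i)^`()) (F i * W i)) ->
  eqm n ('X * (\prod_(i <- r) F i)^`())
    ((\prod_(i <- r) F i) * \sum_(i <- r) W i).
Proof.
move=> E; elim: r => [|i r IHr]; first by rewrite !big_nil derivC !mulr0.
rewrite !big_cons derivM; set p := \prod_(_ <- _) _; set w := \sum_(_ <- _) _.
have -> : 'X * ((F i)^`() * p + F i * p^`()) =
  'X * (F i)^`() * p + F i * ('X * p^`()) by ring.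
have -> : F i * p * (W i + w) = F i * W i * p + F i * (p * w) by ring.
by apply: eqmD; apply: eqmM.
Qed.

End TruncatedSeries.

(** The equation [X P' = P W] computes the coefficients of [P] recursively from
    the constant one. *)
Lemma eqm_Xderiv_uniq (R : idomainType) n (P Q W : {poly R}) :
  (forall k, k.+1%:R != 0 :> R) ->
  W`_0 = 0 -> P`_0 = Q`_0 -> eqm n ('X * P^`()) (P * W) ->
  eqm n ('X * Q^`()) (Q * W) -> eqm n P Q.
Proof.
move=> char0 W0 PQ0 EP EQ k; elim/ltn_ind: k => -[//|k] IHk kn.
have stepE X : eqm n ('X * X^`()) (X * W) ->
    X`_k.+1 *+ k.+1 = \sum_(i < k.+1) X`_i * W`_(k.+1 - i).
  move=> /(_ _ kn); rewrite coef_Xderiv coefM big_ord_recr /=.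
  by rewrite subnn W0 mulr0 addr0.
apply: (mulIf (char0 k)); rewrite !mulr_natr !stepE //.
by apply: eq_bigr => -[i lt_ik] _; rewrite IHk //=; lia.
Qed.

Section Reversal.
Variable R : comNzRingType.
Implicit Types (p q : {poly R}).

(** [X^n * p(1/X)]. *)
Definition revp n p : {poly R} := \poly_(i < n.+1) p`_(n - i).

Lemma revpD n p q : revp n (p + q) = revp n p + revp n q.
Proof.
by apply/polyP => i; rewrite coefD !coef_poly coefD; case: ifP; rewrite ?addr0.
Qed.

Lemma revpC n c p : revp n (c%:P * p) = c%:P * revp n p.
Proof.
by apply/polyP => i; rewrite coefCM !coef_poly coefCM; case: ifP; rewrite ?mulr0.
Qed.

Lemma revp_sum n (I : Type) (r : seq I) (F : I -> {poly R}) :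
  revp n (\sum_(i <- r) F i) = \sum_(i <- r) revp n (F i).
Proof.
apply: (big_morph (revp n) (@revpD n)).
by apply/polyP => i; rewrite coef_poly !coef0; case: ifP.
Qed.

Lemma revpX n p : revp n.+1 ('X * p) = revp n p.
Proof.
apply/polyP => i; rewrite !coef_poly coefXM ltnS.
by case: ltngtP => [ltin|//|->]; rewrite ?subnn // subn_eq0 leqNgt ltin subSn.
Qed.

Lemma revp_prod (I : Type) (r : seq I) (a : I -> R) :
  revp (size r) (\prod_(i <- r) ('X - (a i)%:P)) =
  \prod_(i <- r) (1 - a i *: 'X).
Proof.
elim: r => [|i r IHr].
  by rewrite !big_nil /=; apply/polyP => -[|[|k]]; rewrite coef_poly !coef1.
rewrite !big_cons /= -IHr; set p := \prod_(_ <- _) _.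
have sp : (size p <= (size r).+1)%N by rewrite size_prod_XsubC.
rewrite mulrBl mulrBl mul1r -scalerAl; move: (size r) sp => n sp.
apply/polyP => k; rewrite coefB coefZ coefXM !coef_poly coefB coefXM coefCM.
case: k => [|k] /=.
  by rewrite !subn0 (nth_default _ sp).
rewrite !ltnS subSS; case: (ltngtP k n) => [lt_kn|lt_nk|->] /=.
- by rewrite subn_eq0 leqNgt lt_kn /=; congr (p`_ _ - _); lia.
- by rewrite mulr0 subr0.
- by rewrite subnn.
Qed.

End Reversal.

(** [T] and the [N i / D] are the coefficients of the partial fraction expansion
    [\prod_j (X - t_j) / (X - z_j) = T + X * \sum_i (N_i / D) / (X - z_i)]. *)
Section PartialFractions.
Variables (M : nat) (S : idomainType).
Hypothesis char0 : forall k, k.+1%:R != 0 :> S.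
Variables (z t N : 'I_M -> S) (D T : S).
Hypothesis z_inj : injective z.
Hypothesis z_neq0 : forall i, z i != 0.
Hypothesis NE : forall i, D * \prod_j (z i - t j) =
  z i * N i * \prod_(j | j != i) (z i - z j).
Hypothesis TE : T * \prod_j z j = \prod_j t j.

Let Lin (a : 'I_M -> S) : {poly S} := \prod_j (1 - a j *: 'X).

Lemma size_index_ord : size (index_enum 'I_M) = M.
Proof. by rewrite /index_enum -enumT size_enum_ord. Qed.

Lemma size_index_neq (i : 'I_M) :
  size [seq j <- index_enum 'I_M | j != i] = M.-1.
Proof.
rewrite size_filter; have := count_predC (pred1 i) (index_enum 'I_M).
rewrite size_index_ord count_uniq_mem ?index_enum_uniq //.
by rewrite mem_index_enum add1n => /(congr1 predn).
Qed.

(** Both sides have degree at most [M], and agree at [0] and at the [M] points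
    [z i]. *)
Lemma partial_fraction_X :
  D%:P * \prod_j ('X - (t j)%:P) = (D * T)%:P * \prod_j ('X - (z j)%:P) +
  'X * \sum_i (N i)%:P * \prod_(j | j != i) ('X - (z j)%:P).
Proof.
apply/eqP; rewrite -subr_eq0; set p := _ - _; apply: contraT => p_neq0.
have szp : (size p <= M.+1)%N.
  have szC (c : S) (q : {poly S}) : (size (c%:P * q)%R <= size q)%N.
    by rewrite mul_polyC size_scale_leq.
  have szM (a : 'I_M -> S) : size (\prod_j ('X - (a j)%:P)) = M.+1.
    by rewrite size_prod_XsubC size_index_ord.
  rewrite /p (leq_trans (size_polyD _ _)) // size_polyN geq_max.
  rewrite (leq_trans (szC _ _)) ?szM //=.
  rewrite (leq_trans (size_polyD _ _)) // geq_max.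
  rewrite (leq_trans (szC _ _)) ?szM //=.
  rewrite mulr_sumr (leq_trans (size_sum _ _ _)) //; apply/bigmax_leqP => i _.
  rewrite mulrCA (leq_trans (szC _ _)) // mulrC.
  rewrite (leq_trans (size_polyMleq _ _)) // size_polyX addn2 /=.
  rewrite -big_filter size_prod_XsubC size_index_neq prednK //.
  exact: leq_trans (ltn_ord i).
have horner_lin (P : pred 'I_M) (a : 'I_M -> S) x :
    (\prod_(j | P j) ('X - (a j)%:P)).[x] = \prod_(j | P j) (x - a j).
  by rewrite horner_prod; apply: eq_bigr => j _; rewrite hornerXsubC.
have pE x : p.[x] = D * \prod_j (x - t j) - (D * T * \prod_j (x - z j) +
    x * \sum_i N i * \prod_(j | j != i) (x - z j)).
  rewrite /p hornerD hornerN hornerD !hornerM !hornerC hornerX !horner_lin.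
  rewrite horner_sum; congr (_ - (_ + _ * _)); apply: eq_bigr => i _.
  by rewrite hornerM hornerC horner_lin.
have : (size (0%R :: [seq z i | i <- enum 'I_M]) < size p)%N.
  apply: max_poly_roots p_neq0 _ _.
    apply/allP => x; rewrite inE => /predU1P[->|/mapP[i _ ->]]; apply/rootP;
    rewrite pE.
      rewrite mul0r addr0 -mulrA; apply/eqP; rewrite subr_eq0; apply/eqP.
      congr (_ * _).
      under eq_bigr do rewrite sub0r.
      under [in RHS]eq_bigr do rewrite sub0r.
      by rewrite !prodrN -TE mulrCA.
    rewrite NE; apply/eqP; rewrite subr_eq0; apply/eqP.
    rewrite [in X in _ = X](bigD1 i) //= subrr mul0r mulr0 add0r.
    rewrite [X in _ = _ * X](bigD1 i) //= [X in _ + X]big1 ?addr0 ?mulrA // => k ki.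
    by rewrite (bigD1 i) 1?eq_sym //= subrr mul0r mulr0.
  rewrite /= map_inj_uniq ?enum_uniq // andbT; apply/mapP => -[i _ /esym/eqP].
  by rewrite (negbTE (z_neq0 i)).
by rewrite /= size_map size_enum_ord ltnNge szp.
Qed.

Lemma partial_fraction :
  D%:P * Lin t = (D * T)%:P * Lin z +
    \sum_i (N i)%:P * \prod_(j | j != i) (1 - z j *: 'X).
Proof.
have rvM a : revp M (\prod_j ('X - (a j)%:P)) = Lin a.
  by have := revp_prod (index_enum 'I_M) a; rewrite size_index_ord.
have rvM1 i : revp M.-1 (\prod_(j | j != i) ('X - (z j)%:P)) =
    \prod_(j | j != i) (1 - z j *: 'X).
  have := revp_prod [seq j <- index_enum 'I_M | j != i] z.
  by rewrite size_index_neq !big_filter.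
have := congr1 (revp M) partial_fraction_X.
rewrite revpD !revpC !rvM => ->; congr (_ + _).
rewrite mulr_sumr revp_sum; apply: eq_bigr => i _.
have M0 : M.-1.+1 = M by rewrite prednK // (leq_trans _ (ltn_ord i)).
rewrite mulrCA revpC -rvM1; congr (_ * _).
by rewrite -{1}M0 revpX.
Qed.

(** The expansion of [\prod_j (1 - t_j X) / (1 - z_j X)] in powers of [X] is
    read off in two ways: its coefficients satisfy Newton's recursion for the
    differences of power sums of [z] and [t], and by partial fractions they are
    [\sum_i (N_i / D) z_i^k]. *)
Lemma partial_fraction_newton (n : nat) (a : nat -> S) :
  a 0%N = 1 ->
  (forall k, (0 < k <= n)%N -> k%:R * a k =
     \sum_(1 <= r < k.+1) (\sum_j (z j ^+ r - t j ^+ r)) * a (k - r)%N) ->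
  forall k, (0 < k <= n)%N -> \sum_i N i * z i ^+ k = D * a k.
Proof.
move=> a0 newton k /andP[k_gt0 kn].
pose A : {poly S} := \poly_(k < n.+1) a k.
pose W (b : 'I_M -> S) := \sum_j (- (b j *: 'X) * geom n (b j)).
have WE b r : (r <= n)%N -> (W b)`_r = if (r == 0)%N then 0 else
    - \sum_j b j ^+ r.
  move=> rn; rewrite coef_sum; case: r rn => [|r] rn /=.
    by rewrite big1 // => j _; rewrite mulNr -scalerAl coefN coefZ coefXM mulr0 oppr0.
  rewrite -sumrN; apply: eq_bigr => j _.
  by rewrite mulNr -scalerAl coefN coefZ coefXM /= coef_poly (leqW rn) exprS.
have LinE b : eqm n ('X * (Lin b)^`()) (Lin b * W b).
  by apply: eqm_Xderiv_prod => j; apply: eqm_Xderiv_linear.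
have Lin0 b : (Lin b)`_0 = 1.
  rewrite /Lin coef0_prod big1 // => j _.
  by rewrite coefB coef1 coefZ coefX mulr0 subr0.
have AE : eqm n ('X * A^`()) (A * (W t - W z)).
  move=> [|l] ln; rewrite coef_Xderiv coefMr.
    by rewrite mulr0n big_ord1 coefB !WE // subrr mulr0.
  rewrite coef_poly ltnS ln -mulr_natl newton //= big_add1 /= big_ord_recl.
  rewrite subn0 coefB !WE // subrr mulr0 add0r big_mkord; apply: eq_bigr => i _.
  rewrite lift0 subSS coef_poly ltnS (leq_trans (leq_subr _ _)) 1?ltnW //.
  rewrite mulrC coefB !WE ?(leq_trans (ltn_ord i) ln) //=.
  by rewrite opprK addrC sumrB.
(* Both sides solve the same first-order equation. *)
have ALin : eqm n (A * Lin z) (Lin t).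
  apply: (@eqm_Xderiv_uniq _ _ _ _ (W t)) => //.
  - by rewrite WE.
  - by rewrite coef0M !Lin0 coef_poly /= a0 mulr1.
  - rewrite derivM mulrDr mulrA [X in _ + X]mulrCA.
    apply: eqm_trans (_ : eqm n _ (A * (W t - W z) * Lin z + A * (Lin z * W z))) _.
      by apply: eqmD; apply: eqmM.
    have -> : A * (W t - W z) * Lin z + A * (Lin z * W z) = A * Lin z * W t.
      by ring.
    exact: eqm_refl.
pose G : {poly S} := (D * T)%:P + \sum_i (N i)%:P * geom n (z i).
have GLin : eqm n (G * Lin z) (D%:P * Lin t).
  rewrite partial_fraction mulrDl mulr_suml; apply: eqmD => //.
  apply: eqm_sum => i; rewrite /Lin (bigD1 i) //= -mulrA; apply: eqmM => //.
  rewrite mulrA -[X in eqm n _ X]mul1r; apply: eqmM => //.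
  by rewrite mulrC; apply: eqm_geom.
have /(_ k kn) : eqm n G (D%:P * A).
  apply: (eqm_cancel (Lin0 z)); apply: eqm_trans GLin _.
  by rewrite -mulrA; apply: eqmM => //; apply: eqm_sym.
rewrite coefCM coef_poly ltnS kn => <-; rewrite coefD coefC.
rewrite -[(k == 0)%N]negbK -lt0n k_gt0 add0r coef_sum; apply: eq_bigr => i _.
by rewrite coefCM coef_poly ltnS kn.
Qed.

End PartialFractions.

(** * A difference operator on symmetric functions *)

Section WeightedHomogeneous.
Variables (D : nat) (R : idomainType).
Implicit Types (f g : {mpoly R[D]}) (d e : nat).

(** The variable of index [r] stands for the power sum of degree [r + 1], which
    is also its weight. *)
Definition whomog d f : Prop := forall m, f@_m != 0 -> mnmwgt m = d.

Lemma whomog0 d : whomog d 0.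
Proof. by move=> m; rewrite mcoeff0 eqxx. Qed.

Lemma whomog1 : whomog 0 1.
Proof.
move=> m; rewrite mcoeff1; case: (m =P 0%MM) => [-> _|_]; first exact: mnmwgt0.
by rewrite eqxx.
Qed.

Lemma whomogD d f g : whomog d f -> whomog d g -> whomog d (f + g).
Proof.
move=> hf hg m; rewrite mcoeffD.
have [->|/hf //] := eqVneq f@_m 0; rewrite add0r; exact: hg.
Qed.

Lemma whomogZ d c f : whomog d f -> whomog d (c *: f).
Proof. by move=> hf m; rewrite mcoeffZ mulf_eq0 negb_or => /andP[_ /hf]. Qed.

Lemma whomog_sum d (I : Type) (r : seq I) (P : pred I) (F : I -> {mpoly R[D]}) :
  (forall i, P i -> whomog d (F i)) -> whomog d (\sum_(i <- r | P i) F i).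
Proof.
move=> hF; apply: big_ind => //; [exact: whomog0 | exact: whomogD].
Qed.

Lemma whomogM d e f g : whomog d f -> whomog e g -> whomog (d + e) (f * g).
Proof.
move=> hf hg m; rewrite -mcoeff_msupp => /msuppM_le/allpairsP[[a b] /=].
by rewrite !mcoeff_msupp => -[/hf <- /hg <- ->]; rewrite mnmwgtD.
Qed.

Lemma whomogX (i : 'I_D) : whomog i.+1 'X_i.
Proof.
move=> m; rewrite mcoeffX; case: (U_(i)%MM =P m) => [<- _|_]; first exact: mnmwgt1.
by rewrite eqxx.
Qed.

Lemma whomog_mmap (M : nat) d f (q : 'I_D -> {mpoly R[M]}) :
  (forall r : 'I_D, q r \is r.+1.-homog) -> whomog d f ->
  mmap (@mpolyC M R) q f \is d.-homog.
Proof.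
move=> hq hf; rewrite /mmap big_seq rpred_sum // => m fm.
rewrite mul_mpolyC rpredZ // -(hf m); last by rewrite -mcoeff_msupp.
rewrite /mmap1 /mnmwgt; apply: (big_ind2 (fun p k => p \is k.-homog)) => //.
- exact: dhomog1.
- by move=> p k p' k' hp hp'; apply: dhomogM.
- by move=> r _; rewrite mulnC; apply: dhomogMn.
Qed.

(** Homogeneity for the grading in which the polynomial indeterminate has
    weight one. *)
Definition bihomog d (p : {poly {mpoly R[D]}}) : Prop :=
  forall k m, p`_k@_m != 0 -> (mnmwgt m + k)%N = d.

Lemma bihomog0 d : bihomog d 0.
Proof. by move=> k m; rewrite coef0 mcoeff0 eqxx. Qed.

Lemma bihomogD d p q : bihomog d p -> bihomog d q -> bihomog d (p + q).
Proof.
move=> hp hq k m; rewrite coefD mcoeffD.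
have [->|/hp //] := eqVneq p`_k@_m 0; rewrite add0r; exact: hq.
Qed.

Lemma bihomogM d e p q : bihomog d p -> bihomog e q -> bihomog (d + e) (p * q).
Proof.
move=> hp hq k m; rewrite coefM (raddf_sum (mcoeff m)) => nz.
have [i nzi] : exists i : 'I_k.+1, (p`_i * q`_(k - i))@_m != 0.
  apply/existsP; apply: contraNT nz => /existsPn z; rewrite big1 // => i _.
  by apply/eqP; have := z i; rewrite negbK.
move: nzi; rewrite -mcoeff_msupp => /msuppM_le/allpairsP[[a b] /=].
rewrite !mcoeff_msupp => -[/hp <- /hq <- ->]; rewrite mnmwgtD.
have := ltn_ord i; lia.
Qed.

Lemma bihomog1 : bihomog 0 1.
Proof.
move=> k m; rewrite coef1; case: k => [|k] /=; last by rewrite mcoeff0 eqxx.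
by rewrite addn0; apply: whomog1.
Qed.

Lemma bihomogX n d p : bihomog d p -> bihomog (d * n) (p ^+ n).
Proof.
move=> hp; elim: n => [|n IHn]; first by rewrite muln0; apply: bihomog1.
by rewrite exprS mulnS; apply: bihomogM.
Qed.

Lemma bihomog_coef d p k : bihomog d p -> whomog (d - k) p`_k.
Proof. by move=> hp m /hp <-; rewrite addnK. Qed.

Lemma bihomog_size d p : bihomog d p -> (size p <= d.+1)%N.
Proof.
move=> hp; apply/leq_sizeP => k dk; apply/mpolyP => m; rewrite mcoeff0.
by apply: contraTeq dk => /hp <-; lia.
Qed.

End WeightedHomogeneous.

Section StableOperator.
Variables (A : idomainType) (h c : A) (D : nat).
Hypothesis natU : forall k, (k.+1%:R : A) \is a GRing.unit.

(** The parameters of the deformation, both equal to [1] at [h = 0].  A letter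
    [false] (an ordinary variable) has coefficient parameter [sp] and is dilated
    by [qp]; for a letter [true] (a tilde variable) the two are exchanged. *)
Definition sp : A := 1 - h.
Definition qp : A := 1 + h * c.

Definition tau (b : bool) : A := if b then qp else sp.
Definition dil (b : bool) : A := if b then sp else qp.

(** [(1 - tau b ^+ r) / h], without dividing by [h]: the contribution of one
    variable to the generator of degree [r].  At [h = 0] it is [r] or [- c * r],
    so that one recovers [r] times a super power sum. *)
Definition omega (b : bool) (r : nat) : A :=
  (if b then - c else 1) * \sum_(l < r) tau b ^+ l.

(** The change of a generator when one variable [z] is dilated is [nu r * z ^+ r]
    for both kinds of letters ([omega_dil]); this is why a single operator on
    symmetric functions induces difference operators for all words. *)
Definition nu (r : nat) : A := (\sum_(l < r) sp ^+ l) * (qp ^+ r - 1).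

Lemma omegaE b r : h * omega b r = 1 - tau b ^+ r.
Proof.
rewrite -opprB subrX1 /omega mulrA -mulNr opprB; congr (_ * _).
by case: b; rewrite /tau /sp /qp; ring.
Qed.

Lemma omega_dil b r : omega b r * (dil b ^+ r - 1) = nu r.
Proof.
rewrite /nu /omega; case: b; rewrite /tau /dil ?mul1r //.
have -> : sp ^+ r - 1 = - h * \sum_(l < r) sp ^+ l.
  by rewrite subrX1 /sp; congr (_ * _); ring.
have -> : qp ^+ r - 1 = h * c * \sum_(l < r) qp ^+ l.
  by rewrite subrX1 /qp; congr (_ * _); ring.
by ring.
Qed.

Definition pvar (r : nat) : {mpoly A[D]} :=
  oapp (fun i : 'I_D => 'X_i) 0 (insub r).

Lemma pvarE (i : 'I_D) : pvar i = 'X_i. Proof. by rewrite /pvar valK. Qed.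

Lemma whomog_pvar r : whomog r.+1 (pvar r).
Proof.
by rewrite /pvar; case: insubP => [i _ <-|_]; [apply: whomogX | apply: whomog0].
Qed.

Fixpoint hser_rev (n : nat) : seq {mpoly A[D]} :=
  if n is k.+1 then
    let s := hser_rev k in
    (k.+1%:R^-1 * h) *: (\sum_(i < k.+1) pvar i * nth 0 s i) :: s
  else [:: 1].

(** The coefficient of [X^n] in [exp (h * \sum_r p_r X^r / r)], given by Newton's
    recursion. *)
Definition hser (n : nat) : {mpoly A[D]} := locked (fun k => head 0 (hser_rev k)) n.

Lemma nth_hser_rev n i : (i <= n)%N -> nth 0 (hser_rev n) i = hser (n - i).
Proof.
rewrite /hser -lock.
by elim: n i => [|n IHn] [|i] // lt_in; rewrite subSS -IHn.
Qed.

Lemma hser0 : hser 0 = 1. Proof. by rewrite /hser -lock. Qed.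

Lemma hserS n :
  n.+1%:R *: hser n.+1 = h *: \sum_(i < n.+1) pvar i * hser (n - i).
Proof.
rewrite {1}/hser -lock /= scalerA mulrA; congr (_ *: _).
  by rewrite mulrV // mul1r.
by apply: eq_bigr => i _; rewrite nth_hser_rev // -ltnS.
Qed.

Lemma whomog_hser n : whomog n (hser n).
Proof.
elim/ltn_ind: n => -[_|n IHn]; first by rewrite hser0; apply: whomog1.
rewrite {1}/hser -lock /=; apply: whomogZ; apply: whomog_sum => -[i /= lt_in] _.
rewrite nth_hser_rev // (_ : n.+1 = i.+1 + (n - i))%N; last by lia.
by apply: whomogM; [apply: whomog_pvar | apply: IHn; lia].
Qed.

(** The effect on the generators of dilating a variable, this variable being
    replaced by the polynomial indeterminate. *)
Definition pshift : {mpoly A[D]} -> {poly {mpoly A[D]}} :=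
  locked (mmap (polyC \o @mpolyC D A)
    (fun r : 'I_D => ('X_r)%:P + (nu r.+1)%:MP *: 'X^(r.+1))).

Lemma pshiftD f g : pshift (f + g) = pshift f + pshift g.
Proof. by rewrite /pshift -lock; apply: mmapD. Qed.

Lemma pshiftN f : pshift (- f) = - pshift f.
Proof. by rewrite /pshift -lock; apply: mmapN. Qed.

Lemma pshiftM f g : pshift (f * g) = pshift f * pshift g.
Proof.
rewrite /pshift -lock; exact: (rmorphM (mmap (polyC \o @mpolyC D A) _)).
Qed.

Lemma pshiftC a : pshift a%:MP = (a%:MP)%:P.
Proof. by rewrite /pshift -lock mmapC. Qed.

Lemma pshiftX (r : 'I_D) :
  pshift 'X_r = ('X_r)%:P + (nu r.+1)%:MP *: 'X^(r.+1).
Proof. by rewrite /pshift -lock mmapX mmap1U. Qed.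

Lemma bihomog_pshift d f : whomog d f -> bihomog d (pshift f).
Proof.
move=> hf; rewrite /pshift -lock /mmap big_seq.
apply: (big_ind (bihomog d)); [exact: bihomog0 | exact: bihomogD | move=> m fm].
rewrite -(hf m) -?mcoeff_msupp // -[mnmwgt m]add0n; apply: bihomogM.
  move=> k m'; rewrite /= coefC; case: k => [|k] /=; last by rewrite mcoeff0 eqxx.
  by rewrite mcoeffC; case: (m' =P 0%MM) => [-> _|_]; rewrite ?mulr0 ?eqxx // mnmwgt0.
rewrite /mmap1 /mnmwgt.
apply: (big_ind2 (fun p k => bihomog k p)); first exact: bihomog1.
  by move=> p k p' k' hp hp'; apply: bihomogM.
move=> r _; rewrite mulnC; apply: bihomogX => k m'.
rewrite coefD coefC coefZ coefXn mcoeffD.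
have [->|_] := eqVneq k r.+1.
  rewrite /= mcoeff0 add0r mulr1 mcoeffC.
  case: (m' =P 0%MM) => [->|_]; rewrite ?mulr0 ?eqxx //.
  by rewrite mnmwgt0.
rewrite mulr0 mcoeff0 addr0; case: k => [|k] /=; last by rewrite mcoeff0 eqxx.
by rewrite addn0; apply: whomogX.
Qed.

Lemma pshift0 f : (pshift f)`_0 = f.
Proof.
elim/mpoly_ring_ind: f => [a|r|f g IHf IHg|f g IHf IHg].
- by rewrite pshiftC coefC.
- by rewrite pshiftX coefD coefC coefZ coefXn mulr0 addr0.
- by rewrite pshiftD coefD; congr (_ + _); [exact: IHf | exact: IHg].
- by rewrite pshiftM coef0M; congr (_ * _); [exact: IHf | exact: IHg].
Qed.

(** In [\sum_i dnum i * (dilate i F - F)] the variable [X_i] of the [i]-th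
    difference enters through its powers only, and [hser k] is the symmetric
    function that specializes to [\sum_i dnum i * X_i ^+ k / discr]. *)
Definition stabop (f : {mpoly A[D]}) : {mpoly A[D]} :=
  \sum_(1 <= k < D.+1) hser k * (pshift f)`_k.

Lemma stabopZ a f : stabop (a *: f) = a *: stabop f.
Proof.
rewrite /stabop scaler_sumr; apply: eq_bigr => k _.
by rewrite -mul_mpolyC pshiftM pshiftC coefCM mul_mpolyC scalerAr.
Qed.

Lemma stabopB f g : stabop (f - g) = stabop f - stabop g.
Proof.
rewrite /stabop -sumrB; apply: eq_bigr => k _.
by rewrite pshiftD pshiftN coefB mulrBr.
Qed.

Lemma whomog_stabop d f : whomog d f -> whomog d (stabop f).
Proof.
move=> /bihomog_pshift hf; apply: whomog_sum => k _.
have [kd|dk] := leqP k d; last first.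
  have /leq_sizeP/(_ _ dk) -> := bihomog_size hf.
  by rewrite mulr0; apply: whomog0.
rewrite -(subnKC kd); apply: whomogM; first exact: whomog_hser.
exact: bihomog_coef.
Qed.

Section Evaluation.
Variables (M : nat) (w : nat -> bool).

Definition wtau (i : 'I_M) : A := tau (w i).
Definition wdil (i : 'I_M) : A := dil (w i).

Definition evgen (r : 'I_D) : {mpoly A[M]} :=
  \sum_(i < M) omega (w i) r.+1 *: 'X_i ^+ r.+1.

Definition evw : {mpoly A[D]} -> {mpoly A[M]} :=
  locked (mmap (@mpolyC M A) evgen).

Fact evw_additive : additive evw.
Proof. by rewrite /evw -lock; exact: mmapB. Qed.

Fact evw_multiplicative : multiplicative evw.
Proof. by rewrite /evw -lock; exact: mmap_is_multiplicative. Qed.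

HB.instance Definition _ := GRing.isAdditive.Build
  {mpoly A[D]} {mpoly A[M]} evw evw_additive.
HB.instance Definition _ := GRing.isMultiplicative.Build
  {mpoly A[D]} {mpoly A[M]} evw evw_multiplicative.

Lemma evwD f g : evw (f + g) = evw f + evw g.
Proof. exact: rmorphD. Qed.

Lemma evwM f g : evw (f * g) = evw f * evw g.
Proof. exact: rmorphM. Qed.

Lemma evwC a : evw a%:MP = a%:MP. Proof. by rewrite /evw -lock mmapC. Qed.

Lemma evwX r : evw 'X_r = evgen r. Proof. by rewrite /evw -lock mmapX mmap1U. Qed.

Lemma evwZ a f : evw (a *: f) = a *: evw f.
Proof. by rewrite /evw -lock mmapZ mul_mpolyC. Qed.

Lemma evw_homog d f : whomog d f -> evw f \is d.-homog.
Proof.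
rewrite /evw -lock; apply: whomog_mmap => r.
rewrite rpred_sum // => i _; rewrite rpredZ //.
by rewrite mpolyXn dhomogX /= mdegMn mdeg1 mul1n.
Qed.

(** Both sides are ring morphisms in [f], equal on generators by
    [omega_dil]. *)
Lemma dilate_evw (i : 'I_M) f :
  dilate wdil i (evw f) = (map_poly evw (pshift f)).['X_i].
Proof.
have hD P Q x : (map_poly evw (P + Q)).[x] =
    (map_poly evw P).[x] + (map_poly evw Q).[x].
  by rewrite (raddfD (map_poly evw)) /= hornerD.
have hM P Q x : (map_poly evw (P * Q)).[x] =
    (map_poly evw P).[x] * (map_poly evw Q).[x].
  by rewrite (rmorphM (map_poly evw)) /= hornerM.
elim/mpoly_ring_ind: f => [a|r|f g IHf IHg|f g IHf IHg].
- by rewrite pshiftC evwC /dilate mmapC map_polyC hornerC /= evwC.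
- rewrite pshiftX hD map_polyC map_polyZ map_polyXn hornerC.
  rewrite hornerZ hornerXn /= evwX evwC mul_mpolyC /dilate /evgen.
  rewrite (raddf_sum (mmap _ _)) (bigD1 i) //= [in RHS](bigD1 i) //=.
  rewrite addrAC; congr (_ + _).
    rewrite -scalerDl mmapZ rmorphXn /= mmapX mmap1U eqxx exprZn.
    rewrite mul_mpolyC scalerA; congr (_ *: _).
    by rewrite -(omega_dil (w i)) mulrBr mulr1 addrC subrK.
  apply: eq_bigr => j /negbTE ji; rewrite mmapZ rmorphXn /= mmapX mmap1U ji.
  by rewrite scale1r mul_mpolyC.
- by rewrite evwD dilateD pshiftD hD; congr (_ + _); [exact: IHf | exact: IHg].
- by rewrite evwM dilateM pshiftM hM; congr (_ * _); [exact: IHf | exact: IHg].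
Qed.

Lemma char0_mpoly k : k.+1%:R != 0 :> {mpoly A[M]}.
Proof.
rewrite -mpolyC_nat mpolyC_eq0; apply: contraTneq (natU k) => ->.
by rewrite unitr0.
Qed.

Lemma evw_pvar r : (r < D)%N ->
  h *: evw (pvar r) = \sum_(j < M) ('X_j ^+ r.+1 - (wtau j *: 'X_j) ^+ r.+1).
Proof.
move=> rD; rewrite (pvarE (Ordinal rD)) evwX scaler_sumr.
apply: eq_bigr => j _.
by rewrite scalerA omegaE exprZn scalerBl scale1r.
Qed.

(** Partial fractions with [z_j = X_j] and [t_j = tau_j X_j]: the difference of
    the power sums of [z] and [t] is [h] times a generator. *)
Lemma evw_hser k : (0 < k <= D)%N ->
  \sum_i dnum wtau i * 'X_i ^+ k = discr M A * evw (hser k).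
Proof.
move=> /[dup] /andP[k_gt0 kD] kI.
apply: (@partial_fraction_newton M _ char0_mpoly _ (fun j => wtau j *: 'X_j)
  _ _ ((\prod_j wtau j)%:MP) _ _ _ _ D (fun k => evw (hser k))) => //.
- move=> i j /(congr1 (mcoeff U_(i)%MM)); rewrite !mcoeffXU eqxx.
  by case: eqVneq => // _ /eqP; rewrite oner_eq0.
- move=> i; apply/eqP => /(congr1 (mcoeff U_(i)%MM)).
  by rewrite mcoeffXU eqxx mcoeff0 => /eqP; rewrite oner_eq0.
- move=> i; have -> : \prod_j ('X_i - wtau j *: 'X_j) =
      ((1 - wtau i) *: 'X_i) * \prod_(j | j != i) ('X_i - wtau j *: 'X_j).
    by rewrite (bigD1 i) //= scalerBl scale1r.
  by rewrite /dnum (discrE _ i) -!mul_mpolyC; ring.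
- rewrite rmorph_prod -big_split /=; apply: eq_bigr => j _.
  by rewrite mul_mpolyC.
- by rewrite hser0 rmorph1.
move=> [//|l] /andP[_ lD].
rewrite mulr_natl -scaler_nat -evwZ.
have -> : (l.+1%:R : A) *: hser l.+1 =
    h *: \sum_(i < l.+1) pvar i * hser (l - i) by exact: hserS.
rewrite evwZ rmorph_sum scaler_sumr big_add1 big_mkord /=.
apply: eq_bigr => i _; rewrite rmorphM scalerAl evw_pvar //.
exact: leq_trans (ltn_ord i) lD.
Qed.

(** The difference operators of all words come from the one operator [stabop].
    The bound [d <= D] keeps every [hser k] that occurs within the [D] available
    generators. *)
Lemma discr_stabop d f : (d <= D)%N -> whomog d f ->
  discr M A * evw (stabop f) = qdiff wtau wdil (evw f).
Proof.
move=> dD hf; rewrite /stabop rmorph_sum mulr_sumr /qdiff.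
transitivity (\sum_(1 <= k < D.+1) \sum_i
    dnum wtau i * ('X_i ^+ k * evw (pshift f)`_k)).
  rewrite big_nat_cond [RHS]big_nat_cond; apply: eq_bigr => k /andP[kD _].
  rewrite rmorphM mulrA -evw_hser // mulr_suml; apply: eq_bigr => i _.
  by rewrite mulrA.
rewrite exchange_big /=; apply: eq_bigr => i _; rewrite -mulr_sumr.
congr (_ * _); rewrite dilate_evw (@horner_coef_wide _ D.+1); last first.
  apply: leq_trans (size_poly _ _) _.
  by apply: leq_trans (bihomog_size (bihomog_pshift hf)) _.
rewrite big_ord_recl expr0 mulr1 coef_map /= pshift0 addrAC subrr add0r.
rewrite big_add1 big_mkord; apply: eq_bigr => k _.
by rewrite coef_map mulrC.
Qed.

End Evaluation.
End StableOperator.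

(** * The Jack operator without denominators *)

Section ProductVariation.
Variable R : comNzRingType.

(** The first-order term of [\prod_(j <- r) (a j + h * b j)] in [h]. *)
Fixpoint prodvar (I : Type) (a b : I -> R) (r : seq I) : R :=
  if r is j :: r' then b j * \prod_(l <- r') a l + a j * prodvar a b r' else 0.

Lemma prod_expand (I : Type) (h : R) (a b : I -> R) (r : seq I) :
  exists U, \prod_(j <- r) (a j + h * b j) =
    \prod_(j <- r) a j + h * prodvar a b r + h ^+ 2 * U.
Proof.
elim: r => [|j r [U IHr]]; first by exists 0; rewrite !big_nil /=; ring.
exists (a j * U + b j * prodvar a b r + h * b j * U).
by rewrite !big_cons IHr /=; ring.
Qed.

End ProductVariation.

Lemma rmorph_prodvar (R S : comNzRingType) (f : {rmorphism R -> S}) (I : Type)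
    (a b : I -> R) (r : seq I) :
  f (prodvar a b r) = prodvar (f \o a) (f \o b) r.
Proof.
elim: r => [|j r IHr] /=; first exact: rmorph0.
by rewrite rmorphD !rmorphM rmorph_prod IHr.
Qed.

(** The logarithmic derivative of the product. *)
Lemma prodvar_div (F : fieldType) (I : eqType) (a b : I -> F) (r : seq I) :
  {in r, forall j, a j != 0} ->
  prodvar a b r = (\prod_(j <- r) a j) * \sum_(j <- r) b j / a j.
Proof.
elim: r => [|j r IHr] a0 /=; first by rewrite !big_nil mulr0.
rewrite !big_cons IHr => [|l rl]; last by rewrite a0 // inE rl orbT.
have := a0 j (mem_head _ _); move=> aj0; by field.
Qed.

Lemma eq_prodvar (R : comNzRingType) (I : Type) (a b a' b' : I -> R)
    (r : seq I) :
  a =1 a' -> b =1 b' -> prodvar a b r = prodvar a' b' r.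
Proof.
move=> Ea Eb; elim: r => //= j r ->; rewrite Ea Eb.
by under eq_bigr do rewrite Ea.
Qed.

Section JackOperator.
Variables (N : nat) (R : idomainType).
Implicit Types (F G : {mpoly R[N]}).

Definition others (i : 'I_N) : seq 'I_N := [seq j <- index_enum 'I_N | j != i].

Definition euler F : {mpoly R[N]} := \sum_i 'X_i * mderiv i F.

(** The numerator, over the common denominator [discr], of
    [\sum_i (a2 * X_i^2 d_i^2 + a1 * \sum_j X_i X_j / (X_i - X_j) d_i)]. *)
Definition jacknum (a1 a2 : R) F : {mpoly R[N]} :=
  \sum_i (a2 *: (discr N R * ('X_i ^+ 2 * mderiv i (mderiv i F))) +
    a1 *: (prodvar (fun j => 'X_i - 'X_j) (fun j => 'X_j) (others i) *
           discr_co R i * ('X_i * mderiv i F))).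

Lemma mcoeff_Xderiv i F m : ('X_i * mderiv i F)@_m = (m i)%:R * F@_m.
Proof.
case: (posnP (m i)) => [mi0|mi].
  rewrite mi0 mul0r; apply/eqP; rewrite mcoeff_eq0; apply/negP.
  move/msuppM_le/allpairsP => [[a b] /= []].
  rewrite msuppX inE => /eqP -> _ /(congr1 (fun m : 'X_{1..N} => m i)).
  by rewrite mi0 mnmDE mnm1E eqxx.
have E : m = (U_(i) + (m - U_(i)))%MM by rewrite addmC submK // lep1mP -lt0n.
rewrite mulrC {1}E mcoeffMX mcoeff_deriv addmC -E mnmBE mnm1E eqxx.
by rewrite subn1 prednK // mulr_natl.
Qed.

Lemma mcoeff_X2deriv i F m :
  ('X_i ^+ 2 * mderiv i (mderiv i F))@_m = (m i * (m i).-1)%:R * F@_m.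
Proof.
have -> : 'X_i ^+ 2 * mderiv i (mderiv i F) =
    'X_i * mderiv i ('X_i * mderiv i F) - 'X_i * mderiv i F.
  rewrite mderivM mderivX mnm1E eqxx scale1r.
  have -> : (U_(i) - U_(i))%MM = 0%MM :> 'X_{1..N}.
    by apply/mnmP => l; rewrite mnmBE subnn mnm0E.
  by rewrite mpolyX0; ring.
rewrite mcoeffB !mcoeff_Xderiv mulrA -mulrBl; congr (_ * _).
by case: (m i) => [|k]; rewrite ?mul0r ?subrr //= mulSn natrD natrM; ring.
Qed.

Lemma euler_homog d F : F \is d.-homog -> euler F = d%:R *: F.
Proof.
move=> /dhomogP hF; apply/mpolyP => m; rewrite mcoeffZ (raddf_sum (mcoeff m)).
rewrite (eq_bigr (fun i => (m i)%:R * F@_m)) => [|i _]; last first.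
  exact: mcoeff_Xderiv.
rewrite -mulr_suml -natr_sum -mdegE.
have [Fm|/memN_msupp_eq0 ->] := boolP (m \in msupp F); last by rewrite !mulr0.
by rewrite (hF _ Fm).
Qed.

End JackOperator.

Section MapMpoly.
Variables (R S : idomainType) (f : {rmorphism R -> S}) (N : nat).
Implicit Types F : {mpoly R[N]}.
Local Notation mapf := (map_mpoly f).

Lemma map_mderiv i F : mapf (mderiv i F) = mderiv i (mapf F).
Proof.
apply/mpolyP => m.
by rewrite mcoeff_map_mpoly !mcoeff_deriv mcoeff_map_mpoly raddfMn.
Qed.

Lemma map_mpolyX1 i : mapf 'X_i = 'X_i :> {mpoly S[N]}.
Proof. exact: map_mpolyX. Qed.

Lemma map_discr_co (i : 'I_N) : mapf (discr_co R i) = discr_co S i.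
Proof.
rewrite rmorph_prod; apply: eq_bigr => k _; rewrite rmorph_prod.
by apply: eq_bigr => l _; rewrite rmorphB /= !map_mpolyX1.
Qed.

Lemma map_discr : mapf (discr N R) = discr N S.
Proof.
rewrite rmorph_prod; apply: eq_bigr => k _; rewrite rmorph_prod.
by apply: eq_bigr => l _; rewrite rmorphB /= !map_mpolyX1.
Qed.

Lemma map_jacknum a1 a2 F :
  mapf (jacknum a1 a2 F) = jacknum (f a1) (f a2) (mapf F).
Proof.
rewrite rmorph_sum; apply: eq_bigr => i _; rewrite rmorphD /= !map_mpolyZ.
rewrite !rmorphM /= map_discr !map_mderiv map_discr_co.
rewrite !map_mpolyX1; congr (_ *: _ + _ *: (_ * _ * _)).
rewrite (rmorph_prodvar mapf); apply: eq_prodvar => j /=; last exact: map_mpolyX1.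
by rewrite rmorphB /= !map_mpolyX1.
Qed.

End MapMpoly.

(** * Lifting a Jack function to an eigenvector of the difference operator *)

Lemma eq_mmap (n : nat) (R S : nzRingType) (f : R -> S) (g1 g2 : 'I_n -> S)
    (p : {mpoly R[n]}) : g1 =1 g2 -> mmap f g1 p = mmap f g2 p.
Proof.
move=> E; rewrite /mmap; apply: eq_bigr => m _; congr (_ * _).
by apply: eq_bigr => i _; rewrite E.
Qed.

Lemma eq_mmapl (n : nat) (R S : nzRingType) (f1 f2 : R -> S) (g : 'I_n -> S)
    (p : {mpoly R[n]}) : f1 =1 f2 -> mmap f1 g p = mmap f2 g p.
Proof. by move=> E; rewrite /mmap; apply: eq_bigr => m _; rewrite E. Qed.

Lemma rmorph_mmap (n : nat) (R S T : comNzRingType) (f : R -> S)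
    (g : 'I_n -> S) (t : {rmorphism S -> T}) (p : {mpoly R[n]}) :
  t (mmap f g p) = mmap (t \o f) (t \o g) p.
Proof.
rewrite /mmap rmorph_sum; apply: eq_bigr => m _; rewrite rmorphM rmorph_prod.
by congr (_ * _); apply: eq_bigr => i _; rewrite rmorphXn.
Qed.

Lemma mmap_var (n : nat) (R : comNzRingType) (p : {mpoly R[n]}) :
  mmap (@mpolyC n R) (fun i => 'X_i) p = p.
Proof.
rewrite /mmap [RHS](mpolyE p); apply: eq_bigr => m _.
by rewrite /mmap1 -mpolyXE_id mul_mpolyC.
Qed.

Lemma mmap_whomog_scale (n M d : nat) (R S : idomainType) (f : R -> {mpoly S[M]})
    (g : 'I_n -> {mpoly S[M]}) (a : S) (p : {mpoly R[n]}) :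
  whomog d p ->
  mmap f (fun r => a ^+ r.+1 *: g r) p = a ^+ d *: mmap f g p.
Proof.
move=> hp; rewrite /mmap scaler_sumr big_seq [RHS]big_seq.
apply: eq_bigr => m; rewrite mcoeff_msupp => /hp <-.
rewrite scalerAr; congr (_ * _); rewrite /mmap1 /mnmwgt.
apply: (big_rec3 (fun k x y => x = a ^+ k *: y)); first by rewrite scale1r.
move=> i k x y _ ->; rewrite exprZn -exprM exprD mulnC.
by rewrite -scalerAl -scalerAr scalerA.
Qed.

Lemma prod_lt_const (N : nat) (R : comNzRingType) (x : R) (i : 'I_N) :
  \prod_(l < N | (l < i)%N) x = x ^+ i.
Proof.
rewrite -(big_ord_widen N (fun => x)) ?(ltnW (ltn_ord i)) //.
by rewrite prodr_const card_ord.
Qed.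

Lemma sum_lt_const (N : nat) (k : 'I_N) (x : nat) :
  (\sum_(i < N | (k <= i)%N) x = (N - k) * x)%N.
Proof.
have E : (\sum_(i < N | (i < k)%N) x = k * x)%N.
  rewrite -(big_ord_widen N (fun => x)) ?(ltnW (ltn_ord k)) //.
  by rewrite sum_nat_const card_ord.
have : (\sum_(i < N) x = N * x)%N by rewrite sum_nat_const card_ord.
rewrite (bigID (fun i : 'I_N => (i < k)%N)) /= E mulnBl => <-.
rewrite addKn; apply: eq_bigl => i; by rewrite -leqNgt.
Qed.

Lemma rankE (N : nat) (m : 'X_{1..N}) :
  rank m = (\sum_(k < N) (N - k) * m k)%N.
Proof.
rewrite /rank /psums; under eq_bigr do rewrite big_mkcond.
rewrite exchange_big /=; apply: eq_bigr => k _.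
by rewrite -big_mkcond sum_lt_const.
Qed.

Definition mnm_swap (N : nat) (i j : 'I_N) (m : 'X_{1..N}) : 'X_{1..N} :=
  [multinom m (tperm i j k) | k < N].

(** Positions closer to the beginning weigh more in [rank]. *)
Lemma rank_swap (N : nat) (i j : 'I_N) (m : 'X_{1..N}) :
  (i < j)%N -> (m i < m j)%N -> (rank m < rank (mnm_swap i j m))%N.
Proof.
move=> ij mij; have ji : j != i by rewrite -val_eqE /=; lia.
rewrite !rankE (bigD1 i) //= (bigD1 j) //=.
rewrite [X in (_ < X)%N](bigD1 i) //= [X in (_ < _ + X)%N](bigD1 j) //=.
rewrite !mnmE tpermL tpermR.
rewrite [X in (_ < _ + (_ + X))%N](eq_bigr (fun k : 'I_N => (N - k) * m k)%N).
  by have := ltn_ord j; nia.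
by move=> k /andP[ki kj]; rewrite mnmE tpermD // eq_sym.
Qed.

Lemma sum_idx_rank (N : nat) (m : 'X_{1..N}) :
  (\sum_(i < N) i * m i + rank m = N * mdeg m)%N.
Proof.
rewrite rankE mdegE big_distrr -big_split /=; apply: eq_bigr => k _.
by rewrite -mulnDl subnKC // ltnW.
Qed.

(** Abel summation: a decreasing weight is a sum of indicators of initial
    segments, on each of which the partial sums are compared. *)
Lemma ple_weighted (N : nat) (a b : 'X_{1..N}) (w : 'I_N -> nat) :
  (forall i j : 'I_N, (i <= j)%N -> (w j <= w i)%N) -> ple a b ->
  (\sum_i a i * w i <= \sum_i b i * w i)%N.
Proof.
move=> w_dec /forallP ab.
pose W := (\max_i w i)%N.
have wE i : (w i = \sum_(t < W) (t < w i))%N.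
  have wW : (w i <= W)%N by apply: leq_bigmax.
  have -> : (\sum_(t < W) (t < w i) = \sum_(t < W | (t < w i)%N) 1)%N.
    by rewrite [RHS]big_mkcond; apply: eq_bigr => t _; case: ltnP.
  by rewrite -(big_ord_widen W (fun => 1%N)) // sum1_card card_ord.
have sumE (m : 'X_{1..N}) :
    (\sum_i m i * w i = \sum_(t < W) \sum_(i < N | (t < w i)%N) m i)%N.
  rewrite (eq_bigr (fun i => \sum_(t < W) m i * (t < w i))%N); last first.
    by move=> i _; rewrite -big_distrr -wE.
  rewrite exchange_big /=; apply: eq_bigr => t _; rewrite [RHS]big_mkcond.
  by apply: eq_bigr => i _; case: ltnP; rewrite ?muln1 ?muln0.
rewrite !sumE; apply: leq_sum => t _.
case: (pickP (fun i : 'I_N => t < w i)%N) => [i0 Pi0|P0]; last first.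
  by rewrite !big_pred0.
case: (@arg_maxnP _ i0 (fun i : 'I_N => t < w i)%N (fun i => i) Pi0) => j Pj maxj.
have E (m : 'X_{1..N}) : (\sum_(i < N | (t < w i)%N) m i = psums m j)%N.
  apply: eq_bigl => i; apply/idP/idP => [/maxj //|ij].
  exact: leq_trans Pj (w_dec _ _ ij).
by rewrite !E.
Qed.

(** [A] is thought of as a ring of functions of a parameter [h], with [eps] the
    evaluation at [h = 0] and [iot] the inclusion of the constants.  The
    parameter [c] agrees with [kappa] modulo [h^2]: the terms of order three
    considered below do not see [c2], which can then be chosen so as to make
    eigenvalues distinct. *)
Section Lifting.
Variables (K : numFieldType) (A : idomainType) (h c c2 : A) (kappa : K).
Variables (eps : {rmorphism A -> K}) (iot : {rmorphism K -> A}).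
Hypothesis natU : forall k, (k.+1%:R : A) \is a GRing.unit.
Hypothesis eps_iot : cancel iot eps.
Hypothesis h_neq0 : h != 0.
Hypothesis eps_h : eps h = 0.
Hypothesis eps_ker : forall a, eps a = 0 -> exists b, a = h * b.
Hypothesis cE : c = iot kappa + h ^+ 2 * c2.
Hypothesis kappa_neq0 : kappa != 0.

Variables (D d : nat).
Hypothesis dD : (d <= D)%N.

Local Notation meps := (map_mpoly eps).
Local Notation evA := (@evw A h c D).
Local Notation stab := (@stabop A h c D).
Local Notation s := (sp h).
Local Notation q := (qp h c).

(** The generator of degree [r] at [h = 0]: [r] times the super power sum in
    which a letter [true] counts with the factor [- kappa]. *)
Definition evgen0 M (w : nat -> bool) (r : 'I_D) : {mpoly K[M]} :=
  r.+1%:R *: \sum_(i < M) (if w i then - kappa else 1) *: 'X_i ^+ r.+1.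

Definition ev0 M (w : nat -> bool) : {mpoly K[D]} -> {mpoly K[M]} :=
  mmap (@mpolyC M K) (evgen0 M w).

Lemma eps_c : eps c = kappa.
Proof. by rewrite cE rmorphD rmorphM rmorphXn /= eps_h expr0n mul0r addr0. Qed.

Lemma eps_s : eps s = 1.
Proof. by rewrite /sp rmorphB rmorph1 eps_h subr0. Qed.

Lemma eps_tau b : eps (tau h c b) = 1.
Proof.
rewrite /tau; case: b; last exact: eps_s.
by rewrite /qp rmorphD rmorphM rmorph1 eps_h mul0r addr0.
Qed.

Lemma eps_omega b r : eps (omega h c b r) = (if b then - kappa else 1) * r%:R.
Proof.
rewrite /omega rmorphM rmorph_sum; congr (_ * _).
  by case: b; rewrite ?rmorphN ?rmorph1 ?eps_c.
rewrite (eq_bigr (fun => 1)) => [|l _]; last by rewrite rmorphXn /= eps_tau expr1n.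
by rewrite sumr_const card_ord.
Qed.

Lemma meps_evw M w f : meps (evA M w f) = ev0 M w (meps f).
Proof.
elim/mpoly_ring_ind: f => [a|r|f g IHf IHg|f g IHf IHg].
- by rewrite evwC !map_mpolyC /ev0 mmapC.
- rewrite evwX map_mpolyX1 /ev0 mmapX mmap1U /evgen /evgen0 rmorph_sum scaler_sumr.
  apply: eq_bigr => i _; rewrite /= map_mpolyZ rmorphXn /= map_mpolyX1.
  by rewrite eps_omega scalerA mulrC.
- by rewrite evwD !rmorphD /ev0 mmapD; congr (_ + _); [exact: IHf | exact: IHg].
- rewrite evwM !rmorphM /ev0 rmorphM /=.
  by congr (_ * _); [exact: IHf | exact: IHg].
Qed.

Local Notation w0 := (fun _ : nat => false).

Lemma ev0_inj f : ev0 D w0 f = 0 -> f = 0.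
Proof.
move=> f0; apply: (@powersum_indep K D D (fun r => r.+1%:R)) => //.
- by move=> k; rewrite pnatr_eq0.
- by move=> k; rewrite pnatr_eq0.
rewrite -[RHS]f0; apply: eq_mmap => r; rewrite /evgen0 /=; congr (_ *: _).
by apply: eq_bigr => i _; rewrite scale1r.
Qed.

Lemma evA_inj f : evA D w0 f = 0 -> f = 0.
Proof.
move=> f0; apply: (@powersum_indep A D D (fun r => omega h c false r.+1)) => //.
- by move=> k; apply: contraTneq (natU k) => ->; rewrite unitr0.
- move=> r; apply: contraFneq (pnatr_eq0 K r.+1) => /(congr1 eps).
  by rewrite eps_omega mul1r rmorph0 => /eqP.
rewrite -[RHS]f0 /evw -lock; apply: eq_mmap => r.
by rewrite /evgen scaler_sumr.
Qed.

Lemma eps_ker_mpoly (f : {mpoly A[D]}) : meps f = 0 -> exists f', f = h *: f'.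
Proof.
move=> f0; suff: exists f', \sum_(m <- msupp f) f@_m *: 'X_[m] = h *: f'.
  by rewrite -mpolyE.
elim: (msupp f) => [|m r [f' IHr]]; first by exists 0; rewrite big_nil scaler0.
have [|b Eb] := eps_ker (a := f@_m).
  by rewrite -mcoeff_map_mpoly f0 mcoeff0.
exists (b *: 'X_[m] + f').
by rewrite big_cons IHr Eb scalerDr scalerA.
Qed.

(** At [h = 0] the left side vanishes, while the discriminant does not and the
    all-[false] specialization in [D] variables is injective. *)
Lemma divide_h f G :
  discr D A * evA D w0 f = h *: G -> exists f', f = h *: f'.
Proof.
move=> /(congr1 meps); rewrite rmorphM /= map_discr meps_evw map_mpolyZ eps_h.
rewrite scale0r => /eqP; rewrite mulf_eq0 (negbTE (discr_neq0 _ _)) /=.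
by move=> /eqP/ev0_inj/eps_ker_mpoly.
Qed.

Lemma scaleh_inj n (F G : {mpoly A[n]}) : h *: F = h *: G -> F = G.
Proof.
move=> /eqP; rewrite -subr_eq0 -scalerBr mscalerI (negbTE h_neq0) /=.
by rewrite subr_eq0 => /eqP.
Qed.

Lemma whomog_divh (f : {mpoly A[D]}) : whomog d (h *: f) -> whomog d f.
Proof. by move=> hf m fm; apply: hf; rewrite mcoeffZ mulf_neq0. Qed.

Let k1 : A := iot kappa.
Let k2 : A := iot (kappa ^+ 2 / 2%:R).

Lemma k1k1 : k1 ^+ 2 = 2%:R * k2.
Proof.
rewrite /k1 /k2 -rmorphXn -[2%:R](rmorph_nat iot) -rmorphM /= mulrCA mulfV ?mulr1 //.
by rewrite pnatr_eq0.
Qed.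

(** The remainder of order three in [q_pow]. *)
Fixpoint qrem (a : nat) : A :=
  if a is b.+1 then
    qrem b * q + ((b * b.-1)%:R * k2 * k1 +
      c2 * (1 + b%:R * k1 * h + (b * b.-1)%:R * k2 * h ^+ 2))
  else 0.

Lemma q_pow a :
  q ^+ a = 1 + a%:R * k1 * h + (a * a.-1)%:R * k2 * h ^+ 2 + h ^+ 3 * qrem a.
Proof.
elim: a => [|a IHa]; first by rewrite expr0 /= mul0n; ring.
rewrite exprSr IHa /= /qp cE -/k1.
have -> : (a.+1 * a)%:R = (a * a.-1)%:R + 2%:R * a%:R :> A.
  by rewrite -natrM -natrD; congr (_%:R); case: a {IHa} => // a; lia.
have -> : a.+1%:R = a%:R + 1 :> A by rewrite -addn1 natrD.
set n := (a * a.-1)%:R; set n' := a%:R; set r := qrem a.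
transitivity (1 + n' * k1 * h + h * k1 + (n * k2 + n' * k1 ^+ 2) * h ^+ 2 +
  h ^+ 3 * (r * (1 + h * (k1 + h ^+ 2 * c2)) +
    (n * k2 * k1 + c2 * (1 + n' * k1 * h + n * k2 * h ^+ 2)))).
  by ring.
by rewrite k1k1; ring.
Qed.

Lemma s_pow a : exists u, s ^+ a = 1 - a%:R * h + h ^+ 2 * u.
Proof.
elim: a => [|a [u IHa]]; first by exists 0; rewrite expr0; ring.
exists (u * (1 - h) + a%:R); rewrite exprSr IHa /sp.
by rewrite -(addn1 a) natrD; ring.
Qed.

Section Expansion.
Variable N : nat.
Implicit Types G : {mpoly A[N]}.

Lemma dilate_expand i G : exists V,
  dilate (@wdil A h c N w0) i G - G =
  h *: (k1 *: ('X_i * mderiv i G)) +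
  h ^+ 2 *: (k2 *: ('X_i ^+ 2 * mderiv i (mderiv i G))) + h ^+ 3 *: V.
Proof.
exists (\sum_(m <- msupp G) (qrem (m i) * G@_m) *: 'X_[m]).
apply/mpolyP => m; rewrite mcoeff_dilateB !mcoeffD !mcoeffZ.
rewrite mcoeff_Xderiv mcoeff_X2deriv (raddf_sum (mcoeff m)).
rewrite (@big_seq_single _ _ _ m) ?msupp_uniq //= ?mcoeffZ ?mcoeffX ?eqxx.
- by rewrite /wdil /dil q_pow mulr1; ring.
- by move=> k _ /negbTE km; rewrite mcoeffZ mcoeffX km mulr0.
- by move=> /memN_msupp_eq0 ->; rewrite mulr0 mul0r.
Qed.

(** The lowest term, in [h^2], is a multiple of the Euler operator, a scalar on
    homogeneous polynomials; the next one, in [h^3], is the Jack operator. *)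
Lemma qdiff_expand e G : G \is e.-homog -> exists V,
  qdiff (@wtau A h c N w0) (@wdil A h c N w0) G =
  (h ^+ 2 * k1 * e%:R) *: (discr N A * G) + h ^+ 3 *: (jacknum k1 k2 G + h *: V).
Proof.
move=> hG; pose a i (j : 'I_N) : {mpoly A[N]} := 'X_i - 'X_j.
pose S i := prodvar (a i) (fun j => 'X_j) (others i).
suff /fin_all_exists[V EV] : forall i, exists V,
    dnum (@wtau A h c N w0) i * (dilate (@wdil A h c N w0) i G - G) =
    (h ^+ 2 * k1) *: (discr N A * ('X_i * mderiv i G)) +
    h ^+ 3 *: ((k2 *: (discr N A * ('X_i ^+ 2 * mderiv i (mderiv i G))) +
      k1 *: (S i * discr_co A i * ('X_i * mderiv i G))) + h *: V).
  exists (\sum_i V i); rewrite /qdiff (eq_bigr _ (fun i _ => EV i)).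
  rewrite big_split /= -!scaler_sumr; congr (_ + _ *: _).
    rewrite -mulr_sumr -/(euler G) (euler_homog hG) -!mul_mpolyC mpolyCM.
    by ring.
  by rewrite big_split /= -scaler_sumr.
move=> i; have [V EV] := dilate_expand i G.
have [U EU] := prod_expand (h%:MP_[N]) (a i) (fun j => 'X_j) (others i).
have EN : dnum (@wtau A h c N w0) i = h%:MP *
    ((\prod_(j | j != i) a i j + h%:MP * S i + h%:MP ^+ 2 * U) * discr_co A i).
  rewrite /dnum -mul_mpolyC /wtau /tau /sp opprB addrC subrK; congr (_ * (_ * _)).
  rewrite {}/S; move: EU; rewrite {1 2}/others !big_filter => <-.
  apply: eq_bigr => j _.
  by rewrite /a -mul_mpolyC mpolyCB mpolyC1; ring.
pose P := \prod_(j | j != i) a i j.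
exists (P * discr_co A i * V + S i * discr_co A i *
  (k2%:MP * ('X_i ^+ 2 * mderiv i (mderiv i G)) + h%:MP * V) +
  U * discr_co A i * (k1%:MP * ('X_i * mderiv i G) + h%:MP * k2%:MP *
    ('X_i ^+ 2 * mderiv i (mderiv i G)) + h%:MP ^+ 2 * V)).
have hX k : (h ^+ k)%:MP = h%:MP ^+ k :> {mpoly A[N]} by exact: rmorphXn.
rewrite EN EV (discrE A i) -/P -!mul_mpolyC mpolyCM !hX.
by ring.
Qed.

End Expansion.

Variable P0 : {mpoly K[D]}.
Hypothesis P0_homog : whomog d P0.

Let br (r : 'I_D) : A := omega h c false r.+1.
Let L : A := \prod_r br r.

(** A lift of [P0] whose all-[false] specialization does not depend on [h], both
    up to a scalar: the weight-[r] generator is rescaled so as to absorb the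
    factor [(1 - s ^ r) / h] without dividing by it. *)
Definition lift0 : {mpoly A[D]} :=
  mmap (@mpolyC D A \o iot)
    (fun r => (r.+1%:R * L ^+ r * \prod_(l | l != r) br l) *: 'X_r) P0.

Lemma lift0_homog : whomog d lift0.
Proof.
rewrite /lift0 /mmap big_seq; apply: whomog_sum => m; rewrite mcoeff_msupp => Pm.
rewrite mul_mpolyC; apply: whomogZ; rewrite -(P0_homog Pm) /mmap1 /mnmwgt.
apply: (big_ind2 (fun p k => whomog k p)); first exact: whomog1.
  by move=> p k p' k' hp hp'; apply: whomogM.
move=> r _; elim: (m r) => [|k IHk]; first by rewrite expr0; apply: whomog1.
rewrite exprS mulSn; apply: whomogM => //; apply: whomogZ; exact: whomogX.
Qed.

Lemma L_at r : L = br r * \prod_(l | l != r) br l.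
Proof. by rewrite /L (bigD1 r). Qed.

Lemma evA_lift0 : evA D w0 lift0 = L ^+ d *: map_mpoly iot (ev0 D w0 P0).
Proof.
rewrite /lift0 /ev0 !rmorph_mmap -(mmap_whomog_scale _ _ _ P0_homog).
rewrite (eq_mmapl (f2 := map_mpoly iot \o @mpolyC D K)); last first.
  by move=> a; rewrite /= evwC map_mpolyC.
apply: eq_mmap => r; rewrite /= evwZ evwX.
have -> : evgen h c D w0 r = br r *: \sum_(i < D) 'X_i ^+ r.+1.
  by rewrite /evgen scaler_sumr.
have -> : map_mpoly iot (evgen0 D w0 r) = r.+1%:R *: \sum_(i < D) 'X_i ^+ r.+1.
  rewrite /evgen0 map_mpolyZ (rmorph_nat iot) (raddf_sum (map_mpoly iot)).
  congr (_ *: _); apply: eq_bigr => i _ /=.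
  by rewrite scale1r rmorphXn /= map_mpolyX1.
rewrite !scalerA; congr (_ *: _).
by rewrite exprS {2}(L_at r); ring.
Qed.

Lemma meps_lift0 : exists2 x, x != 0 & meps lift0 = x *: P0.
Proof.
exists (eps L ^+ d).
  apply: expf_neq0; rewrite rmorph_prod; apply/prodf_neq0 => r _.
  by rewrite eps_omega mul1r pnatr_eq0.
rewrite /lift0 rmorph_mmap -[in RHS](mmap_var P0).
rewrite -(mmap_whomog_scale _ _ _ P0_homog).
rewrite (eq_mmapl (f2 := @mpolyC D K)); last first.
  by move=> a; rewrite /= map_mpolyC; congr (_%:MP); apply: eps_iot.
apply: eq_mmap => r; rewrite /= map_mpolyZ map_mpolyX1; congr (_ *: _).
rewrite !rmorphM rmorphXn /= (rmorph_nat eps) exprS {2}(L_at r) rmorphM /=.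
by rewrite {2}/br eps_omega mul1r; ring.
Qed.

Variable e : K.
Hypothesis jackE : jacknum kappa (kappa ^+ 2 / 2%:R) (ev0 D w0 P0) =
  (kappa * e) *: (discr D K * ev0 D w0 P0).

Lemma jacknumZ (x : K) F :
  jacknum kappa (kappa ^+ 2 / 2%:R) (x *: F) =
  x *: jacknum kappa (kappa ^+ 2 / 2%:R) F :> {mpoly K[D]}.
Proof.
rewrite /jacknum scaler_sumr; apply: eq_bigr => i _.
rewrite !mderivZ !(scalerDr, scalerA) -!mul_mpolyC !mpolyCM.
by ring.
Qed.

Lemma ev0Z M w (x : K) f : ev0 M w (x *: f) = x *: ev0 M w f.
Proof. by rewrite /ev0 mmapZ mul_mpolyC. Qed.

Lemma ev0B M w f g : ev0 M w (f - g) = ev0 M w f - ev0 M w g.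
Proof. exact: mmapB. Qed.

(** [stab - h^2 kappa d] vanishes to third order in [h], and its leading term is
    the Jack operator, which acts on [P0] as a scalar. *)
Lemma stabop_step g x : whomog d g -> meps g = x *: P0 -> exists g',
  [/\ whomog d g', meps g' = (x * (kappa * e)) *: P0 &
      stab g = (h ^+ 2 * k1 * d%:R) *: g + h ^+ 3 *: g'].
Proof.
move=> hg eg; pose f := stab g - (h ^+ 2 * k1 * d%:R) *: g.
have [V EV] := qdiff_expand (evw_homog h c D w0 hg).
have Ef : discr D A * evA D w0 f =
    h ^+ 3 *: (jacknum k1 k2 (evA D w0 g) + h *: V).
  rewrite /f rmorphB /= evwZ mulrBr (discr_stabop h c natU D w0 dD hg) EV.
  by rewrite -scalerAr addrAC subrr add0r.
have [f1 E1] : exists f1, f = h *: f1.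
  by apply: divide_h; rewrite Ef exprS -scalerA.
have {}Ef : discr D A * evA D w0 f1 =
    h ^+ 2 *: (jacknum k1 k2 (evA D w0 g) + h *: V).
  apply: scaleh_inj; rewrite scalerA -exprS -Ef E1 evwZ scalerAr.
  by [].
have [f2 E2] : exists f2, f1 = h *: f2.
  by apply: divide_h; rewrite Ef exprS -scalerA.
have {}Ef : discr D A * evA D w0 f2 =
    h *: (jacknum k1 k2 (evA D w0 g) + h *: V).
  apply: scaleh_inj; rewrite scalerA -expr2 -Ef E2 evwZ scalerAr.
  by [].
have [f3 E3] : exists f3, f2 = h *: f3 by apply: divide_h; rewrite Ef.
have {}Ef : discr D A * evA D w0 f3 = jacknum k1 k2 (evA D w0 g) + h *: V.
  by apply: scaleh_inj; rewrite -Ef E3 evwZ scalerAr.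
have Ef3 : f = h ^+ 3 *: f3 by rewrite E1 E2 E3 !scalerA -!expr2 -exprSr.
exists f3; split; last by rewrite -Ef3 /f addrC subrK.
  have : whomog d f.
    rewrite /f -scaleN1r; apply: whomogD; first exact: whomog_stabop.
    by apply: whomogZ; apply: whomogZ.
  by rewrite E1 E2 E3 => hf; move: (@whomog_divh _ hf) => {}hf;
    move: (@whomog_divh _ hf) => {}hf; exact: (@whomog_divh _ hf).
apply/eqP; rewrite -subr_eq0; apply/eqP/ev0_inj; rewrite ev0B.
apply/eqP; rewrite subr_eq0; apply/eqP/(mulfI (discr_neq0 D K)).
have := congr1 meps Ef; rewrite rmorphM rmorphD /= map_discr meps_evw => ->.
rewrite map_mpolyZ eps_h scale0r addr0 map_jacknum meps_evw eg !ev0Z.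
by rewrite /k1 /k2 !eps_iot jacknumZ jackE -scalerAr scalerA.
Qed.

Local Notation en := (qdiff_eig (@wtau A h c D w0) (@wdil A h c D w0)).

(** The coefficient of [h^3] in the eigenvalue, at [h = 0]. *)
Definition eig1 (m : 'X_{1..D}) : K :=
  kappa * \sum_i ((m i * (m i).-1)%:R * (kappa / 2%:R) - (i * m i)%:R).

Lemma eig_expand m : mdeg m = d -> exists2 e1,
  en m = h ^+ 2 * k1 * d%:R + h ^+ 3 * e1 & eps e1 = eig1 m.
Proof.
move=> md; pose n i := (m i * (m i).-1)%:R : A.
suff /fin_all_exists[v Ev] : forall i : 'I_D, exists v,
    (1 - @wtau A h c D w0 i) * (\prod_(l < D | (l < i)%N) @wtau A h c D w0 l) *
      (@wdil A h c D w0 i ^+ m i - 1) =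
    h ^+ 2 * k1 * (m i)%:R + h ^+ 3 * (n i * k2 - (i * m i)%:R * k1 + h * v).
  exists (\sum_i (n i * k2 - (i * m i)%:R * k1 + h * v i)).
    rewrite /qdiff_eig (eq_bigr _ (fun i _ => Ev i)) big_split /= -!mulr_sumr.
    by rewrite -natr_sum -mdegE md.
  rewrite /eig1 rmorph_sum mulr_sumr; apply: eq_bigr => i _.
  rewrite rmorphD rmorphM eps_h mul0r addr0 rmorphB !rmorphM /= !(rmorph_nat eps).
  by rewrite /k1 /k2 !eps_iot; field.
move=> i; rewrite (prod_lt_const (sp h)) /wtau /wdil /tau /dil q_pow.
have [u ->] := s_pow i; rewrite natrM -/(n i).
set mi := (m i)%:R; set r := qrem _; set j := i%:R.
exists (r - j * (n i * k2 + h * r) + u * (mi * k1 + n i * k2 * h + h ^+ 2 * r)).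
by rewrite /sp; ring.
Qed.

Fixpoint kill (l : seq A) (f : {mpoly A[D]}) : {mpoly A[D]} :=
  if l is a :: l' then stab (kill l' f) - a *: kill l' f else f.

Lemma kill_cat l1 l2 f : kill (l1 ++ l2) f = kill l1 (kill l2 f).
Proof. by elim: l1 => //= a l1 ->. Qed.

Lemma killB l f g : kill l (f - g) = kill l f - kill l g.
Proof.
elim: l => //= a l ->; rewrite stabopB -!mul_mpolyC; ring.
Qed.

Lemma killZ l a f : kill l (a *: f) = a *: kill l f.
Proof.
by elim: l => //= b l ->; rewrite stabopZ scalerBr !scalerA [b * a]mulrC.
Qed.

Lemma kill_stab l f : kill l (stab f) = stab (kill l f).
Proof.
by elim: l => //= a l ->; rewrite stabopB stabopZ.
Qed.

Lemma whomog_kill l f : whomog d f -> whomog d (kill l f).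
Proof.
move=> hf; elim: l => //= a l IHl; rewrite -scaleN1r; apply: whomogD.
  exact: whomog_stabop.
by apply: whomogZ; apply: whomogZ.
Qed.

(** Each operator [stab - en m] is divisible by [h ^ 3] on lifts of multiples
    of [P0], on which the quotient acts at [h = 0] as a scalar. *)
Lemma kill_lift (l : seq 'X_{1..D}) f x :
  whomog d f -> meps f = x *: P0 -> {in l, forall m, mdeg m = d} ->
  exists g, [/\ whomog d g,
    meps g = (x * \prod_(m <- l) (kappa * e - eig1 m)) *: P0 &
    kill [seq en m | m <- l] f = h ^+ (3 * size l) *: g].
Proof.
move=> hf ef; elim: l => [|m l IHl] ml.
  by exists f; rewrite big_nil mulr1 scale1r.
have [k lk|g [hg eg Eg]] := IHl; first by apply: ml; rewrite inE lk orbT.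
have [g' [hg' eg' Eg']] := stabop_step hg eg.
have [e1 Em ee1] := eig_expand (ml _ (mem_head _ _)).
exists (g' - e1 *: g); split.
- rewrite -scaleN1r; apply: whomogD => //; apply: whomogZ; exact: whomogZ.
- rewrite rmorphB /= map_mpolyZ ee1 eg' eg scalerA -scalerBl big_cons.
  by congr (_ *: _); ring.
rewrite /= Eg stabopZ Eg' Em mulnS exprD -!mul_mpolyC !mpolyCM !mpolyCD !mpolyCM.
by ring.
Qed.

Lemma mcoeff_stab f m : whomog d f ->
  {in msupp (evA D w0 f), forall m', ple m m' -> m' = m} ->
  (evA D w0 (stab f))@_m = en m * (evA D w0 f)@_m.
Proof. by move=> hf; apply: qdiff_mcoeff; apply: discr_stabop dD hf. Qed.

Lemma msupp_stabB f a m : whomog d f -> m \in msupp (evA D w0 (stab f - a *: f)) ->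
  exists2 m', m' \in msupp (evA D w0 f) & ple m m'.
Proof.
move=> hf; rewrite rmorphB /= evwZ => /msuppB_le; rewrite mem_cat => /orP[].
  exact: qdiff_msupp (discr_stabop h c natU D w0 dD hf) _.
by move=> /msuppZ_le fm; exists m => //; apply: ple_refl.
Qed.

Lemma msupp_kill l f m : whomog d f -> m \in msupp (evA D w0 (kill l f)) ->
  exists2 m', m' \in msupp (evA D w0 f) & ple m m'.
Proof.
move=> hf; elim: l m => [|a l IHl] m /=; first by move=> fm; exists m; rewrite ?ple_refl.
move=> fm; have [m1 /IHl[m2 fm2 le12] le1] := msupp_stabB (@whomog_kill l f hf) fm.
by exists m2 => //; apply: ple_trans le12.
Qed.

(** At an exponent of top rank the triangular operators act diagonally, so their
    composite multiplies the coefficient by a product of differences of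
    eigenvalues. *)
Lemma mcoeff_kill (l : seq 'X_{1..D}) f m : whomog d f ->
  {in msupp (evA D w0 f), forall m', (rank m' <= rank m)%N} ->
  (evA D w0 (kill [seq en k | k <- l] f))@_m =
  \prod_(k <- l) (en m - en k) * (evA D w0 f)@_m.
Proof.
move=> hf top; elim: l => [|k l IHl] /=; first by rewrite big_nil mul1r.
rewrite rmorphB /= evwZ mcoeffB mcoeffZ mcoeff_stab ?IHl ?big_cons.
- by ring.
- exact: whomog_kill.
move=> m' /(msupp_kill hf)[m2 /top le2 le1] mm'; apply/esym/ple_eq_rank => //.
exact: leq_trans (ple_rank le1) le2.
Qed.

Lemma mcoeff_evA_swap i j f m :
  (evA D w0 f)@_(mnm_swap i j m) = (evA D w0 f)@_m.
Proof.
rewrite -mcoeff_sym; congr (_@__).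
rewrite /evw -lock (rmorph_mmap _ _ (msym (tperm i j))).
rewrite (eq_mmapl (f2 := @mpolyC D A)); last by move=> a; rewrite /= /msym mmapC.
apply: eq_mmap => r; rewrite /= /evgen rmorph_sum.
rewrite [RHS](reindex_inj (@perm_inj _ (tperm i j))) /=; apply: eq_bigr => k _.
by rewrite msymZ rmorphXn /= /msym mmapX mmap1U.
Qed.

Variable lam : 'X_{1..D}.
Hypothesis lam_deg : mdeg lam = d.
Hypothesis lam_dec : forall i j : 'I_D, (i <= j)%N -> (lam j <= lam i)%N.
Hypothesis P0_supp : {in msupp (ev0 D w0 P0), forall m, ple m lam}.
Hypothesis P0_lam : (ev0 D w0 P0)@_lam = 1.
Hypothesis kappa_gen : forall a b : nat, (0 < b)%N -> a%:R * kappa + b%:R != 0.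

Lemma eig1E m : mdeg m = d -> eig1 m = kappa * (kappa / 2%:R *
  ((\sum_i m i * m i)%N%:R - d%:R) - (D * d)%:R + (rank m)%:R).
Proof.
move=> md; rewrite /eig1 sumrB -mulr_suml -!natr_sum; congr (_ * _).
have := sum_idx_rank m; rewrite md => <-; rewrite natrD.
have -> : (\sum_i m i * m i = \sum_i m i * (m i).-1 + d)%N.
  rewrite -md mdegE -big_split /=; apply: eq_bigr => i _.
  by case: (m i) => // k /=; lia.
by rewrite natrD; ring.
Qed.

(** The rank of [m] is smaller than that of [lam], and its sum of squares is not
    larger, so the difference of the eigenvalues is [kappa] times half
    of some [a * kappa + b] with [b > 0]. *)
Lemma eig1_neq m : mdeg m = d ->
  (forall i j : 'I_D, (i <= j)%N -> (m j <= m i)%N) ->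
  ple m lam -> m != lam -> eig1 lam - eig1 m != 0.
Proof.
move=> md m_dec m_lam m_neq; rewrite !eig1E // -mulrBr mulf_neq0 //.
have lt_rank : (rank m < rank lam)%N.
  rewrite ltnNge; apply: contra m_neq => le.
  by apply/eqP; apply: ple_eq_rank.
have le_sq : (\sum_i m i * m i <= \sum_i lam i * lam i)%N.
  apply: leq_trans (ple_weighted m_dec m_lam) _.
  under eq_bigr do rewrite mulnC.
  exact: ple_weighted lam_dec m_lam.
set a := (\sum_i m i * m i)%N in le_sq *; set b := (\sum_i _ * _)%N in le_sq *.
have := @kappa_gen (b - a) (2 * (rank lam - rank m)) _.
rewrite natrM !natrB ?(ltnW lt_rank) // => /(_ _)/wrap[]; first by lia.
apply: contra_neq => E.
transitivity (2%:R * (kappa / 2%:R * (b%:R - d%:R) - (D * d)%:R + (rank lam)%:R -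
  (kappa / 2%:R * (a%:R - d%:R) - (D * d)%:R + (rank m)%:R))); first by field.
by rewrite E mulr0.
Qed.

Lemma lift0_supp : {in msupp (evA D w0 lift0), forall m, ple m lam}.
Proof.
move=> m; rewrite evA_lift0 => /msuppZ_le; rewrite mcoeff_msupp mcoeff_map_mpoly.
by rewrite fmorph_eq0 -mcoeff_msupp => /P0_supp.
Qed.

Lemma lift0_lam : (evA D w0 lift0)@_lam = L ^+ d.
Proof. by rewrite evA_lift0 mcoeffZ mcoeff_map_mpoly P0_lam /= rmorph1 mulr1. Qed.

Lemma lift0_max : {in msupp (evA D w0 lift0), forall m, ple lam m -> m = lam}.
Proof. by move=> m /lift0_supp le1 le2; apply: ple_anti. Qed.

(** Compare the coefficients of the leading exponent [lam] in [stab lift0]. *)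
Lemma kappa_e : kappa * e = eig1 lam.
Proof.
have [x x0 Ex] := meps_lift0.
have [g [hg eg Eg]] := stabop_step lift0_homog Ex.
have [e1 Ee1 <-] := eig_expand lam_deg.
have := mcoeff_stab lift0_homog lift0_max.
rewrite Eg rmorphD /= !evwZ mcoeffD !mcoeffZ lift0_lam Ee1 mulrDl.
move=> /addrI; rewrite -mulrA => /(mulfI (expf_neq0 3 h_neq0)) /(congr1 eps).
rewrite rmorphM -mcoeff_map_mpoly meps_evw eg ev0Z mcoeffZ P0_lam mulr1.
have -> : eps (L ^+ d) = x.
  have := congr1 (mcoeff lam) (congr1 meps evA_lift0).
  by rewrite meps_evw Ex ev0Z mcoeffZ P0_lam map_mpolyZ mcoeffZ !mcoeff_map_mpoly
    P0_lam /= !rmorph1 !mulr1.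
by move=> /esym; rewrite mulrC => /(mulfI x0).
Qed.

(** The decreasing exponents strictly below [lam]; it suffices to remove the
    corresponding eigenvalues, by symmetry in the variables. *)
Let lower (m : 'X_{1..D}) : bool := [&& mdeg m == d, ple m lam, m != lam &
  [forall i : 'I_D, forall j : 'I_D, (i <= j)%N ==> (m j <= m i)%N]].

Let T : seq 'X_{1..D} :=
  [seq bmnm m | m <- enum {: 'X_{1..D < d.+1}} & lower (bmnm m)].

Lemma mem_T (m : 'X_{1..D}) : (m \in T) = lower m.
Proof.
apply/mapP/idP => [[b]|Pm]; first by rewrite mem_filter => /andP[Pb _] ->.
have md : (mdeg m < d.+1)%N by case/and4P: Pm => /eqP ->.
by exists (BMultinom md) => //; rewrite mem_filter mem_enum andbT.
Qed.

Let below f := {in msupp (evA D w0 f), forall m, ple m lam /\ m != lam}.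

(** A symmetric polynomial has, among its exponents of top rank, only decreasing
    ones, and [kill] annihilates their coefficients. *)
Lemma kill_T f R : whomog d f -> below f ->
  {in msupp (evA D w0 f), forall m, (rank m <= R)%N} ->
  let f' := kill [seq en m | m <- T] f in
  below f' /\ {in msupp (evA D w0 f'), forall m, (rank m < R)%N}.
Proof.
move=> hf bf topR f'; have b' : below f'.
  move=> m /(msupp_kill hf)[m2 /bf[le2 ne2] le1].
  split; first exact: ple_trans le1 le2.
  by apply: contra_neq ne2 => E; apply: ple_anti => //; rewrite -E.
split=> // m fm'; have [m2 fm2 le1] := msupp_kill hf fm'.
have le_mR : (rank m <= R)%N := leq_trans (ple_rank le1) (topR _ fm2).
rewrite ltn_neqAle le_mR andbT; apply: contraTneq fm' => Em.
rewrite mcoeff_msupp negbK /f' mcoeff_kill // => [|m' /topR]; last by rewrite Em.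
have E2 : m = m2 by apply: ple_eq_rank => //; rewrite Em; apply: topR.
have [|nT] := boolP (m \in T).
  by move=> mT; rewrite (big_rem m) //= subrr !mul0r.
have fm : m \in msupp (evA D w0 f) by rewrite E2.
move: nT; rewrite mem_T /lower (dhomog_mf (evw_homog h c D w0 hf) fm) eqxx /=.
have [-> ->] := bf _ fm; rewrite /= => /forallPn[i /forallPn[j]].
rewrite negb_imply -ltnNge => /andP[le_ij lt_m].
have lt_ij : (i < j)%N.
  by rewrite ltn_neqAle le_ij andbT; apply: contraTneq lt_m => /val_inj ->; rewrite ltnn.
have := rank_swap lt_ij lt_m; rewrite Em ltnNge topR //.
by rewrite mcoeff_msupp mcoeff_evA_swap -mcoeff_msupp.
Qed.

Lemma kill_all r : let f := stab lift0 - en lam *: lift0 in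
  let f' := kill [seq en m | m <- flatten (nseq r T)] f in
  below f' /\ {in msupp (evA D w0 f'), forall m, (rank m + r <= rank lam)%N}.
Proof.
move=> f; have hf : whomog d f.
  rewrite /f -scaleN1r; apply: whomogD; first exact: whomog_stabop lift0_homog.
  by apply: whomogZ; apply: whomogZ; apply: lift0_homog.
elim: r => [|r [IHb IHr]] /=.
  split=> [m fm|m /(msupp_stabB lift0_homog)[m' /lift0_supp le1 le2]]; last first.
    by rewrite addn0; apply: ple_rank; apply: ple_trans le1.
  split.
    have [m' /lift0_supp le1 le2] := msupp_stabB lift0_homog fm.
    exact: ple_trans le1.
  apply: contraTneq fm => ->; rewrite mcoeff_msupp negbK /f rmorphB /= evwZ.
  rewrite mcoeffB mcoeffZ mcoeff_stab ?subrr //; first exact: lift0_homog.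
  exact: lift0_max.
rewrite map_cat kill_cat.
have [m /IHr|bT rT] := kill_T (R := (rank lam - r)%N) (@whomog_kill _ _ hf) IHb.
  by lia.
by split=> // m /rT; lia.
Qed.

(** Remove from [lift0] the eigenvalues of all decreasing exponents below [lam],
    once for each possible rank.  Since [(stab - en lam) lift0] is supported
    strictly below [lam], it is annihilated by this, so the result is an
    eigenvector.  It is divisible by a power of [h], and at [h = 0] the quotient
    is a multiple of [P0] by a product of differences of Jack eigenvalues, none
    of which vanishes. *)
Theorem eigenvector_lift : exists g x,
  [/\ whomog d g, x != 0, meps g = x *: P0 & stab g = en lam *: g].
Proof.
pose l := flatten (nseq (rank lam).+1 T).
have lT m : m \in l -> m \in T.
  by move=> /flattenP[t]; rewrite mem_nseq => /andP[_ /eqP ->].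
have [x x0 Ex] := meps_lift0.
have [m lm|g [hg eg Eg]] := kill_lift (l := l) lift0_homog Ex.
  by have := lT _ lm; rewrite mem_T => /and4P[/eqP].
exists g, (x * \prod_(m <- l) (kappa * e - eig1 m)); split => //.
  rewrite mulf_neq0 // big_seq prodf_seq_neq0; apply/allP => m lm.
  apply/implyP => _; rewrite kappa_e.
  have := lT _ lm; rewrite mem_T => /and4P[/eqP md le ne /forallP dec].
  apply: eig1_neq => // i j ij; have /forallP/(_ j)/implyP := dec i; exact.
apply/eqP; rewrite -subr_eq0; apply/eqP.
have [_ supp0] := kill_all (rank lam).+1.
have {supp0} kf0 : kill [seq en m | m <- l] (stab lift0 - en lam *: lift0) = 0.
  apply: evA_inj; apply: msuppnil0; case E: (msupp _) => [//|m t].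
  by have := supp0 m; rewrite E mem_head => /(_ isT); lia.
have : h ^+ (3 * size l) *: (stab g - en lam *: g) = 0.
  by rewrite scalerBr -stabopZ scalerA [_ * en lam]mulrC -scalerA -Eg
    -kill_stab -killZ -killB.
by move=> /eqP; rewrite mscalerI expf_eq0 (negbTE h_neq0) andbF => /eqP.
Qed.

End Lifting.

(** * Supports of the specializations *)

Lemma poly_graded_free (K : fieldType) (p : nat -> {poly K}) (a : nat -> K)
    (n : nat) :
  (forall k, size (p k) = k.+1) -> \sum_(k < n) a k *: p k = 0 ->
  forall k, (k < n)%N -> a k = 0.
Proof.
move=> szp; elim: n => [//|n IHn]; rewrite big_ord_recr /= => S0.
have an : a n = 0.
  have := congr1 (fun q : {poly K} => q`_n) S0.
  rewrite coefD coefZ coef0 nth_default => [/eqP|].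
    rewrite add0r mulf_eq0 => /orP[/eqP //|].
    have := lead_coef_eq0 (p n); rewrite lead_coefE szp /= => ->.
    by rewrite -size_poly_eq0 szp.
  apply: leq_trans (size_sum _ _ _) _; apply/bigmax_leqP => k _.
  by rewrite (leq_trans (size_scale_leq _ _)) // szp.
move: S0; rewrite an scale0r addr0 => /IHn an' k.
by rewrite ltnS leq_eqVlt => /predU1P[->|/an'].
Qed.

(** The monomials [s ^ r * q ^ k] with [r] less than the degree of [q] have
    distinct degrees. *)
Lemma count_boxes (K : numFieldType) (B : nat) (s q : {poly K})
    (b1 b2 : seq (nat * nat)) :
  (0 < B)%N -> size s = 2 -> size q = B.+1 ->
  all (fun b => (b.1 < B)%N) b1 -> all (fun b => (b.1 < B)%N) b2 ->
  \sum_(b <- b1) s ^+ b.1 * q ^+ b.2 = \sum_(b <- b2) s ^+ b.1 * q ^+ b.2 ->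
  forall b, (b.1 < B)%N -> count_mem b b1 = count_mem b b2.
Proof.
move=> B0 szs szq all1 all2 E b bB.
pose key (b : nat * nat) := (b.1 + b.2 * B)%N.
pose p k := s ^+ (k %% B) * q ^+ (k %/ B).
have keyE (x : nat * nat) : (x.1 < B)%N -> s ^+ x.1 * q ^+ x.2 = p (key x).
  by move=> xB; rewrite /p /key addnC modnMDl modn_small // divnMDl // divn_small ?addn0.
have key_inj (x y : nat * nat) : (x.1 < B)%N -> (y.1 < B)%N ->
    key x = key y -> x = y.
  case: x y => [x1 x2] [y1 y2]; rewrite /key /= => xB yB Exy.
  have := congr1 (modn^~ B) Exy; have := congr1 (divn^~ B) Exy.
  rewrite /= addnC divnMDl // divn_small // addn0 addnC divnMDl // divn_small //.
  by rewrite addn0 modnMDl modn_small // modnMDl modn_small // => -> ->.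
have szp k : size (p k) = k.+1.
  have nz (x : {poly K}) i : size x = i.+1 -> x != 0.
    by move=> szx; rewrite -size_poly_eq0 szx.
  have szX (x : {poly K}) i j : size x = i.+1 -> size (x ^+ j) = (i * j).+1.
    move=> szx; have := size_exp x j; rewrite szx /= => <-.
    by rewrite prednK // lt0n size_poly_eq0 expf_neq0 // (nz _ _ szx).
  rewrite /p size_mul ?expf_neq0 ?(nz _ _ szs) ?(nz _ _ szq) //.
  rewrite (szX _ _ _ szs) (szX _ _ _ szq) mul1n addnS /= addSn.
  by rewrite {3}(divn_eq k B) addnC mulnC.
pose n := (\max_(x <- b :: b1 ++ b2) (key x)).+1.
have sumE (l : seq (nat * nat)) : {subset l <= b1 ++ b2} ->
    all (fun b => (b.1 < B)%N) l ->
    \sum_(x <- l) s ^+ x.1 * q ^+ x.2 =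
    \sum_(k < n) (count (fun x => key x == k) l)%:R *: p k.
  move=> sub_l /allP all_l.
  transitivity (\sum_(x <- l) \sum_(k < n) (key x == k)%:R *: p k).
    rewrite big_seq [RHS]big_seq; apply: eq_bigr => x lx.
    have lt_n : (key x < n)%N.
      by rewrite ltnS leq_bigmax_seq // inE (sub_l _ lx) orbT.
    rewrite (bigD1 (Ordinal lt_n)) //= eqxx scale1r big1 ?addr0.
      by rewrite keyE ?all_l.
    move=> k; rewrite -val_eqE eq_sym => /negbTE /= ->; exact: scale0r.
  rewrite exchange_big; apply: eq_bigr => k _ /=.
  rewrite -scaler_suml -sum1_count natr_sum [in RHS]big_mkcond /=.
  by congr (_ *: _); apply: eq_bigr => x _; case: eqP.
have count_key (l : seq (nat * nat)) : all (fun b => (b.1 < B)%N) l ->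
    count_mem b l = count (fun x => key x == key b) l.
  move=> /allP all_l; apply: eq_in_count => x lx /=.
  by apply/eqP/eqP => [->//|]; apply: key_inj => //; apply: all_l.
rewrite !count_key //; apply/eqP; rewrite -(eqr_nat K) -subr_eq0; apply/eqP.
apply: (@poly_graded_free K p (fun k => (count (fun x => key x == k) b1)%:R -
  (count (fun x => key x == k) b2)%:R) n szp); last first.
  by rewrite ltnS leq_bigmax_seq // mem_head.
under eq_bigr do rewrite scalerBl.
rewrite sumrB -!sumE //; first by rewrite E subrr.
- by move=> x; rewrite mem_cat orbC => ->.
- by move=> x; rewrite mem_cat => ->.
Qed.

Section Words.
Variable w : nat -> bool.

Definition nfalse (i : nat) : nat := (\sum_(l < i) ~~ w l)%N.
Definition ntrue (i : nat) : nat := (\sum_(l < i) w l)%N.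

Lemma nfalseS i : nfalse i.+1 = (nfalse i + ~~ w i)%N.
Proof. by rewrite /nfalse big_ord_recr. Qed.
Lemma ntrueS i : ntrue i.+1 = (ntrue i + w i)%N.
Proof. by rewrite /ntrue big_ord_recr. Qed.

Lemma nfalse_mono i j : (i <= j)%N -> (nfalse i <= nfalse j)%N.
Proof.
elim: j => [|j IHj]; first by rewrite leqn0 => /eqP ->.
rewrite leq_eqVlt nfalseS => /predU1P[->|/IHj]; rewrite ?nfalseS //.
by move=> /leq_trans->//; lia.
Qed.

Lemma ntrue_mono i j : (i <= j)%N -> (ntrue i <= ntrue j)%N.
Proof.
elim: j => [|j IHj]; first by rewrite leqn0 => /eqP ->.
rewrite leq_eqVlt ntrueS => /predU1P[->|/IHj]; rewrite ?ntrueS //.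
by move=> /leq_trans->//; lia.
Qed.

Lemma nfalse_le i : (nfalse i <= i)%N.
Proof.
elim: i => [|i IHi]; first by rewrite /nfalse big_ord0.
by rewrite nfalseS; case: (w i) => /=; lia.
Qed.

(** The [l]-th box of the strip of position [i]: the strips are the rows and
    columns peeled off the quadrant in the order prescribed by the word. *)
Definition sbox (i l : nat) : nat * nat :=
  if w i then ((nfalse i + l)%N, ntrue i) else (nfalse i, (ntrue i + l)%N).

Lemma sbox_inj i l i' l' : sbox i l = sbox i' l' -> (i, l) = (i', l').
Proof.
wlog le_ii' : i l i' l' / (i <= i')%N.
  move=> H E; have [le|/ltnW le] := leqP i i'; first exact: H.
  by apply/esym/H.
rewrite /sbox; move: le_ii'; rewrite leq_eqVlt => /predU1P[->|lt_ii'].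
  by case: (w i') => -[/addnI ->].
have := nfalse_mono lt_ii'; have := ntrue_mono lt_ii'; rewrite nfalseS ntrueS.
by case: (w i) => /= le1 le2; case: (w i') => /= -[]; lia.
Qed.

End Words.

Definition col (la : seq nat) (j : nat) : nat := count (fun k => j < k)%N la.

Lemma part_col (la : seq nat) (i j : nat) : sorted geq la ->
  (j < part la i)%N = (i < col la j)%N.
Proof.
rewrite /part /col; elim: la i => [|k la IHla] i /=; first by rewrite nth_nil.
move=> le_la; have [lt_jk|le_kj] := ltnP j k.
  by case: i => [|i] //=; rewrite add1n ltnS IHla // (path_sorted le_la).
have la0 : count (fun k => j < k)%N la = 0%N.
  apply/eqP; rewrite -leqn0 leqNgt -has_count; apply/hasPn => x lax.
  rewrite -leqNgt (leq_trans _ le_kj) //.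
  have /allP := order_path_min (fun a b c ab bc => leq_trans bc ab : geq b c) le_la.
  exact.
rewrite la0 addn0 ltn0; case: i => [|i] /=; first by rewrite ltnNge le_kj.
by rewrite IHla ?(path_sorted le_la) // la0.
Qed.

Lemma part_dec (la : seq nat) (i j : nat) : sorted geq la -> (i <= j)%N ->
  (part la j <= part la i)%N.
Proof.
move=> la_sorted ij; rewrite leqNgt; apply/negP => lt_p.
have := ltnn (part la i); rewrite part_col // => /negbT.
move: lt_p; rewrite part_col //; lia.
Qed.

(** Reading the word from left to right, peel off [la] its first remaining row at
    each [false] and its first remaining column at each [true]. *)
Definition wlead (w : nat -> bool) (la : seq nat) (M : nat) : 'X_{1..M} :=
  [multinom if w i then col la (ntrue w i) - nfalse w i
            else part la (nfalse w i) - ntrue w i | i < M]%N.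

Definition wboxes (w : nat -> bool) (M : nat) (m : 'X_{1..M}) :
    seq (nat * nat) :=
  flatten [seq [seq sbox w i l | l <- iota 0 (m i)] | i : 'I_M <- enum 'I_M].

Lemma count_wboxes w M (m : 'X_{1..M}) (i : 'I_M) l :
  count_mem (sbox w i l) (wboxes w m) = (l < m i)%N.
Proof.
rewrite /wboxes count_flatten -map_comp sumnE big_map big_enum /=.
rewrite (bigD1 i) //= big1 => [|j ji]; last first.
  apply/count_memPn/mapP => -[l' _ /sbox_inj[/val_inj ij _]].
  by rewrite ij eqxx in ji.
rewrite addn0 count_uniq_mem; last first.
  by rewrite map_inj_uniq ?iota_uniq // => l1 l2 /sbox_inj[].
congr (nat_of_bool _); apply/mapP/idP => [[l' + /sbox_inj[->]]|li].
  by rewrite mem_iota.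
by exists l => //; rewrite mem_iota.
Qed.

Lemma mem_wboxes w M (m : 'X_{1..M}) b :
  b \in wboxes w m -> exists (i : 'I_M) l, (l < m i)%N /\ b = sbox w i l.
Proof.
move=> /flattenP[_ /mapP[i _ ->] /mapP[l]]; rewrite mem_iota => /= li ->.
by exists i, l.
Qed.

(** In position [i] the product of the [tau_l], [l < i], is
    [s ^+ nfalse i * q ^+ ntrue i], and
    [sig_i ^+ m_i - 1] is a geometric sum over the strip of [i]. *)
Lemma qdiff_eigE (A : idomainType) (h c : A) w M (m : 'X_{1..M}) :
  qdiff_eig (@wtau A h c M w) (@wdil A h c M w) m =
  h ^+ 2 * c * \sum_(b <- wboxes w m) sp h ^+ b.1 * qp h c ^+ b.2.
Proof.
rewrite /wboxes big_flatten /= big_map big_enum mulr_sumr /=.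
apply: eq_bigr => i _; rewrite big_map.
have -> : \prod_(l < M | (l < i)%N) @wtau A h c M w l =
    sp h ^+ nfalse w i * qp h c ^+ ntrue w i.
  rewrite -(big_ord_widen M (fun l => tau h c (w l))) ?(ltnW (ltn_ord i)) //.
  elim: (val i) => [|k IHk]; first by rewrite big_ord0 /nfalse /ntrue !big_ord0 mul1r.
  rewrite big_ord_recr /= IHk nfalseS ntrueS !exprD /tau.
  by case: (w k); rewrite /= expr0 expr1; ring.
have -> : iota 0 (m i) = index_iota 0 (m i) by rewrite /index_iota subn0.
rewrite big_mkord /wtau /wdil /tau /dil subrX1 /sbox.
case: (w i) => /=.
  under [in RHS]eq_bigr do rewrite exprD -mulrA [_ * _ ^+ ntrue w i]mulrC mulrA.
  by rewrite -mulr_sumr /sp /qp; ring.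
under [in RHS]eq_bigr do rewrite exprD mulrA.
by rewrite -mulr_sumr /sp /qp; ring.
Qed.

Lemma nfalse_false i : nfalse xpred0 i = i.
Proof. by rewrite /nfalse sum_nat_const card_ord muln1. Qed.

Lemma ntrue_false i : ntrue xpred0 i = 0%N.
Proof. by rewrite /ntrue sum_nat_const card_ord muln0. Qed.

Definition part_mnm (la : seq nat) (D : nat) : 'X_{1..D} :=
  [multinom part la i | i < D].

Lemma count_pboxes la D b : (size la <= D)%N ->
  count_mem b (wboxes xpred0 (part_mnm la D)) = (b.2 < part la b.1)%N.
Proof.
move=> laD; case: b => r k /=.
have sboxE i l : sbox xpred0 i l = (i, l) by rewrite /sbox nfalse_false ntrue_false.
have [rD|Dr] := ltnP r D.
  by have := count_wboxes xpred0 (part_mnm la D) (Ordinal rD) k; rewrite sboxE mnmE.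
rewrite /part nth_default ?(leq_trans laD) //; apply/count_memPn/negP.
move=> /mem_wboxes[i [l [_]]]; rewrite sboxE => -[ri _].
by have := ltn_ord i; rewrite -ri ltnNge Dr.
Qed.

Lemma mdeg_part_mnm la D : (size la <= D)%N -> mdeg (part_mnm la D) = sumn la.
Proof.
move=> la_size; rewrite mdegE sumnE (big_nth 0%N) big_mkord.
under eq_bigr do rewrite mnmE.
rewrite [RHS](big_ord_widen D (fun i => nth 0%N la i)) // [RHS]big_mkcond /=.
apply: eq_bigr => i _; case: ltnP => // li.
by rewrite /part nth_default.
Qed.

Section WordSupport.
Variables (K : numFieldType) (kappa : K) (la : seq nat) (D : nat).
Hypothesis kappa_neq0 : kappa != 0.
Hypothesis kappa_gen : forall a b : nat, (0 < b)%N -> a%:R * kappa + b%:R != 0.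
Hypothesis la_sorted : sorted geq la.
Hypothesis la_size : (size la <= D)%N.
Hypothesis la_deg : (sumn la <= D)%N.
Variables (P0 : {mpoly K[D]}) (e : K).
Hypothesis P0_homog : whomog (sumn la) P0.
Hypothesis jackE :
  jacknum kappa (kappa ^+ 2 / 2%:R) (ev0 kappa D xpred0 P0) =
  (kappa * e) *: (discr D K * ev0 kappa D xpred0 P0).
Hypothesis P0_supp :
  {in msupp (ev0 kappa D xpred0 P0), forall m, ple m (part_mnm la D)}.
Hypothesis P0_lam : (ev0 kappa D xpred0 P0)@_(part_mnm la D) = 1.

Lemma wlead_eq M w (m : 'X_{1..M}) :
  (forall (i : 'I_M) l, (l <= sumn la + D)%N ->
     (l < m i)%N = ((sbox w i l).2 < part la (sbox w i l).1)%N) ->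
  mdeg m = sumn la -> m = wlead w la M.
Proof.
move=> H md; apply/mnmP => i; rewrite mnmE.
have le_m : (m i <= sumn la)%N by rewrite -md mdegE (bigD1 i) //= leq_addr.
set x := (if w i then _ else _).
have E l : (l <= sumn la + D)%N -> (l < m i)%N = (l < x)%N.
  move=> /H ->; rewrite /sbox /x; case: (w i) => /=; last by lia.
  by rewrite part_col //; lia.
apply/eqP; rewrite eqn_leq; apply/andP; split.
  rewrite leqNgt; apply/negP => lt_xm.
  by have := E x; rewrite lt_xm ltnn; lia.
rewrite leqNgt; apply/negP => lt_mx.
by have := E (m i); rewrite lt_mx ltnn; lia.
Qed.

(** Deform [kappa] to [kappa + h^(B - 1)] over [K[h]], with [B] large.  The
    specialization of the lifted eigenvector has an eigenvalue that is, up to a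
    common factor, the sum of [s ^+ r * q ^+ k] over the boxes [(r, k)] of [la];
    a maximal exponent of its support has an eigenvalue given in the same way by
    its own boxes, and the polynomials [s ^+ r * q ^+ k] have distinct degrees.
    So the boxes of a maximal exponent are those of [la], which makes it
    [wlead w la M].  Setting [h = 0] can only shrink the support. *)
Theorem word_support M w :
  {in msupp (ev0 kappa M w P0), forall m, ple m (wlead w la M)}.
Proof.
pose n0 := (M + sumn la + D)%N; pose B := n0.+3.
pose c : {poly K} := kappa%:P + 'X^(n0.+2).
have natU k : (k.+1%:R : {poly K}) \is a GRing.unit.
  by rewrite -(rmorph_nat polyC) rmorph_unit // unitfE pnatr_eq0.
have eps_iot : cancel polyC (horner_eval (0 : K)) by move=> a; apply: hornerC.
have h_neq0 : 'X != 0 :> {poly K} by rewrite polyX_eq0.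
have eps_h : horner_eval (0 : K) 'X = 0 by apply: hornerX.
have eps_ker (a : {poly K}) : horner_eval 0 a = 0 -> exists b, a = 'X * b.
  move=> /rootP/factor_theorem[b ->]; exists b; by rewrite subr0 mulrC.
have cE : c = polyC kappa + 'X ^+ 2 * 'X^n0.
  by rewrite /c -exprD.
have lam_dec (i j : 'I_D) : (i <= j)%N -> (part_mnm la D j <= part_mnm la D i)%N.
  by move=> ij; rewrite !mnmE part_dec.
have [g [x [hg x0 Eg stabg]]] := eigenvector_lift natU eps_iot h_neq0 eps_h
  eps_ker cE kappa_neq0 la_deg P0_homog jackE (mdeg_part_mnm la_size) lam_dec
  P0_supp P0_lam kappa_gen.
have supp_g m : m \in msupp (ev0 kappa M w P0) -> m \in msupp (evw 'X c M w g).
  rewrite !mcoeff_msupp; apply: contra_neq => g0.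
  have := congr1 (mcoeff m) (meps_evw eps_iot eps_h cE M w g).
  rewrite mcoeff_map_mpoly g0 /= /horner_eval horner0 Eg ev0Z mcoeffZ => /esym/eqP.
  by rewrite mulf_eq0 (negbTE x0) => /eqP.
move=> m /supp_g/ex_ple_max[m1 gm1 [le1 max1]].
suff <- : m1 = wlead w la M by [].
have dm1 : mdeg m1 = sumn la := dhomog_mf (evw_homog 'X c M w hg) gm1.
have Eeig : qdiff_eig (@wtau _ 'X c M w) (@wdil _ 'X c M w) m1 =
    qdiff_eig (@wtau _ 'X c D xpred0) (@wdil _ 'X c D xpred0) (part_mnm la D).
  have := qdiff_mcoeff (discr_stabop 'X c natU M w la_deg hg) max1.
  rewrite stabg evwZ mcoeffZ => /esym; apply: mulIf.
  by rewrite -mcoeff_msupp.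
have c_neq0 : c != 0.
  apply: contra_neq kappa_neq0 => c0.
  by have := congr1 (horner_eval 0) cE; rewrite c0 rmorph0 rmorphD rmorphM
    rmorphXn /= eps_h expr0n mul0r addr0 eps_iot.
move: Eeig; rewrite !qdiff_eigE => /(mulfI _) Ebox.
have {}Ebox := Ebox (mulf_neq0 (expf_neq0 2 h_neq0) c_neq0).
have size_s : size (sp ('X : {poly K})) = 2.
  by rewrite /sp -opprB size_polyN -(polyC1) size_XsubC.
have size_q : size (qp ('X : {poly K}) c) = B.+1.
  rewrite /qp /c mulrDr addrA addrC -exprS size_polyDl size_polyXn //.
  rewrite ltnS (leq_trans (size_polyD _ _)) // geq_max size_poly1 /=.
  rewrite (leq_trans (size_polyMleq _ _)) // size_polyX size_polyC.
  by rewrite kappa_neq0.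
have cnt := count_boxes (ltn0Sn _) size_s size_q _ _ Ebox.
apply: (wlead_eq _ dm1) => i l le_l; apply: (can_inj oddb).
rewrite -(count_wboxes w m1) -(count_pboxes _ la_size).
apply: cnt.
- apply/allP => b /mem_wboxes[j [k [lt_k ->]]].
  have := nfalse_le w j; have := ltn_ord j.
  have le_m : (m1 j <= sumn la)%N by rewrite -dm1 mdegE (bigD1 j) //= leq_addr.
  by rewrite /sbox /B /n0; case: (w j) => /=; lia.
- apply/allP => b /mem_wboxes[j [k [lt_k ->]]].
  by have := ltn_ord j; rewrite /sbox nfalse_false /B /n0 /=; lia.
have := nfalse_le w i; have := ltn_ord i.
by rewrite /sbox /B /n0; case: (w i) => /=; lia.
Qed.

End WordSupport.

(** * Quasi-invariance *)

Lemma big_seq_pair (R : nmodType) (I : eqType) (s : seq I) (u v : I)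
    (g : I -> R) :
  uniq s -> u != v -> (forall a, a \in s -> a != u -> a != v -> g a = 0) ->
  (u \notin s -> g u = 0) -> (v \notin s -> g v = 0) ->
  \sum_(a <- s) g a = g u + g v.
Proof.
move=> us uv g0 gu gv.
rewrite (eq_bigr (fun a => (if a == u then g a else 0) +
    (if a == u then 0 else g a))); last first.
  by move=> a _; case: eqP => _; rewrite ?addr0 ?add0r.
rewrite big_split /=; congr (_ + _).
  transitivity (if u == u then g u else 0); last by rewrite eqxx.
  by apply: big_seq_single => // [a _ /negbTE ->//|]; rewrite eqxx.
transitivity (if v == u then 0 else g v); last by rewrite eq_sym (negbTE uv).
apply: big_seq_single => // [a sa av|]; last by rewrite eq_sym (negbTE uv).
by have [//|au] := eqVneq a u; apply: g0.
Qed.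

Section Specializations.
Variables (K : numFieldType) (kappa : K) (D : nat).
Implicit Types (f : {mpoly K[D]}) (w : nat -> bool).
Local Notation ev := (ev0 kappa).

Lemma eq_ev0 M w w' f : (forall i, (i < M)%N -> w i = w' i) ->
  ev M w f = ev M w' f.
Proof.
move=> E; apply: eq_mmap => r; rewrite /evgen0; congr (_ *: _).
by apply: eq_bigr => i _; rewrite E.
Qed.

Lemma ev0_ring_ind M w (P : {mpoly K[M]} -> Prop) :
  (forall c, P c%:MP) -> (forall r : 'I_D, P (evgen0 kappa M w r)) ->
  (forall p q, P p -> P q -> P (p + q)) ->
  (forall p q, P p -> P q -> P (p * q)) -> forall f, P (ev M w f).
Proof.
move=> PC PX PD PM; elim/mpoly_ring_ind=> [c|r|f g Pf Pg|f g Pf Pg].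
- by rewrite /ev0 mmapC; apply: PC.
- by rewrite /ev0 mmapX mmap1U; apply: PX.
- by rewrite /ev0 mmapD; apply: PD.
- by rewrite /ev0 rmorphM; apply: PM.
Qed.

Lemma ev0_homog M w d f : whomog d f -> ev M w f \is d.-homog.
Proof.
apply: whomog_mmap => r; rewrite rpredZ // rpred_sum // => i _; rewrite rpredZ //.
by rewrite mpolyXn dhomogX /= mdegMn mdeg1 mul1n.
Qed.

Definition wswap (i : nat) w : nat -> bool :=
  fun k => if k == i then w i.+1 else if k == i.+1 then w i else w k.

Lemma mcoeff_ev0_swap M w (i j : 'I_M) f m : val j = i.+1 ->
  (ev M (wswap i w) f)@_m = (ev M w f)@_(mnm_swap i j m).
Proof.
move=> ji; rewrite -mcoeff_sym; congr (_@__).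
rewrite /ev0 (rmorph_mmap _ _ (msym (tperm i j))).
rewrite [RHS](eq_mmapl (f2 := @mpolyC M K)); last by move=> a; rewrite /= /msym mmapC.
apply: eq_mmap => r; rewrite /= /evgen0 msymZ; congr (_ *: _).
rewrite rmorph_sum /= (reindex_inj (@perm_inj _ (tperm i j))) /=.
apply: eq_bigr => k _; rewrite msymZ rmorphXn /= /msym mmapX mmap1U.
suff -> : wswap i w (tperm i j k) = w k by [].
have jNi : (nat_of_ord j == i) = false by rewrite -[nat_of_ord j]/(val j) ji; lia.
rewrite /wswap -ji; case: tpermP => [->|->|/eqP ki /eqP kj].
- by rewrite /= jNi eqxx.
- by rewrite eqxx.
- by rewrite !val_eqE (negbTE ki) (negbTE kj).
Qed.

Definition collapse M (i j : 'I_M) : {mpoly K[M]} -> {mpoly K[M]} :=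
  mmap (@mpolyC M K) (fun k => 'X_(if k == j then i else k)).

(** True for the generators, because [- kappa] is the weight of a [true] letter,
    and preserved by products by the Leibniz rule, as [collapse] is a ring
    morphism. *)
Lemma quasi_invariance M w (i j : 'I_M) f : w i = false -> w j = true ->
  collapse i j (kappa *: mderiv i (ev M w f) + mderiv j (ev M w f)) = 0.
Proof.
move=> wi wj; have cD p q : collapse i j (p + q) = collapse i j p + collapse i j q.
  exact: mmapD.
have cM p q : collapse i j (p * q) = collapse i j p * collapse i j q.
  exact: (rmorphM (mmap (@mpolyC M K) _)).
apply: (@ev0_ring_ind M w (fun F =>
  collapse i j (kappa *: mderiv i F + mderiv j F) = 0)) => [a|r|p q IHp IHq|p q IHp IHq].
- by rewrite !mderivC scaler0 addr0 /collapse mmap0.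
- have dE k : mderiv k (evgen0 kappa M w r) =
      (r.+1%:R * (if w k then - kappa else 1) * r.+1%:R) *: 'X_k ^+ r.
    rewrite /evgen0 mderivZ (raddf_sum (mderiv k)) (bigD1 k) //= big1 ?addr0.
      by rewrite mderivZ mderiv_varX eqxx mulr1 !scalerA.
    by move=> l lk; rewrite mderivZ mderiv_varX (negbTE lk) mulr0 scale0r scaler0.
  rewrite !dE wi wj cD /collapse !mmapZ !rmorphXn /= !mmapX !mmap1U eqxx.
  rewrite if_same mulrA -mpolyCM -mulrDl -mpolyCD.
  set a := (X in X%:MP); have -> : a = 0 by rewrite /a; ring.
  by rewrite mpolyC0 mul0r.
- rewrite !mderivD scalerDr addrACA cD.
  by move: IHp IHq => -> ->; rewrite addr0.
- rewrite !mderivM.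
  have -> : kappa *: (mderiv i p * q + p * mderiv i q) +
      (mderiv j p * q + p * mderiv j q) =
      (kappa *: mderiv i p + mderiv j p) * q +
      p * (kappa *: mderiv i q + mderiv j q).
    by rewrite -!mul_mpolyC; ring.
  by rewrite cD !cM IHp IHq mul0r mulr0 addr0.
Qed.

(** The effect of [collapse] on exponents. *)
Definition merge M (i j : 'I_M) (m : 'X_{1..M}) : 'X_{1..M} :=
  [multinom if k == i then m i + m j else if k == j then 0 else m k | k < M]%N.

Lemma collapseX M (i j : 'I_M) m : i != j ->
  collapse i j 'X_[m] = 'X_[merge i j m].
Proof.
move=> ij; rewrite /collapse mmapX /mmap1 [RHS]mpolyXE_id.
have ji : j != i by rewrite eq_sym.
rewrite (bigD1 i) //= (negbTE ij) (bigD1 j) //= eqxx mulrA -exprD.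
rewrite [RHS](bigD1 i) //= [X in _ = _ * X](bigD1 j) //= !mnmE !eqxx.
rewrite (negbTE ji) expr0 mul1r; congr (_ * _).
apply: eq_bigr => k /andP[ki kj]; rewrite mnmE (negbTE ki) (negbTE kj) //.
Qed.

Lemma collapse_diff_coef M w (i j : 'I_M) f v : i != j ->
  w i = false -> w j = true ->
  \sum_(m <- msupp (ev M w f) | (merge i j m - U_(i))%MM == v)
     (ev M w f)@_m * (kappa * (m i)%:R + (m j)%:R) = 0.
Proof.
move=> ij wi wj; have := congr1 (mcoeff v) (quasi_invariance f wi wj).
rewrite mcoeff0 => E; rewrite -[RHS]E; set F := ev M w f.
have -> : collapse i j (kappa *: mderiv i F + mderiv j F) =
    \sum_(m <- msupp F) (F@_m * (kappa * (m i)%:R + (m j)%:R)) *: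
       'X_[merge i j m - U_(i)].
  have cD p q : collapse i j (p + q) = collapse i j p + collapse i j q.
    exact: mmapD.
  have cZ a p : collapse i j (a *: p) = a *: collapse i j p.
    by rewrite /collapse mmapZ mul_mpolyC.
  rewrite {1 2}(mpolyE F) !(raddf_sum (mderiv _)) /= scaler_sumr -big_split /=.
  rewrite (big_morph _ cD (mmap0 _ _)); apply: eq_bigr => m _.
  rewrite !mderivZ !mderivX scalerA cD !cZ !collapseX // !scalerA mulrDr scalerDl.
  congr (_ + _).
    case: (posnP (m i)) => [->|mi]; first by rewrite !mulr0 !scale0r.
    rewrite mulrCA mulrA; congr (_ *: 'X_[_]); apply/mnmP => k.
    rewrite !mnmE eqxx (negbTE ij) !(eq_sym _ k).
    by do 2!case: (k == _) => //=; lia.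
  case: (posnP (m j)) => [->|mj]; first by rewrite !mulr0 !scale0r.
  congr (_ *: 'X_[_]); apply/mnmP => k; rewrite !mnmE eqxx [j == i]eq_sym.
  rewrite (negbTE ij) !(eq_sym _ k).
  case: (eqVneq k i) => [ki|ki] /=; first by lia.
  by case: (k == j) => //=; lia.
rewrite (raddf_sum (mcoeff v)) /= big_mkcond; apply: eq_bigr => m _.
by rewrite mcoeffZ mcoeffX; case: eqP; rewrite ?mulr1 ?mulr0.
Qed.

Lemma big_ord_insub (T : Type) (idx : T) (op : Monoid.com_law idx)
    (L M : nat) (F : 'I_L -> T) : (L <= M)%N ->
  \big[op/idx]_(i < L) F i =
  \big[op/idx]_(k < M) oapp F idx (insub (val k)).
Proof.
move=> LM; transitivity (\big[op/idx]_(i < L) oapp F idx (insub (nat_of_ord i))).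
  by apply: eq_bigr => i _; rewrite valK.
rewrite (big_ord_widen M (fun k => oapp F idx (insub k))) // big_mkcond /=.
by apply: eq_bigr => k _; case: ltnP => // kL; rewrite insubF // ltnNge kL.
Qed.

Definition mnm_extend (L M : nat) (m : 'X_{1..L}) : 'X_{1..M} :=
  [multinom oapp (fun i : 'I_L => m i) 0%N (insub (val k)) | k < M].

Definition truncX (L M : nat) (k : 'I_M) : {mpoly K[L]} :=
  oapp (fun i : 'I_L => 'X_i) 0 (insub (val k)).

Definition trunc (L M : nat) : {mpoly K[M]} -> {mpoly K[L]} :=
  mmap (@mpolyC L K) (@truncX L M).

Lemma trunc_ev0 (L M : nat) w f : (L <= M)%N -> trunc L (ev M w f) = ev L w f.
Proof.
move=> LM; rewrite /trunc /ev0 (rmorph_mmap _ _ (mmap (@mpolyC L K) _)).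
rewrite (eq_mmapl (f2 := @mpolyC L K)); last by move=> a; rewrite /= mmapC.
apply: eq_mmap => r; rewrite /= /evgen0 mmapZ mul_mpolyC; congr (_ *: _).
rewrite raddf_sum /= [RHS](big_ord_insub _ _ LM).
apply: eq_bigr => k _; rewrite mmapZ rmorphXn /= mmapX mmap1U mul_mpolyC /truncX.
by case: insubP => [i kL <-|kL] //=; rewrite expr0n scaler0.
Qed.

Lemma mcoeff_trunc (L M : nat) (F : {mpoly K[M]}) (m : 'X_{1..L}) :
  (L <= M)%N -> (trunc L F)@_m = F@_(mnm_extend M m).
Proof.
move=> LM; rewrite /trunc /mmap (raddf_sum (mcoeff m)).
have mnm_extendE (i : 'I_L) (k : 'I_M) : nat_of_ord k = i -> mnm_extend M m k = m i.
  by move=> ki; rewrite mnmE /= ki valK.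
have powE (mu : 'X_{1..M}) : (mmap1 (@truncX L M) mu)@_m = (mu == mnm_extend M m)%:R.
  rewrite /mmap1; have [allz|] := boolP [forall k : 'I_M, (L <= k)%N ==> (mu k == 0%N)].
    have -> : \prod_(k < M) truncX L k ^+ mu k =
        'X_[[multinom mu (widen_ord LM i) | i < L]].
      rewrite mpolyXE_id (big_ord_insub _ _ LM).
      apply: eq_bigr => k _; rewrite /truncX; case: insubP => [i kL ik|kL] /=.
        by rewrite mnmE; congr (_ ^+ mu _); apply: val_inj.
      by have /forallP/(_ k) := allz; rewrite leqNgt kL => /eqP ->.
    rewrite mcoeffX; congr (nat_of_bool _)%:R; apply/eqP/eqP => [<-|->].
      apply/mnmP => k; rewrite mnmE; case: insubP => [i kL ik|kL] /=.
        by rewrite mnmE; congr (mu _); apply: val_inj.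
      by have /forallP/(_ k) := allz; rewrite leqNgt kL => /eqP.
    by apply/mnmP => i; rewrite mnmE; apply: mnm_extendE.
  move=> /forallPn[k]; rewrite negb_imply => /andP[Lk muk].
  rewrite (bigD1 k) //= /truncX insubF ?ltnNge ?Lk //= expr0n (negbTE muk) mul0r.
  rewrite mcoeff0; case: eqP => // E; move: muk; rewrite E mnmE.
  by rewrite insubF ?ltnNge ?Lk.
rewrite (@big_seq_single _ _ _ (mnm_extend M m)) ?msupp_uniq //=.
- by rewrite mcoeffCM powE eqxx mulr1.
- by move=> mu _ /negbTE ne; rewrite mcoeffCM powE ne mulr0.
- by move=> /memN_msupp_eq0 ->; rewrite mpolyC0 mul0r mcoeff0.
Qed.

End Specializations.

(** * Leading coefficients of neighbouring words *)

Section AdjacentSwaps.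
Variables (w : nat -> bool) (i : nat).

Lemma sum_wswap (g : bool -> nat) l : l != i.+1 ->
  (\sum_(k < l) g (wswap i w k) = \sum_(k < l) g (w k))%N.
Proof.
elim/ltn_ind: l => -[|l] IHl li; first by rewrite !big_ord0.
have [l_eq|l_ne] := eqVneq l i.+1.
  rewrite l_eq !big_ord_recr /= IHl; [|lia..].
  have iN : (i.+1 == i) = false by lia.
  by rewrite /wswap !eqxx iN -!addnA [(g _ + g _)%N]addnC.
by rewrite !big_ord_recr /= IHl // /wswap (negbTE l_ne) ifN.
Qed.

Lemma nfalse_wswap l : l != i.+1 -> nfalse (wswap i w) l = nfalse w l.
Proof. exact: (sum_wswap (fun b => ~~ b)). Qed.

Lemma ntrue_wswap l : l != i.+1 -> ntrue (wswap i w) l = ntrue w l.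
Proof. exact: (sum_wswap id). Qed.

End AdjacentSwaps.

Lemma nfalse_ntrue w i : (nfalse w i + ntrue w i)%N = i.
Proof.
by elim: i => [|i IHi]; rewrite /nfalse /ntrue ?big_ord0 // -/(nfalse w _) -/(ntrue w _)
  nfalseS ntrueS; case: (w i) => /=; lia.
Qed.

Lemma eq_ntrue w w' i : (forall l, (l < i)%N -> w l = w' l) -> ntrue w i = ntrue w' i.
Proof. by move=> E; apply: eq_bigr => l _; rewrite E. Qed.

Definition block (m R i : nat) : bool := (R <= i < R + m)%N.

Lemma ntrue_block m R i : ntrue (block m R) i = minn (i - R) m.
Proof.
elim: i => [|i IHi]; first by rewrite /ntrue big_ord0 min0n.
rewrite ntrueS IHi /block; case: (leqP R i) => Ri /=; last by lia.
by case: (ltnP i (R + m)) => /=; lia.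
Qed.

Lemma nfalse_block m R i : nfalse (block m R) i = (i - minn (i - R) m)%N.
Proof. by have := nfalse_ntrue (block m R) i; rewrite ntrue_block; lia. Qed.

Section LeadingCoefficient.
Variables (K : numFieldType) (kappa : K) (D : nat) (la : seq nat).
Variable P0 : {mpoly K[D]}.
Local Notation ev := (ev0 kappa).
Hypothesis la_sorted : sorted geq la.
Hypothesis P0_supp :
  forall M w, {in msupp (ev M w P0), forall m, ple m (wlead w la M)}.

Definition wlead_coef M w : K := (ev M w P0)@_(wlead w la M).

(** The word has [false true] in positions [i], [j = i + 1], and [m1], [m2] are
    the leading exponents before and after the exchange of the two letters, both
    read in the variables of [w]. *)
Section OneSwap.
Variables (M : nat) (w : nat -> bool) (i j : 'I_M).
Hypotheses (ji : val j = i.+1) (wi : w i = false) (wj : w j = true).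
Let r := nfalse w i.
Let k := ntrue w i.
Let m1 := wlead w la M.
Let m2 := mnm_swap i j (wlead (wswap i w) la M).

Let ijN : i != j.
Proof. by apply/eqP => E; move: wj; rewrite -E wi. Qed.

Let m1i : m1 i = (part la r - k)%N.
Proof. by rewrite mnmE wi. Qed.

Let m1j : m1 j = (col la k - r.+1)%N.
Proof. by rewrite mnmE wj [nat_of_ord j]ji nfalseS ntrueS wi addn1 addn0. Qed.

Let m2i : m2 i = (part la r - k.+1)%N.
Proof.
rewrite mnmE tpermL mnmE [nat_of_ord j]ji nfalseS ntrueS.
rewrite nfalse_wswap ?ntrue_wswap //; try lia.
have -> : wswap i w i = true by rewrite /wswap eqxx -ji.
have -> : wswap i w i.+1 = false by rewrite /wswap eqxx ifN //; lia.
by rewrite addn0 addn1.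
Qed.

Let m2j : m2 j = (col la k - r)%N.
Proof.
rewrite mnmE tpermR mnmE nfalse_wswap ?ntrue_wswap //; try lia.
by have -> : wswap i w i = true by rewrite /wswap eqxx -ji.
Qed.

Let m2k l : l != i -> l != j -> m2 l = m1 l.
Proof.
move=> li lj; rewrite mnmE tpermD 1?eq_sym // !mnmE.
have lj' : nat_of_ord l != i.+1 by rewrite -ji.
have -> : wswap i w l = w l.
  by rewrite /wswap (negbTE lj') (_ : _ == _ = false) //; apply/negbTE.
by rewrite nfalse_wswap ?ntrue_wswap.
Qed.

(** The box [(r, k)] lies outside [la], and both exponents vanish in positions
    [i] and [j]. *)
Lemma wlead_coef_swap_out : (part la r <= k)%N ->
  wlead_coef M (wswap i w) = wlead_coef M w.
Proof.
move=> le_k; rewrite /wlead_coef (mcoeff_ev0_swap _ _ _ _ ji); congr (_@__).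
have col_le : (col la k <= r)%N by rewrite leqNgt -part_col // -leqNgt.
apply/mnmP => l; have [->|li] := eqVneq l i; first by rewrite -/m2 -/m1 m2i m1i; lia.
have [->|lj] := eqVneq l j; first by rewrite -/m2 -/m1 m2j m1j; lia.
exact: m2k.
Qed.

(** The supports of both words bound the exponents of the specialization: those
    that agree with [m1] away from [i], [j] and have the same total degree there
    can only be [m1] and [m2].  Hence quasi-invariance, read at the
    exponent where the two are merged, is a relation between two coefficients. *)
Lemma wlead_coef_swap : (k < part la r)%N ->
  wlead_coef M w * (kappa * (part la r - k)%:R + (col la k - r.+1)%:R) +
  wlead_coef M (wswap i w) * (kappa * (part la r - k.+1)%:R + (col la k - r)%:R) = 0.
Proof.
move=> lt_k; have lt_r : (r < col la k)%N by rewrite -part_col.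
rewrite {2}/wlead_coef (mcoeff_ev0_swap _ _ _ _ ji) -/m2.
rewrite /wlead_coef -/m1 -m1i -m1j -m2i -m2j.
have jiN : (j == i) = false by rewrite eq_sym (negbTE ijN).
set v := (merge i j m1 - U_(i))%MM.
have := collapse_diff_coef kappa P0 v ijN wi wj; rewrite big_mkcond /=.
have mergeE m l : merge i j m l =
    (if l == i then m i + m j else if l == j then 0 else m l)%N by rewrite mnmE.
have merge2 : merge i j m2 = merge i j m1.
  apply/mnmP => l; rewrite !mergeE; case: eqVneq => li; first by lia.
  by case: eqVneq => lj //; apply: m2k.
rewrite (@big_seq_pair _ _ _ m1 m2) ?msupp_uniq // -/v ?merge2 -/v ?eqxx //.
- by apply/eqP => E; have := m2i; rewrite -E m1i; lia.
- move=> m Fm m_1 m_2; case: eqP => // vE.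
  have [m_z|m_pos] := posnP (m i + m j).
    have [-> ->] : m i = 0%N /\ m j = 0%N by lia.
    by rewrite mulr0 addr0 mulr0.
  have mE l : merge i j m l = merge i j m1 l.
    have := congr1 (fun u : 'X_{1..M} => u l) vE; rewrite !mnmBE !mergeE !mnm1E.
    by rewrite eq_sym; case: eqVneq => [_|li]; lia.
  have mk l : l != i -> l != j -> m l = m1 l.
    by move=> li lj; have := mE l; rewrite !mergeE (negbTE li) (negbTE lj).
  have mij : (m i + m j = m1 i + m1 j)%N by have := mE i; rewrite !mergeE eqxx.
  have psi (a b : 'X_{1..M}) : (forall l, l != i -> l != j -> a l = b l) ->
      ple a b -> (a i <= b i)%N.
    move=> ab /forallP/(_ i); rewrite /psums (bigD1 i) //=.
    rewrite [in X in (_ <= X)%N](bigD1 i) //=.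
    rewrite (eq_bigr b) ?leq_add2r // => l /andP[li lNi]; apply: ab => //.
    by apply: contraTneq li => ->; rewrite [nat_of_ord j]ji ltnn.
  have mi : (m i <= m1 i)%N by apply: psi => //; apply: P0_supp.
  have mj : (m j <= m2 j)%N.
    have -> : m j = mnm_swap i j m i by rewrite mnmE tpermL.
    have -> : m2 j = wlead (wswap i w) la M i by rewrite mnmE tpermR.
    apply: psi => [l li lj|].
      by rewrite mnmE tpermD 1?eq_sym // mk // -m2k // mnmE tpermD 1?eq_sym.
    apply: P0_supp; rewrite mcoeff_msupp (mcoeff_ev0_swap _ _ _ _ ji).
    suff -> : mnm_swap i j (mnm_swap i j m) = m by rewrite -mcoeff_msupp.
    by apply/mnmP => l; rewrite !mnmE tpermK.
  have [mi1|] : m i = m1 i \/ m i = m2 i by lia.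
    case/eqP: m_1; apply/mnmP => l; have [->//|li] := eqVneq l i.
    by have [->|lj] := eqVneq l j; [lia | apply: mk].
  move=> mi2; case/eqP: m_2; apply/mnmP => l; have [->//|li] := eqVneq l i.
  by have [->|lj] := eqVneq l j; [lia | rewrite mk // m2k].
- by move=> /memN_msupp_eq0 ->; rewrite mul0r.
- by move=> /memN_msupp_eq0 ->; rewrite mul0r.
Qed.

End OneSwap.

Lemma eq_wlead M w w' : (forall i, (i < M)%N -> w i = w' i) ->
  wlead w la M = wlead w' la M.
Proof.
move=> E; apply/mnmP => i; rewrite !mnmE E //.
have ntrueE : ntrue w i = ntrue w' i.
  by apply: eq_ntrue => l li; apply: E; apply: ltn_trans li _.
have nfalseE : nfalse w i = nfalse w' i.
  by have := nfalse_ntrue w i; have := nfalse_ntrue w' i; lia.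
by rewrite ntrueE nfalseE.
Qed.

Lemma eq_wlead_coef M w w' : (forall i, (i < M)%N -> w i = w' i) ->
  wlead_coef M w = wlead_coef M w'.
Proof. by move=> E; rewrite /wlead_coef (eq_ev0 kappa P0 E) (eq_wlead E). Qed.

Lemma wlead_coef_trunc L M w : (L <= M)%N ->
  (forall i : 'I_M, (L <= i)%N -> wlead w la M i = 0%N) ->
  wlead_coef M w = wlead_coef L w.
Proof.
move=> LM H; rewrite /wlead_coef -(trunc_ev0 _ _ _ LM) mcoeff_trunc //; congr (_@__).
apply/mnmP => i; rewrite [RHS]mnmE; case: insubP => [k kL ki|kL] /=.
  by rewrite !mnmE -ki.
by apply: H; rewrite leqNgt.
Qed.

Hypothesis kappa_gen : forall a b : nat, (0 < b)%N -> a%:R * kappa + b%:R != 0.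

(** The factor gained by the leading coefficient when a letter [true] moves to
    the left of a letter [false], whose row [r] meets its column [k]. *)
Definition swap_factor (r k : nat) : K :=
  if (k < part la r)%N then
    - (kappa * (part la r - k)%:R + (col la k - r.+1)%:R) /
      (kappa * (part la r - k.+1)%:R + (col la k - r)%:R)
  else 1.

Lemma wlead_coef_step M w i r k : (i.+1 < M)%N -> w i = false -> w i.+1 = true ->
  nfalse w i = r -> ntrue w i = k ->
  wlead_coef M (wswap i w) = wlead_coef M w * swap_factor r k.
Proof.
move=> iM wi wj <- <-; have iM' := ltnW iM.
have := @wlead_coef_swap M w (Ordinal iM') (Ordinal iM) erefl wi wj.
have := @wlead_coef_swap_out M w (Ordinal iM') (Ordinal iM) erefl wi wj.
rewrite /swap_factor /=; case: ltnP => [lt_k _ /(_ isT) E|_ -> //]; last first.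
  by rewrite mulr1.
have d0 : kappa * (part la (nfalse w i) - (ntrue w i).+1)%:R +
    (col la (ntrue w i) - nfalse w i)%:R != 0.
  by rewrite mulrC kappa_gen // subn_gt0 -part_col.
apply: (mulIf d0); rewrite -mulrA divfK // mulrN.
by apply/eqP; rewrite -subr_eq0 opprK addrC E.
Qed.

(** The [false] letter in position [R] is moved to the right across the [m] letters
    of the block, one exchange at a time. *)
Lemma wlead_coef_block M m R : (R + m < M)%N ->
  wlead_coef M (block m R) = wlead_coef M (block m R.+1) * \prod_(j < m) swap_factor R j.
Proof.
move=> RM; pose u j i := ((R <= i < R + j) || (R + j < i < R + m.+1))%N.
suff H j : (j <= m)%N ->
    wlead_coef M (u j) = wlead_coef M (block m R.+1) * \prod_(k < j) swap_factor R k.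
  rewrite -H //; apply: eq_wlead_coef => i _; rewrite /block /u; lia.
elim: j => [|j IHj] jm.
  by rewrite big_ord0 mulr1; apply: eq_wlead_coef => i _; rewrite /block /u; lia.
rewrite big_ord_recr /= mulrA -IHj; last exact: ltnW.
have ntrueE : ntrue (u j) (R + j) = j.
  rewrite (@eq_ntrue _ (block m R)); last by move=> l; rewrite /u /block; lia.
  by rewrite ntrue_block; lia.
rewrite -(@wlead_coef_step M (u j) (R + j)); [|lia|..].
- apply: eq_wlead_coef => i _; rewrite /wswap /u.
  by case: eqP => [->|]; last case: eqP => [->|]; lia.
- by rewrite /u; lia.
- by rewrite /u; lia.
- by have := nfalse_ntrue (u j) (R + j); rewrite ntrueE; lia.
- exact: ntrueE.
Qed.

Hypothesis la_size : (size la <= D)%N.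
Hypothesis P0_lam : (ev D xpred0 P0)@_(part_mnm la D) = 1.

(** With the block far enough to the right, its variables have exponent [0] in
    the leading term, which is then the leading term of the Jack function itself,
    with coefficient [1].  With the block at position [n], the hook condition says
    that the variables after the block do not occur in the leading term, so that
    they can be dropped. *)
Lemma wlead_coef_hook n m : (part la n <= m)%N ->
  wlead_coef (n + m) (block m n) =
  \prod_(n <= r < n + D) \prod_(j < m) swap_factor r j.
Proof.
move=> hook; pose M := (n + m + D)%N.
have part0 r : (size la <= r)%N -> part la r = 0%N by apply: nth_default.
have far : wlead_coef M (block m (n + D)) = 1.
  rewrite (@wlead_coef_trunc D); [|by rewrite /M; lia|].
    rewrite (@eq_wlead_coef _ _ xpred0) => [|i iD]; last by rewrite /block; lia.
    rewrite -P0_lam /wlead_coef; congr (_@__).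
    by apply/mnmP => i; rewrite !mnmE nfalse_false ntrue_false subn0.
  move=> i Di; rewrite mnmE nfalse_block ntrue_block /block.
  case: (leqP (n + D) i) => Ri /=; last by rewrite part0 //; have := la_size; lia.
  move: (nat_of_ord i) (ltn_ord i) Di Ri => {}i iM Di Ri.
  rewrite ifT; last by move: iM; rewrite /M; lia.
  apply/eqP; rewrite subn_eq0 (leq_trans (count_size _ _)) //.
  by have := la_size; move: iM; rewrite /M; lia.
have -> : wlead_coef (n + m) (block m n) = wlead_coef M (block m n).
  have LM : (n + m <= M)%N by rewrite /M leq_addr.
  rewrite (wlead_coef_trunc LM) // => i Li.
  rewrite mnmE nfalse_block ntrue_block /block ifF; last by lia.
  suff : (part la (i - minn (i - n) m) <= part la n)%N by lia.
  by apply: part_dec => //; lia.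
suff H d : (d <= D)%N -> wlead_coef M (block m n) = wlead_coef M (block m (n + d)) *
    \prod_(n <= r < n + d) \prod_(j < m) swap_factor r j.
  by rewrite (H D) // far mul1r.
elim: d => [|d IHd] dD; first by rewrite addn0 big_geq // mulr1.
rewrite IHd; last exact: ltnW.
rewrite addnS big_nat_recr ?leq_addr //= wlead_coef_block; last by rewrite /M; lia.
by rewrite -mulrA [X in _ * X]mulrC.
Qed.

End LeadingCoefficient.

(** * Conjugate partitions and the product of the factors *)

Lemma ltn_ext a b : (forall i, (i < a)%N = (i < b)%N) -> a = b.
Proof. by move=> E; have := E a; have := E b; rewrite !ltnn; lia. Qed.

Lemma part_drop n la i : part (drop n la) i = part la (n + i).
Proof. exact: nth_drop. Qed.

Lemma col_drop n la k : sorted geq la -> col (drop n la) k = (col la k - n)%N.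
Proof.
move=> la_sorted; apply: ltn_ext => i.
rewrite -part_col; last exact: drop_sorted.
by rewrite part_drop part_col // ltn_subRL.
Qed.

Lemma part_conj la k : sorted geq la -> part (conj_part la) k = col la k.
Proof.
move=> la_sorted; have [lt_k|le_k] := ltnP k (part la 0).
  by rewrite /part /conj_part (nth_map 0%N) ?size_iota // nth_iota.
rewrite /part nth_default ?size_map ?size_iota //.
by apply/esym/eqP; rewrite -leqn0 leqNgt -part_col // -leqNgt.
Qed.

Lemma sorted_conj la : sorted geq (conj_part la).
Proof.
apply: (homo_sorted (e := leq)) (iota_sorted _ _) => i j ij.
by apply: sub_count => k /=; apply: leq_ltn_trans.
Qed.

Lemma part_conjK la k : sorted geq la -> part (conj_part (conj_part la)) k = part la k.
Proof.
move=> la_sorted; rewrite part_conj ?sorted_conj //; apply: ltn_ext => i.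
by rewrite -part_col ?sorted_conj // part_conj // part_col.
Qed.

Lemma sumn_part la D : (size la <= D)%N -> sumn la = (\sum_(i < D) part la i)%N.
Proof.
by move=> szD; rewrite -(mdeg_part_mnm szD) mdegE; apply: eq_bigr => i _; rewrite mnmE.
Qed.

(** The boxes [(r, k)] of [la] with [n <= r] are the boxes [(k, r - n)] of the
    conjugate of [drop n la]; each contributes [-1] times the corresponding factor
    of [jack_b]. *)
Lemma prod_swap_factor (K : numFieldType) (kappa : K) (la : seq nat) (n m D : nat) :
  sorted geq la -> (size la <= D)%N -> (part la n <= m)%N ->
  \prod_(n <= r < n + D) \prod_(k < m) swap_factor kappa la r k =
  (-1) ^+ sumn (drop n la) * jack_b kappa (conj_part (drop n la)).
Proof.
move=> la_sorted la_size hook.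
have dS : sorted geq (drop n la) by apply: drop_sorted.
have part_m j : (part la (n + j) <= m)%N.
  by rewrite (leq_trans _ hook) // part_dec // leq_addr.
pose F j k := (kappa * (part la (n + j) - k)%:R + (col la k - (n + j).+1)%:R) /
  (kappa * (part la (n + j) - k.+1)%:R + (col la k - (n + j))%:R).
transitivity (\prod_(j < D) ((-1) ^+ part la (n + j) *
    \prod_(k < m | (k < part la (n + j))%N) F j k)).
  rewrite -{1}[n]add0n [(n + D)%N]addnC big_addn addnK big_mkord.
  apply: eq_bigr => j _; rewrite -(big_ord_widen m (F j)) // [(j + n)%N]addnC.
  transitivity (\prod_(k < part la (n + j)) (-1 * F j k)).
    rewrite (big_ord_widen m (fun k => -1 * F j k)) // [RHS]big_mkcond.
    by apply: eq_bigr => k _; rewrite /swap_factor mulN1r mulNr.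
  by rewrite big_split /= prodr_const card_ord.
rewrite big_split /= prodrXr; congr (_ ^+ _ * _).
  rewrite (@sumn_part _ D); last by rewrite size_drop; lia.
  by apply: eq_bigr => j _; rewrite part_drop.
rewrite (exchange_big_dep xpredT) //= /jack_b.
rewrite size_map size_iota part_drop addn0.
rewrite (big_ord_widen m (fun k => \prod_(j < part (conj_part (drop n la)) k)
    (((arm (conj_part (drop n la)) k j)%:R +
      kappa * (leg (conj_part (drop n la)) k j)%:R + kappa) /
     ((arm (conj_part (drop n la)) k j)%:R +
      kappa * (leg (conj_part (drop n la)) k j)%:R + 1)))) // [RHS]big_mkcond.
apply: eq_bigr => k _; case: ltnP => [lt_k|le_k]; last first.
  rewrite big_pred0 // => j; apply/negbTE; rewrite -leqNgt (leq_trans _ le_k) //.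
  by rewrite part_dec // leq_addr.
have pE : part (conj_part (drop n la)) k = (col la k - n)%N.
  by rewrite part_conj // col_drop.
have le_D : (part (conj_part (drop n la)) k <= D)%N.
  by rewrite pE (leq_trans (leq_subr _ _)) // (leq_trans (count_size _ _)).
rewrite (big_ord_widen D (fun j =>
    (((arm (conj_part (drop n la)) k j)%:R +
      kappa * (leg (conj_part (drop n la)) k j)%:R + kappa) /
     ((arm (conj_part (drop n la)) k j)%:R +
      kappa * (leg (conj_part (drop n la)) k j)%:R + 1)))) //.
apply: eq_big => [j|j lt_j]; first by rewrite pE part_col // ltn_subRL.
rewrite /arm /leg pE part_conjK // part_drop /F.
have lt_c : (n + j < col la k)%N by rewrite -part_col.
congr (_ / _).
  have -> : (part la (n + j) - k = (part la (n + j) - k.+1).+1)%N by lia.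
  have -> : (col la k - n - j.+1 = col la k - (n + j).+1)%N by lia.
  by rewrite -[in LHS]natr1; ring.
have -> : (col la k - (n + j) = (col la k - n - j.+1).+1)%N by lia.
by rewrite -[in LHS]natr1; ring.
Qed.

(** * From symmetric functions to polynomials in power sums *)

Section HomogeneousPreimage.
Variables (K : numFieldType) (kappa : K) (D : nat).

(** The components of [f] of other weights specialize to components of other
    degrees, hence to zero, and the specialization is injective. *)
Lemma whomog_ev0 d (f : {mpoly K[D]}) :
  ev0 kappa D xpred0 f \is d.-homog -> whomog d f.
Proof.
move=> hf; pose g : {mpoly K[D]} :=
  \sum_(m <- msupp f | mnmwgt m != d) f@_m *: 'X_[m].
pose fd : {mpoly K[D]} := \sum_(m <- msupp f | mnmwgt m == d) f@_m *: 'X_[m].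
have fE : f = fd + g by rewrite [LHS]mpolyE (bigID (fun m => mnmwgt m == d)).
have whX m : whomog (mnmwgt m) ('X_[m] : {mpoly K[D]}).
  by move=> m'; rewrite mcoeffX; case: (m =P m') => [->//|_]; rewrite eqxx.
have hfd : whomog d fd.
  apply: whomog_sum => m /eqP <-; apply: whomogZ; exact: whX.
suff g0 : g = 0 by rewrite fE g0 addr0.
apply: (@ev0_inj _ kappa); apply/mpolyP => m'; rewrite mcoeff0.
have hg : ev0 kappa D xpred0 g \is d.-homog.
  have -> : g = f - fd by rewrite {1}fE addrC addKr.
  by rewrite ev0B rpredB // ev0_homog.
have [m'd|m'd] := eqVneq (mdeg m') d; last exact: dhomog_nemf_coeff hg m'd.
rewrite /g /ev0 (raddf_sum (mmap _ _)) (raddf_sum (mcoeff m')) /= big1 // => m md.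
rewrite -/(ev0 kappa D xpred0 _) ev0Z mcoeffZ.
rewrite (dhomog_nemf_coeff (ev0_homog kappa D xpred0 (@whX m))) ?mulr0 //.
by suff: mdeg m' != mnmwgt m by []; rewrite m'd eq_sym.
Qed.

End HomogeneousPreimage.

(** A symmetric function involves finitely many power sums only.  The factors
    [r + 1] are those of the generators [evgen0]; [B] allows [D] to be as large as
    desired. *)
Lemma subst_psum_mmap (K : numFieldType) (P : symfun K) (B : nat) :
  exists (D : nat) (P0 : {mpoly K[D]}), (B <= D)%N /\
    forall N (q : nat -> {mpoly K[N]}), subst_psum q P =
      mmap (@mpolyC N K) (fun r : 'I_D => r.+1%:R *: q r.+1) P0.
Proof.
pose S := (\sum_(m <- monalg.msupp P) \sum_(r <- finsupp m) r.+1)%N.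
pose D := (B + S)%N; exists D.
exists (\sum_(m <- monalg.msupp P) monalg.mcoeff m P *:
  \prod_(r < D) (r.+1%:R^-1 *: 'X_r) ^+ m r).
split=> [|N q]; first exact: leq_addr.
rewrite /subst_psum monalg.mmapE (raddf_sum (mmap _ _)) big_seq [RHS]big_seq.
apply: eq_bigr => m mP /=; rewrite mmapZ rmorph_prod /=; congr (_ * _).
have ltD r : r \in finsupp m -> (r < D)%N.
  move=> rm; rewrite /D /S (big_rem m) //= (big_rem r) //=; lia.
transitivity (\prod_(r < D) q r.+1 ^+ m r); last first.
  apply: eq_bigr => r _; rewrite rmorphXn /= mmapZ mmapX mmap1U mul_mpolyC.
  by rewrite scalerA mulVf ?scale1r // pnatr_eq0.
rewrite /subst_mon (perm_big [seq r <- index_iota 0 D | r \in finsupp m]) /=.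
  rewrite big_filter big_mkcond big_mkord; apply: eq_bigr => r _.
  by case: ifPn => //; rewrite -cmE_eq0 => /eqP ->.
apply: uniq_perm; rewrite ?fset_uniq ?filter_uniq ?iota_uniq // => r.
by rewrite mem_filter mem_index_iota /=; case: (boolP (r \in _)) => // /ltD ->.
Qed.

Section JackEigen.
Variables (K : numFieldType) (N : nat).

Lemma jacknum_jack_op (theta : K) (F : {mpoly K[N]}) : theta != 0 ->
  tofrac (jacknum theta^-1 (theta^-1 ^+ 2 / 2%:R) F) =
  tofrac (theta^-1 *: discr N K) * jack_op theta F.
Proof.
move=> theta0; rewrite /jack_op mulrDr /jacknum big_split rmorphD /=.
congr (_ + _).
  rewrite -rmorphM; congr tofrac.
  rewrite -scaler_sumr -mulr_sumr -scalerAl -scalerAr scalerA.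
  by congr (_ *: _); field; rewrite theta0.
rewrite rmorph_sum mulr_sumr; apply: eq_bigr => i _.
rewrite (discrE K i) -!mul_mpolyC !rmorphM /= rmorph_prodvar prodvar_div; last first.
  move=> j; rewrite mem_filter => /andP[ji _]; rewrite /= tofrac_eq0.
  apply/eqP => /(congr1 (mcoeff U_(i))); rewrite mcoeffB !mcoeffX eqxx mcoeff0.
  by rewrite eq_mnm1 (negbTE ji) subr0 => /eqP; rewrite oner_eq0.
rewrite /others !big_filter [in RHS]rmorph_prod /=.
rewrite [X in _ = _ * X](eq_bigl (fun j => j != i)) => [|j]; last by rewrite eq_sym.
rewrite [X in _ = _ * X](eq_bigr (fun j => tofrac 'X_i * tofrac (mderiv i F) *
    (tofrac 'X_j / tofrac ('X_i - 'X_j)))) => [|j _].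
  by rewrite -[in RHS]mulr_sumr; ring.
by rewrite rmorphM /=; ring.
Qed.

End JackEigen.

(** * Monomial symmetric polynomials *)

Definition parts_of N (m : 'X_{1..N}) : seq nat :=
  [seq k <- [seq m i | i <- enum 'I_N] | k != 0%N].

Lemma sumn_take n s : sumn (take n s) = (\sum_(k < n) nth 0 s k)%N.
Proof.
elim: s n => [|x s IHs] [|n] /=; rewrite ?big_ord0 //.
  by rewrite big1 // => k _; rewrite nth_nil.
by rewrite big_ord_recl IHs.
Qed.

Lemma leq_sumn_take k l s : (k <= l)%N -> (sumn (take k s) <= sumn (take l s))%N.
Proof.
move=> kl; rewrite -[in leqRHS](cat_take_drop k (take l s)) sumn_cat.
by rewrite take_takel // leq_addr.
Qed.

Lemma sumn_filter0 s : sumn [seq k <- s | k != 0%N] = sumn s.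
Proof. by elim: s => //= -[|x] s /= ->. Qed.

Lemma nth_parts N (m : 'X_{1..N}) (i : 'I_N) :
  nth 0%N [seq m i | i <- enum 'I_N] i = m i.
Proof. by rewrite (nth_map i) ?size_enum_ord // nth_ord_enum. Qed.

Lemma psumsE N (m : 'X_{1..N}) (i : 'I_N) :
  psums m i = sumn (take i.+1 [seq m i | i <- enum 'I_N]).
Proof.
rewrite sumn_take (big_ord_widen N (fun k => nth 0%N _ k)) //.
by apply: eq_bigr => k _; rewrite nth_parts.
Qed.

Lemma sumn_parts N (m : 'X_{1..N}) : sumn (parts_of m) = mdeg m.
Proof.
by rewrite sumn_filter0 sumnE big_map big_enum mdegE.
Qed.

(** A selection [u] of entries of a weakly decreasing sequence sums to at most its
    first entries; the induction exchanges the head of [u] with the largest entry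
    when the latter was not selected. *)
Lemma sumn_take_sorted (u v mu : seq nat) : sorted geq mu ->
  perm_eq (u ++ v) mu -> (sumn u <= sumn (take (size u) mu))%N.
Proof.
elim: mu u v => [|x mu IHmu] u v mu_sorted uv.
  have /eqP : size (u ++ v) == 0%N by rewrite (perm_size uv).
  by move/size0nil; case: u {uv}.
have mu_tail : sorted geq mu := path_sorted mu_sorted.
have xuv : x \in u ++ v by rewrite (perm_mem uv) mem_head.
have [xu|xu] := boolP (x \in u).
  have pu := perm_to_rem xu; rewrite (perm_sumn pu) (perm_size pu) /= leq_add2l.
  apply: (IHmu _ v) => //; rewrite -(perm_cons x) -(permPr uv) -cat_cons.
  by rewrite perm_cat2r perm_sym.
move: xuv; rewrite mem_cat (negbTE xu) /= => xv; have pv := perm_to_rem xv.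
case: u uv xu => [//|y u] uv _ /=; apply: leq_add.
  have : y \in x :: mu by rewrite -(perm_mem uv) mem_head.
  rewrite inE => /predU1P[->//|].
  by have /allP := order_path_min (rev_trans leq_trans) mu_sorted; apply.
apply: (IHmu _ (y :: rem x v)) => //; rewrite -(perm_cons x).
rewrite -(permPr uv); apply/seq.permP => a.
by rewrite /= !count_cat /= (seq.permP pv) /=; lia.
Qed.

Lemma mcoeff_monomial_sym (K : fieldType) N (mu : seq nat) m :
  (monomial_sym K N mu)@_m = (perm_eq (parts_of m) mu)%:R.
Proof.
rewrite /monomial_sym (raddf_sum (mcoeff m)) /=.
have [pm|npm] := boolP (perm_eq _ _); last first.
  rewrite big1 // => m' pm'; rewrite mcoeffX; case: eqP => // E.
  by rewrite /parts_of -E pm' in npm.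
have md : (mdeg m < (sumn mu).+1)%N by rewrite ltnS -sumn_parts (perm_sumn pm).
rewrite (bigD1 (BMultinom md)) //= mcoeffX eqxx big1 ?addr0 // => m' /andP[_ m'm].
rewrite mcoeffX; case: eqP => // E; case/eqP: m'm; exact: val_inj.
Qed.

(** A rearrangement of [mu] has smaller partial sums than [mu] itself. *)
Lemma ple_dominated la mu N (m : 'X_{1..N}) : sorted geq mu ->
  dominated mu la -> perm_eq (parts_of m) mu -> ple m (part_mnm la N).
Proof.
move=> mu_sorted [_ dom] pm; apply/forallP => i.
rewrite psumsE [X in (_ <= X)%N](_ : _ = sumn (take i.+1 la)); last first.
  rewrite sumn_take (big_ord_widen N (fun k => nth 0%N la k)) //.
  by apply: eq_bigr => k _; rewrite mnmE.
apply: leq_trans (dom i.+1); rewrite -sumn_filter0.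
set s := [seq _ | _ <- _]; set u := [seq _ <- _ | _].
have := @sumn_take_sorted u [seq k <- drop i.+1 s | k != 0%N] mu mu_sorted.
rewrite -filter_cat cat_take_drop => /(_ pm)/leq_trans-> //.
apply: leq_sumn_take; rewrite size_filter (leq_trans (count_size _ _)) //.
by rewrite size_take_min geq_minl.
Qed.

Lemma parts_of_part_mnm la N : 0%N \notin la -> (size la <= N)%N ->
  parts_of (part_mnm la N) = la.
Proof.
move=> la0 szN; rewrite /parts_of.
have -> : [seq part_mnm la N i | i <- enum 'I_N] = [seq part la i | i <- iota 0 N].
  by rewrite -val_enum_ord -map_comp; apply: eq_map => i; rewrite /= mnmE.
rewrite -(subnKC szN) iotaD map_cat filter_cat add0n.
rewrite -[map _ _]/(mkseq (nth 0%N la) _) mkseq_nth.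
rewrite (_ : [seq k <- la | _] = la); last first.
  by apply/all_filterP/allP => k kla; apply: contraNneq la0 => <-.
rewrite [X in _ ++ X](_ : _ = [::]) ?cats0 //.
apply/eqP; rewrite -[_ == _]negbK -has_filter; apply/hasPn => _ /mapP[i + ->].
by rewrite mem_iota => /andP[le_i _]; rewrite /part nth_default.
Qed.

Lemma monic_triangular_restrict (K : fieldType) la (P : symfun K) N :
  is_partition la -> (size la <= N)%N -> monic_triangular la P ->
  {in msupp (Defs.restrict N P),
     forall m, ple m (part_mnm la N) /\ mdeg m = sumn la} /\
  (Defs.restrict N P)@_(part_mnm la N) = 1.
Proof.
move=> /andP[la_sorted la0] szN [s [u [hs /(_ N) ->]]].
have coefE m : (monomial_sym K N la + \sum_(mu <- s) u mu *: monomial_sym K N mu)@_m =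
    (perm_eq (parts_of m) la)%:R + \sum_(mu <- s) u mu * (perm_eq (parts_of m) mu)%:R.
  rewrite mcoeffD mcoeff_monomial_sym (raddf_sum (mcoeff m)); congr (_ + _).
  by apply: eq_bigr => mu _; rewrite /= mcoeffZ mcoeff_monomial_sym.
split=> [m|].
  rewrite mcoeff_msupp coefE => c0.
  suff [mu [mu_sorted dom pm]] : exists mu, [/\ sorted geq mu, dominated mu la &
      perm_eq (parts_of m) mu].
    split; first exact: ple_dominated dom pm.
    by rewrite -sumn_parts (perm_sumn pm) dom.1.
  have [pm|npm] := boolP (perm_eq (parts_of m) la).
    by exists la; split=> //; split.
  have [/hasP[mu smu pm]|/hasPn H] := boolP (has (perm_eq (parts_of m)) s).
    by have [/andP[? _] ? _] := hs mu smu; exists mu.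
  case/eqP: c0; rewrite (negbTE npm) add0r big_seq big1 // => mu /H/negbTE->.
  exact: mulr0.
rewrite coefE parts_of_part_mnm // perm_refl big_seq.
rewrite big1 ?addr0 // => mu /hs[/andP[mu_sorted _] _ mula].
case: (boolP (perm_eq la mu)) => [pm|_]; last by rewrite mulr0.
case: mula; apply/esym; apply: (sorted_eq (rev_trans leq_trans)) => //.
by move=> x y /andP[xy yx]; apply: anti_leq; rewrite yx.
Qed.

(** * Super Jack polynomials *)

Section SuperJack.
Variables (K : numFieldType) (theta : K) (la : seq nat) (P : symfun K).
Hypothesis theta_gen : forall a b : nat, (0 < b)%N -> a%:R + b%:R * theta != 0.
Hypothesis la_part : is_partition la.
Hypothesis P_jack : is_jack theta la P.

(** The super Jack polynomial is the specialization to the word with [n] letters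
    [false] followed by [nt] letters [true].  The condition on [theta] makes the
    Jack eigenvalues of comparable partitions distinct, and keeps the denominators
    of the factors of the leading coefficient away from zero. *)
Theorem super_jack_lead n nt
    (lead := join_exp n nt (part la) (part (conj_part (drop n la)))) :
  in_hook n nt la ->
  {in msupp (superize theta n nt P), forall m, ple m lead} /\
  (superize theta n nt P)@_lead =
    (-1) ^+ sumn (drop n la) * jack_b theta^-1 (conj_part (drop n la)).
Proof.
move=> hook; have [la_sorted _] := andP la_part.
have theta0 : theta != 0 by have := @theta_gen 0 1 isT; rewrite add0r mul1r.
set kappa := theta^-1; have kappa0 : kappa != 0 by rewrite invr_eq0.
have kappa_gen a b : (0 < b)%N -> a%:R * kappa + b%:R != 0.
  move=> /(theta_gen a) ab0; rewrite -(mulfK theta0 (_ + _)) mulf_neq0 //.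
  by rewrite mulrDl divfK.
have [D [P0 [le_D PE]]] := subst_psum_mmap P (size la + sumn la).
have la_size : (size la <= D)%N by apply: leq_trans le_D; apply: leq_addr.
have la_deg : (sumn la <= D)%N by apply: leq_trans le_D; apply: leq_addl.
have [[L [stabL [e LP]]] mono] := P_jack.
have resE : Defs.restrict D P = ev0 kappa D xpred0 P0.
  rewrite /Defs.restrict PE; apply: eq_mmap => r; congr (_ *: _).
  by apply: eq_bigr => i _; rewrite scale1r.
have [supp0 lam0] := monic_triangular_restrict la_part la_size mono.
rewrite resE in supp0 lam0.
have P0_homog : whomog (sumn la) P0.
  by apply: (@whomog_ev0 _ kappa); apply/dhomogP => m /supp0[].
have P0_supp : {in msupp (ev0 kappa D xpred0 P0), forall m, ple m (part_mnm la D)}.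
  by move=> m /supp0[].
have jackE : jacknum kappa (kappa ^+ 2 / 2%:R) (ev0 kappa D xpred0 P0) =
    (kappa * e) *: (discr D K * ev0 kappa D xpred0 P0).
  apply/eqP; rewrite -tofrac_eq jacknum_jack_op // -resE stabL LP.
  rewrite -rmorphM tofrac_eq /Defs.restrict linearZ /=.
  by rewrite -scalerAl -scalerAr scalerA.
have supp := word_support kappa0 kappa_gen la_sorted la_size la_deg P0_homog
  jackE P0_supp lam0.
have SPE : superize theta n nt P = ev0 kappa (n + nt) (block nt n) P0.
  rewrite /superize PE; apply: eq_mmap => r; congr (_ *: _).
  rewrite big_split_ord /= /super_psum; congr (_ + _).
    apply: eq_bigr => i _; rewrite /block /= leqNgt ltn_ord scale1r //.
  rewrite -scaleNr scaler_sumr; apply: eq_bigr => i _.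
  by rewrite /block /= leq_addr ltn_add2l ltn_ord.
have leadE : lead = wlead (block nt n) la (n + nt).
  apply/mnmP => i; rewrite !mnmE nfalse_block ntrue_block /block.
  case: splitP => j ij; rewrite ij.
    have jn := ltn_ord j; rewrite ifF; last by lia.
    by rewrite (_ : (j - n = 0)%N) ?min0n ?subn0 //; lia.
  have jn := ltn_ord j; rewrite ifT; last by lia.
  rewrite part_conj ?drop_sorted // col_drop //.
  have -> : minn (n + j - n) nt = j by lia.
  by have -> : (n + j - j = n)%N by lia.
rewrite SPE leadE; split; first exact: supp.
rewrite -/(wlead_coef kappa la P0 (n + nt) (block nt n)) wlead_coef_hook //.
exact: prod_swap_factor.
Qed.

End SuperJack.

Local Open Scope complex_scope.

Theorem lemma3p2 (R : realType) (n nt : nat) (theta : R)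
    (htheta : forall q : rat, q <= 0 -> theta <> ratr q)
    (la : seq nat) (hla : is_partition la) (hhook : in_hook n nt la)
    (SP : {mpoly R[i][n + nt]})
    (hSP : is_super_jack theta%:C la SP) :
  let lead := join_exp n nt (part la) (part (conj_part (drop n la))) in
  (forall m : 'X_{1..(n + nt)}, m \in msupp SP -> partial_sum_le m lead) /\
  SP@_lead = (-1) ^+ sumn (drop n la)
             * jack_b (theta%:C)^-1 (conj_part (drop n la)).
Proof.
have theta_gen a b : (0 < b)%N -> a%:R + b%:R * theta%:C != 0.
  move=> b0; rewrite -!(rmorph_nat (real_complex R)) -rmorphM -rmorphD /=.
  rewrite -[0](rmorph0 (real_complex R)) (inj_eq (@complexI _)).
  apply/eqP => E; have bR : b%:R != 0 :> R by rewrite pnatr_eq0 -lt0n.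
  apply: (htheta (- (a%:R / b%:R))); first by rewrite oppr_le0 divr_ge0 ?ler0n.
  rewrite rmorphN fmorph_div !rmorph_nat; apply: (mulfI bR).
  by apply/eqP; rewrite mulrN mulrCA divff // mulr1 -addr_eq0 addrC E.
have [P P_jack ->] := hSP.
have [supp lead_coef] := super_jack_lead theta_gen hla P_jack hhook.
by split=> // m /supp/pleP.
Qed.
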